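(* Let $b$ be a broken closed string on $\Lambda^0\subset(\mathbb{R}^3_{\Lambda^\pm},\xi_{\Lambda^\pm})$ of the form $$b=\zeta_1\ast(a_1\kappa_1)\ast\cdots\ast\zeta_n\ast(a_n\kappa_n)$$ where each $\zeta_k$ is a path in $\Lambda^0$, each $\kappa_k$ is a chord of $\Lambda^0$ with respect to $R_\epsilon$, and $a_k\in\{\pm1\}$. Write $\kappa_k=(r_{k_1}\cdots r_{k_{n_k}})$ for the word of chords with boundary on $\Lambda^0\subset(\mathbb{R}^3,\xi_{std})$ corresponding to $\kappa_k$. Then $$\mathrm{M}_{X,Y}(b)=\sum_{k=1}^n\left(\frac{\theta(\zeta_k)}{\pi}-\frac12+a_k\,m_{X,Y}(\kappa_k)\right),\qquad m_{X,Y}(\kappa_k)=\sum_{l=1}^{n_k-1}\left(\mathrm{rot}_{k_l,k_{l+1}}+\delta_{1,c^+_{k_l}}\right).$$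
   Context: Surgery setup. $I_\epsilon=[-\epsilon,\epsilon]$, $S^1=\mathbb{R}/\mathbb{Z}$, $\alpha_{std}=dz-y\,dx$, $\xi_{std}=\ker\alpha_{std}$ on $\mathbb{R}^3$, $\pi_{xy}$ the projection to the $xy$-plane. $\Lambda=\Lambda^+\cup\Lambda^0\cup\Lambda^-\subset(\mathbb{R}^3,\xi_{std})$ is an oriented Legendrian link with components $\Lambda_i$; $c_i\in\{+1,0,-1\}$ means $\Lambda_i\subset\Lambda^{c_i}$; $\Lambda^\pm=\Lambda^+\cup\Lambda^-$. The chords $r_j$ of $\Lambda$ are the $\partial_z$-directed segments with both endpoints on $\Lambda$; $r_j$ begins (tail) on $\Lambda_{l_j^-}$ and ends (tip) on $\Lambda_{l_j^+}$; $c_j^\pm=c_{l_j^\pm}$. Standing assumptions: chords are non-degenerate (double points of $\pi_{xy}(\Lambda)$ are transverse) and pairwise disjoint; each component has length $1$ for the metric on $\xi_{std}$ making $\partial_x+y\partial_z,\partial_y$ orthonormal; good position: near each double point $(x_0,y_0)$ of $\pi_{xy}(\Lambda)$ the upper strand projects to $\{(x_0+s,y_0-s)\}$ and the lower one to $\{(x_0+s,y_0+s)\}$. For small $\epsilon_0>0$ fix disjoint embeddings $\Phi_i:I_{\epsilon_0}\times I_{\epsilon_0}\times S^1\to\mathbb{R}^3$, coordinates $(z,p,q)$, with $\Phi_i^*\alpha_{std}=dz+p\,dq$, $\Phi_i(z,p,q)=\Phi_i(0,p,q)+(0,0,z)$, $\Phi_i(0,0,q)$ an oriented unit-speed parameterization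 of $\Lambda_i$, and near a chord endpoint with parameter $q_0$ over the double point $(x_0,y_0)$: $\pi_{xy}\Phi_i(z,p,q)=(x_0,y_0)+(q-q_0)v-p\,J_0v$, $v$ the unit tangent of $\pi_{xy}(\Lambda_i)$ there and $J_0$ rotation by $\pi/2$. $N_{\epsilon,i}=\Phi_i(I_\epsilon\times I_\epsilon\times S^1)$, $N_\epsilon=\bigcup_iN_{\epsilon,i}$; the projections of the strands of $N_\epsilon$ overlap only in one rectangle $\mathcal{D}_j$ around the double point of each $r_j$. Fix smooth $f:\mathbb{R}\to S^1$ with $f=0$ for $p\le-1$, $f'$ even, $0\le f'\le1$, $\mathrm{supp} f'\subset[-1,1]$, $\int f'=1$, and $f'=1$ on $I_{(1-\delta)/2}$, where $\delta=\delta(\epsilon)>0$ is so small that all points flowing through a surgery handle from its bottom over a rectangle $\mathcal{D}_j$ to its top over a rectangle $\mathcal{D}_{j'}$, $j'\neq j$, have $p$ in the interval where $f_\epsilon(p)=f(p/\epsilon)$ is affine. Let $H_\epsilon(p)=\int_{-\infty}^pPf_\epsilon'(P)\,dP$. For $\epsilon<\epsilon_0$, $(\mathbb{R}^3_{\Lambda^\pm},\xi_{\Lambda^\pm})$ with contact form $\alpha_\epsilon$ (Reeb field $R_\epsilon$) is obtained by removing $N_{\epsilon,i}$ for each $\Lambda_i\subset\Lambda^\pm$ and regluing a copy of it with the form $dz+p\,dq$, inside coordinates being sent to outside coordinates by $(z,p,q)\mapsto(z-c_iH_\epsilon(p),p,q+c_if_\epsilon(p))$ near the top $\{z=\epsilon\}$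 and by the identity near the sides $\{|p|=\epsilon\}$ and bottom $\{z=-\epsilon\}$; $\alpha_\epsilon=\alpha_{std}$ elsewhere. $\Lambda^0$ is considered as a Legendrian link in the surgered manifold. Words. Chords $\kappa$ of $\Lambda^0\subset\mathbb{R}^3_{\Lambda^\pm}$ for $R_\epsilon$ correspond bijectively to words $r_{j_1}\cdots r_{j_n}$ of chords with boundary on $\Lambda^0$ ($l^+_{j_k}=l^-_{j_{k+1}}$, $r_{j_1}$ begins and $r_{j_n}$ ends on $\Lambda^0$, all other endpoints on $\Lambda^\pm$), the word listing the chords $r_j$ along which the vertical segments of $\kappa$ outside the handles run; write $\kappa=(r_{j_1}\cdots r_{j_n})$. Rotation. For a path $\zeta$ in $\Lambda$, $\theta(\zeta)\in\mathbb{R}$ is the total change of angle, along $\zeta$, of the oriented unit tangent of $\pi_{xy}(\Lambda)$. For $l_a^+=l_b^-$, $\eta_{a,b}$ is the embedded arc of $\Lambda_{l_a^+}$ following its orientation from the tip of $r_a$ to the tail of $r_b$, $\theta_{a,b}=\theta(\eta_{a,b})$ and $\mathrm{rot}_{a,b}=\lfloor\theta_{a,b}/\pi\rfloor$. $\delta_{\cdot,\cdot}$ with two subscripts is the Kronecker delta. Framing. $(X,Y)$ is a pair of sections of $\xi_{\Lambda^\pm}$ equal to $(\partial_x+y\partial_z,\partial_y)$ outside $N_\epsilon$, extended over the handles so as to be a symplectic basis away from a small neighborhood of the push-offs $T_i^{c_i}=\{z=0,p=c_i\epsilon\}$ of the $\Lambda_i\subset\Lambda^\pm$ (with common zero locus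 equal to the union of those $T_i^{c_i}$ for which $\mathrm{rot}(\Lambda_i)\neq0$); in particular it is a symplectic basis along $\Lambda^0$, its chords and all closed orbits. Broken closed strings and Maslov index. A broken closed string is a closed concatenation as in the claim, where $a_k\kappa_k$ is $\kappa_k$ traversed forwards ($a_k=1$) or backwards ($a_k=-1$), and the $\zeta_k$ are paths in $\Lambda^0$ joining the relevant endpoints (up to homotopy rel endpoints). Using $(X,Y)$ to identify $\xi$ along $b$ with $\mathbb{C}$, form a loop of unoriented real lines: over $\zeta_k$ take $T\Lambda^0$; over $\kappa_k$ with $a_k=1$ take the image of $T\Lambda^0$ at its starting point under the linearized flow of $R_\epsilon$, followed at the endpoint by the smallest clockwise rotation onto $T\Lambda^0$; with $a_k=-1$ take the image of $T\Lambda^0$ at the endpoint under the backward linearized flow, followed at the starting point by the smallest clockwise rotation onto $T\Lambda^0$. $\mathrm{M}_{X,Y}(b)\in\mathbb{Z}$ is the degree of the resulting map to the circle $\mathbb{R}/\pi\mathbb{Z}$ of lines.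
   Formalization: The smallness condition on δ is also required for j'=j (flow from the tip of a chord to its own tail), needed for words containing r_j r_j; and (X,Y) need be standard outside N_ε only away from the small neighborhoods of the push-offs. *)

(* Defs.v *)
(* Conventions.  Classical real analysis on Stdlib's [R] with Coquelicot.

   A point of R^3 is ((x, y), z); handle coordinates (z, p, q) are written
   ((z, p), q).  S^1 = R/Z is unfolded: objects on S^1 are 1-periodic objects
   on R, and equality on S^1 is [congr1].  A point of the link is a pair
   (component, parameter) : I * R.

   Contact planes have two coordinate systems:
     - outside the handles xi = ker(dz - y dx), and (a, b) : vec2 stands for
       a (d_x + y d_z) + b d_y, i.e. for its image under pi_xy;
     - in a handle xi = ker(dz + p dq), and (a, b) stands for
       a d_p + b (d_q - p d_z).
   In both, d(alpha) is the determinant form and the Reeb field is d_z. *)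

From mathcomp Require Import ssreflect ssrbool eqtype fintype.
From Stdlib Require Import Reals ZArith List.
From Coquelicot Require Import Coquelicot.
Import ListNotations.

Set Implicit Arguments.
Unset Strict Implicit.
Unset Printing Implicit Defensive.

Open Scope R_scope.

Definition vec2 : Type := (R * R)%type.
Definition pt3 : Type := (R * R * R)%type.

Definition xy (x : pt3) : vec2 := fst x.
Definition xc (x : pt3) : R := fst (fst x).
Definition yc (x : pt3) : R := snd (fst x).
Definition zc (x : pt3) : R := snd x.

Definition det (u v : vec2) : R := fst u * snd v - snd u * fst v.

Definition rotate (a : R) (v : vec2) : vec2 :=
  (cos a * fst v - sin a * snd v, sin a * fst v + cos a * snd v).

Definition congr1 (q q' : R) : Prop := exists k : Z, q' = q + IZR k.

(* Smoothness means C^infinity; for three variables, all iterated partial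
   derivatives exist and are jointly continuous. *)
Definition smooth1 (g : R -> R) : Prop := forall n x, ex_derive_n g n x.

CoInductive smooth3 (g : R -> R -> R -> R) : Prop := Smooth3 {
  s3_cont : forall w : pt3,
    continuous (fun w : pt3 => g (fst (fst w)) (snd (fst w)) (snd w)) w;
  s3_ex1 : forall z p q, ex_derive (fun s => g s p q) z;
  s3_ex2 : forall z p q, ex_derive (fun s => g z s q) p;
  s3_ex3 : forall z p q, ex_derive (fun s => g z p s) q;
  s3_1 : smooth3 (fun z p q => Derive (fun s => g s p q) z);
  s3_2 : smooth3 (fun z p q => Derive (fun s => g z s q) p);
  s3_3 : smooth3 (fun z p q => Derive (fun s => g z p s) q)
}.

(* ** The Legendrian link and its chords *)

(* [gam i] is the oriented unit-speed parameterization of Lambda_i, so that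
   having length 1 is having period exactly 1. *)
Record legendrian_link (I : finType) (gam : I -> R -> pt3) : Prop := {
  ll_smooth : forall i,
    smooth1 (fun q => xc (gam i q)) /\ smooth1 (fun q => yc (gam i q)) /\
    smooth1 (fun q => zc (gam i q));
  ll_period : forall i q, gam i (q + 1) = gam i q;
  ll_embedded : forall i q i' q',
    gam i q = gam i' q' -> i = i' /\ congr1 q q';
  ll_legendrian : forall i q,
    Derive (fun s => zc (gam i s)) q
      = yc (gam i q) * Derive (fun s => xc (gam i s)) q;
  ll_unit_speed : forall i q,
    (Derive (fun s => xc (gam i s)) q)^2
      + (Derive (fun s => yc (gam i s)) q)^2 = 1
}.

Definition pos (I : finType) (gam : I -> R -> pt3) (P : I * R) : pt3 :=
  gam (fst P) (snd P).

Definition tangent (I : finType) (gam : I -> R -> pt3) (P : I * R) : vec2 :=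
  (Derive (fun s => xc (gam (fst P) s)) (snd P),
   Derive (fun s => yc (gam (fst P) s)) (snd P)).

Definition same_pt (I : finType) (P Q : I * R) : Prop :=
  fst P = fst Q /\ congr1 (snd P) (snd Q).

Definition near (I : finType) (e : R) (P Q : I * R) : Prop :=
  fst P = fst Q /\ exists k : Z, Rabs (snd Q - snd P - IZR k) <= e.

Record chord (I : finType) := Chord { tail : I * R; tip : I * R }.

Definition is_chord (I : finType) (gam : I -> R -> pt3) (r : chord I) : Prop :=
  xy (pos gam (tail r)) = xy (pos gam (tip r)) /\
  zc (pos gam (tail r)) < zc (pos gam (tip r)).

Definition on_chord (I : finType) (gam : I -> R -> pt3) (r : chord I)
    (x : pt3) : Prop :=
  xy x = xy (pos gam (tail r)) /\
  zc (pos gam (tail r)) <= zc x <= zc (pos gam (tip r)).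

Record chord_conditions (I : finType) (gam : I -> R -> pt3) : Prop := {
  cc_nondegenerate : forall r, is_chord gam r ->
    det (tangent gam (tail r)) (tangent gam (tip r)) <> 0;
  cc_disjoint : forall r r' x, is_chord gam r -> is_chord gam r' ->
    on_chord gam r x -> on_chord gam r' x ->
    same_pt (tail r) (tail r') /\ same_pt (tip r) (tip r');
  cc_good_position : forall r, is_chord gam r ->
    exists eta, 0 < eta /\ forall t, Rabs t < eta ->
      let x0 := xc (pos gam (tip r)) in
      let y0 := yc (pos gam (tip r)) in
      (exists s, xy (gam (fst (tip r)) (snd (tip r) + t))
                   = (x0 + s, y0 - s)) /\
      (exists s, xy (gam (fst (tail r)) (snd (tail r) + t))
                   = (x0 + s, y0 + s))
}.

(* ** Rotation *)

(* [tau i] is a continuous determination of the angle of the unit tangent of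
   pi_xy(Lambda_i).  It is unique up to a constant in 2 pi Z, on which nothing
   below depends. *)
Definition tangent_angle (I : finType) (gam : I -> R -> pt3)
    (tau : I -> R -> R) : Prop :=
  forall i q, continuous (tau i) q /\
    tangent gam (i, q) = (cos (tau i q), sin (tau i q)).

(* The path zeta : [0,1] -> Lambda_i is given by its lift to the parameter
   line. *)
Definition theta_path (I : finType) (tau : I -> R -> R) (i : I)
    (zeta : R -> R) : R :=
  tau i (zeta 1) - tau i (zeta 0).

(* theta_{a,b}: the oriented embedded arc from the tip of a to the tail of b,
   which lie on a common component, has parameter length
   frac(tail - tip) in [0,1). *)
Definition theta (I : finType) (tau : I -> R -> R) (a b : chord I) : R :=
  let i := fst (tip a) in
  let q := snd (tip a) in
  tau i (q + frac_part (snd (tail b) - q)) - tau i q.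

Definition rot (I : finType) (tau : I -> R -> R) (a b : chord I) : Z :=
  Int_part (theta tau a b / PI).

Definition rot_component (I : finType) (tau : I -> R -> R) (i : I) : R :=
  (tau i 1 - tau i 0) / (2 * PI).

(* ** Surgery data *)

(* [prof] is the lift to R of f : R -> S^1 that vanishes for p <= -1. *)
Record surgery (I : finType) := Surgery {
  gam : I -> R -> pt3;
  coef : I -> Z;
  eps0 : R;
  Phi : I -> R -> R -> R -> pt3;
  eps : R;
  delta : R;
  prof : R -> R
}.

(* pi_xy o Phi_i, which does not depend on z. *)
Definition proj (I : finType) (S : surgery I) (i : I) (p q : R) : vec2 :=
  xy (Phi S i 0 p q).

(* The conditions on Phi_i concern the box |z|, |p| <= eps0 only.  Contact
   pull-back makes Phi_i an immersion, so [tb_injective] makes the Phi_i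
   disjoint embeddings. *)
Record tubes (I : finType) (S : surgery I) : Prop := {
  tb_eps0 : 0 < eps0 S;
  tb_smooth : forall i,
    smooth3 (fun z p q => xc (Phi S i z p q)) /\
    smooth3 (fun z p q => yc (Phi S i z p q)) /\
    smooth3 (fun z p q => zc (Phi S i z p q));
  tb_period : forall i z p q, Phi S i z p (q + 1) = Phi S i z p q;
  tb_injective : forall i z p q i' z' p' q',
    Rabs z <= eps0 S -> Rabs p <= eps0 S ->
    Rabs z' <= eps0 S -> Rabs p' <= eps0 S ->
    Phi S i z p q = Phi S i' z' p' q' ->
    i = i' /\ z = z' /\ p = p' /\ congr1 q q';
  tb_contact : forall i z p q, Rabs z <= eps0 S -> Rabs p <= eps0 S ->
    let y := yc (Phi S i z p q) in
    Derive (fun s => zc (Phi S i s p q)) z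
      - y * Derive (fun s => xc (Phi S i s p q)) z = 1 /\
    Derive (fun s => zc (Phi S i z s q)) p
      - y * Derive (fun s => xc (Phi S i z s q)) p = 0 /\
    Derive (fun s => zc (Phi S i z p s)) q
      - y * Derive (fun s => xc (Phi S i z p s)) q = p;
  tb_translation : forall i z p q, Rabs z <= eps0 S -> Rabs p <= eps0 S ->
    Phi S i z p q = (xy (Phi S i 0 p q), zc (Phi S i 0 p q) + z);
  tb_core : forall i q, Phi S i 0 0 q = gam S i q;
  (* The second summand is -p J_0 v, with J_0 (v1, v2) = (-v2, v1). *)
  tb_linear : forall r e, is_chord (gam S) r -> e = tail r \/ e = tip r ->
    forall p q, Rabs p <= eps0 S -> Rabs (q - snd e) <= eps0 S ->
    let v := tangent (gam S) e in
    proj S (fst e) p q =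
      (xc (pos (gam S) e) + (q - snd e) * fst v + p * snd v,
       yc (pos (gam S) e) + (q - snd e) * snd v - p * fst v);
  (* Strands overlap only in the rectangles D_j; on either strand D_j is
     |p| <= eps0 within parameter distance eps0 of the chord endpoint. *)
  tb_overlap : forall i p q i' p' q',
    Rabs p <= eps0 S -> Rabs p' <= eps0 S ->
    proj S i p q = proj S i' p' q' ->
    (i = i' /\ p = p' /\ congr1 q q') \/
    exists r, is_chord (gam S) r /\
      ((near (eps0 S) (tail r) (i, q) /\ near (eps0 S) (tip r) (i', q')) \/
       (near (eps0 S) (tip r) (i, q) /\ near (eps0 S) (tail r) (i', q')))
}.

Definition f_eps (I : finType) (S : surgery I) (p : R) : R :=
  prof S (p / eps S).

Definition H_eps (I : finType) (S : surgery I) (p : R) : R :=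
  RInt_gen (fun P => P * Derive (f_eps S) P)
    (Rbar_locally m_infty) (at_point p).

(* q-coordinate, outside, of the point leaving handle i through its top with
   inside coordinates p, q. *)
Definition q_top (I : finType) (S : surgery I) (i : I) (p q : R) : R :=
  q + IZR (coef S i) * f_eps S p.

Record profile (I : finType) (S : surgery I) : Prop := {
  pf_delta : 0 < delta S < 1;
  pf_smooth : smooth1 (prof S);
  pf_zero : forall p, p <= -1 -> prof S p = 0;
  pf_even : forall p, Derive (prof S) (- p) = Derive (prof S) p;
  pf_range : forall p, 0 <= Derive (prof S) p <= 1;
  pf_support : forall p, 1 < Rabs p -> Derive (prof S) p = 0;
  pf_integral : RInt (Derive (prof S)) (-1) 1 = 1;
  pf_affine : forall p, Rabs p <= (1 - delta S) / 2 ->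
    Derive (prof S) p = 1;
  (* Points flowing through handle i from the rectangle of a (at its tip) to
     the rectangle of b (at its tail) have p where f_eps is affine. *)
  pf_flow : forall a b i p q,
    is_chord (gam S) a -> is_chord (gam S) b -> coef S i <> 0%Z ->
    Rabs p <= eps S ->
    near (eps S) (tip a) (i, q) ->
    near (eps S) (tail b) (i, q_top S i p q) ->
    Rabs p <= eps S * ((1 - delta S) / 2)
}.

Record surgery_setup (I : finType) (S : surgery I) : Prop := {
  ss_link : legendrian_link (gam S);
  ss_coef : forall i, coef S i = 1%Z \/ coef S i = 0%Z \/ coef S i = (-1)%Z;
  ss_chords : chord_conditions (gam S);
  ss_tubes : tubes S;
  ss_eps : 0 < eps S < eps0 S;
  ss_profile : profile S
}.

(* ** The surgered manifold *)

(* The surgered manifold is the union of two kinds of closed pieces: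
     - the outside [outer], R^3 minus the open tubes N_{eps,i} with c_i <> 0;
     - for each such i the handle [in_handle i], with its coordinates (z,p,q).
   They are glued along their boundaries by the given attaching maps: the
   identity on bottom and sides, (z - c_i H, p, q + c_i f) on top.  As this last
   map changes z, the top of the handle is {z = eps + c_i H_eps(p)}, the
   preimage of the top {z = eps} of the tube. *)

Definition open_tube (I : finType) (S : surgery I) (i : I) (x : pt3) : Prop :=
  exists z p q, Rabs z < eps S /\ Rabs p < eps S /\ x = Phi S i z p q.

Definition closed_tube (I : finType) (S : surgery I) (i : I) (x : pt3)
    : Prop :=
  exists z p q, Rabs z <= eps S /\ Rabs p <= eps S /\ x = Phi S i z p q.

Definition outer (I : finType) (S : surgery I) (x : pt3) : Prop :=
  forall i, coef S i <> 0%Z -> ~ open_tube S i x.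

Definition z_top (I : finType) (S : surgery I) (i : I) (p : R) : R :=
  eps S + IZR (coef S i) * H_eps S p.

Definition in_handle (I : finType) (S : surgery I) (i : I) (h : pt3) : Prop :=
  let: (z, p, q) := h in Rabs p <= eps S /\ - eps S <= z <= z_top S i p.

(* Differential of pi_xy o Phi_i on the contact planes: from components on
   (d_p, d_q - p d_z) at (p, q) to components on (d_x + y d_z, d_y). *)
Definition dproj (I : finType) (S : surgery I) (i : I) (p q : R) (w : vec2)
    : vec2 :=
  (fst w * Derive (fun s => fst (proj S i s q)) p
     + snd w * Derive (fun s => fst (proj S i p s)) q,
   fst w * Derive (fun s => snd (proj S i s q)) p
     + snd w * Derive (fun s => snd (proj S i p s)) q).

(* Differentials of the attaching maps on the contact planes, at handle
   coordinates p, q. *)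
Definition push_id (I : finType) (S : surgery I) (i : I) (p q : R) (w : vec2)
    : vec2 :=
  dproj S i p q w.

Definition push_top (I : finType) (S : surgery I) (i : I) (p q : R) (w : vec2)
    : vec2 :=
  dproj S i p (q_top S i p q)
    (fst w, snd w + IZR (coef S i) * Derive (f_eps S) p * fst w).

(* ** Framings *)

(* A pair of sections X, Y of xi over the surgered manifold, in the
   coordinates of the outside and of the handles. *)
Record framing (I : finType) := Framing {
  Xo : pt3 -> vec2;
  Yo : pt3 -> vec2;
  Xh : I -> pt3 -> vec2;
  Yh : I -> pt3 -> vec2
}.

Record is_section (I : finType) (S : surgery I) (Vo : pt3 -> vec2)
    (Vh : I -> pt3 -> vec2) : Prop := {
  sec_cont_outer : continuous_on (outer S) Vo;
  sec_cont_handle : forall i, coef S i <> 0%Z ->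
    continuous_on (in_handle S i) (Vh i);
  sec_period : forall i z p q, Vh i (z, p, q + 1) = Vh i (z, p, q);
  sec_bottom : forall i p q, coef S i <> 0%Z -> Rabs p <= eps S ->
    Vo (Phi S i (- eps S) p q) = push_id S i p q (Vh i (- eps S, p, q));
  sec_sides : forall i z p q, coef S i <> 0%Z -> Rabs p = eps S ->
    Rabs z <= eps S ->
    Vo (Phi S i z p q) = push_id S i p q (Vh i (z, p, q));
  sec_top : forall i p q, coef S i <> 0%Z -> Rabs p <= eps S ->
    Vo (Phi S i (eps S) p (q_top S i p q))
      = push_top S i p q (Vh i (z_top S i p, p, q))
}.

(* The neighborhood of the push-off T_i^{c_i} = {z = 0, p = c_i eps}, in the
   coordinates (z, p, q) of Phi_i and of the handle, which agree there. *)
Definition near_pushoff (I : finType) (S : surgery I) (rho : R) (i : I)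
    (z p : R) : Prop :=
  Rabs z < rho /\ Rabs (p - IZR (coef S i) * eps S) < rho.

Definition outer_pushoff (I : finType) (S : surgery I) (rho : R) (x : pt3)
    : Prop :=
  exists i z p q, coef S i <> 0%Z /\ near_pushoff S rho i z p /\
    x = Phi S i z p q.

(* Since T_i^{c_i} lies on a side of the handle, a continuous section that
   vanishes there cannot be standard at every outside point: the sections are
   standard at the outside points away from the neighborhood of the
   push-offs. *)
Definition is_framing (I : finType) (S : surgery I) (tau : I -> R -> R)
    (F : framing I) : Prop :=
  is_section S (Xo F) (Xh F) /\ is_section S (Yo F) (Yh F) /\
  exists rho, 0 < rho /\ rho <= eps S / 2 /\ rho <= eps0 S - eps S /\
    (forall x, outer S x -> ~ outer_pushoff S rho x ->
       Xo F x = (1, 0) /\ Yo F x = (0, 1)) /\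
    (forall i z p q, coef S i <> 0%Z -> in_handle S i (z, p, q) ->
       ~ near_pushoff S rho i z p ->
       det (Xh F i (z, p, q)) (Yh F i (z, p, q)) = 1) /\
    (forall x, outer S x ->
       (Xo F x = (0, 0) /\ Yo F x = (0, 0) <->
        exists i q, coef S i <> 0%Z /\ rot_component tau i <> 0 /\
          x = Phi S i 0 (IZR (coef S i) * eps S) q)) /\
    (forall i z p q, coef S i <> 0%Z -> in_handle S i (z, p, q) ->
       (Xh F i (z, p, q) = (0, 0) /\ Yh F i (z, p, q) = (0, 0) <->
        rot_component tau i <> 0 /\ z = 0 /\ p = IZR (coef S i) * eps S)).

(* The complex number identified with V by the basis (X, Y). *)
Definition coords (X Y V : vec2) : vec2 :=
  (det V Y / det X Y, det X V / det X Y).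

(* ** Chords of Lambda^0 for R_eps and their words *)

(* One passage of a Reeb trajectory through handle [cr_comp], at constant
   handle coordinates p, q, upwards from the bottom to the top. *)
Record crossing (I : finType) := Crossing {
  cr_comp : I;
  cr_p : R;
  cr_q : R
}.

Definition cr_in (I : finType) (S : surgery I) (x : crossing I) : pt3 :=
  Phi S (cr_comp x) (- eps S) (cr_p x) (cr_q x).

Definition cr_out (I : finType) (S : surgery I) (x : crossing I) : pt3 :=
  Phi S (cr_comp x) (eps S) (cr_p x) (q_top S (cr_comp x) (cr_p x) (cr_q x)).

Definition outer_segment (I : finType) (S : surgery I) (P Q : pt3) : Prop :=
  xy P = xy Q /\ zc P < zc Q /\
  forall z, zc P < z < zc Q ->
    forall i, coef S i <> 0%Z -> ~ closed_tube S i (xy P, z).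

(* R_eps = d_z in all charts: a compact trajectory with outside endpoints
   alternates vertical outside segments and crossings. *)
Fixpoint trajectory (I : finType) (S : surgery I) (P : pt3)
    (l : list (crossing I)) (Q : pt3) : Prop :=
  match l with
  | [] => outer_segment S P Q
  | x :: l' =>
      coef S (cr_comp x) <> 0%Z /\ Rabs (cr_p x) <= eps S /\
      outer_segment S P (cr_in S x) /\ trajectory S (cr_out S x) l' Q
  end.

Record reeb_chord (I : finType) := ReebChord {
  rc_start : I * R;
  rc_cross : list (crossing I);
  rc_end : I * R
}.

Definition is_reeb_chord (I : finType) (S : surgery I) (k : reeb_chord I)
    : Prop :=
  coef S (fst (rc_start k)) = 0%Z /\ coef S (fst (rc_end k)) = 0%Z /\
  trajectory S (pos (gam S) (rc_start k)) (rc_cross k)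
    (pos (gam S) (rc_end k)).

(* The outside segments run, in order, along the chords of the word w: over
   the rectangle of the chord, from its lower to its upper strand.  P and Q are
   the strand points (component, q) over which the trajectory starts and
   ends. *)
Fixpoint spells (I : finType) (S : surgery I) (P : I * R)
    (l : list (crossing I)) (Q : I * R) (w : list (chord I)) : Prop :=
  match l, w with
  | [], [r] =>
      is_chord (gam S) r /\ near (eps S) (tail r) P /\ near (eps S) (tip r) Q
  | x :: l', r :: w' =>
      is_chord (gam S) r /\ near (eps S) (tail r) P /\
      near (eps S) (tip r) (cr_comp x, cr_q x) /\
      spells S (cr_comp x, q_top S (cr_comp x) (cr_p x) (cr_q x)) l' Q w'
  | _, _ => False
  end.

Definition has_word (I : finType) (S : surgery I) (k : reeb_chord I)
    (w : list (chord I)) : Prop :=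
  spells S (rc_start k) (rc_cross k) (rc_end k) w.

(* m_{X,Y}, as a function of the word. *)
Fixpoint m_index (I : finType) (S : surgery I) (tau : I -> R -> R)
    (w : list (chord I)) : Z :=
  match w with
  | a :: ((b :: _) as w') =>
      (rot tau a b + (if Z.eqb 1 (coef S (fst (tip a))) then 1 else 0)
         + m_index S tau w')%Z
  | _ => 0%Z
  end.

(* ** The linearized Reeb flow *)

(* The flow is a translation in each chart, so a vector field along a
   trajectory that is invariant under the linearized flow has constant
   components in each chart: [u] on the first outside segment, [v] on the last
   one, [ws] in the successive handles. *)
Fixpoint flow_invariant (I : finType) (S : surgery I) (u : vec2)
    (l : list (crossing I)) (ws : list vec2) (v : vec2) : Prop :=
  match l, ws with
  | [], [] => u = v
  | x :: l', w :: ws' =>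
      u = push_id S (cr_comp x) (cr_p x) (cr_q x) w /\
      flow_invariant S (push_top S (cr_comp x) (cr_p x) (cr_q x) w) l' ws' v
  | _, _ => False
  end.

(* ** Loops of lines *)

(* A path of lines in C = R^2 is given by directing vectors on [0,1], and a
   piecewise path by the list of its pieces.  [lifts ps a b]: the angles of the
   lines of the concatenation ps have a continuous lift to R going from a to
   b.  In particular the lines agree where pieces are joined. *)
Inductive lifts : list (R -> vec2) -> R -> R -> Prop :=
| lifts_nil a : lifts [] a a
| lifts_cons (v : R -> vec2) ps (phi : R -> R) b :
    continuous_on (fun t => 0 <= t <= 1) phi ->
    (forall t, 0 <= t <= 1 ->
       v t <> (0, 0) /\ det (v t) (cos (phi t), sin (phi t)) = 0) ->
    lifts ps (phi 1) b ->
    lifts (v :: ps) (phi 0) b.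

Definition has_degree (ps : list (R -> vec2)) (M : Z) : Prop :=
  exists a, lifts ps a (a + IZR M * PI).

(* rho is the angle of the smallest clockwise rotation taking the line of e
   onto the line of e'. *)
Definition smallest_cw (e e' : vec2) (rho : R) : Prop :=
  0 <= rho < PI /\ det (rotate (- rho) e) e' = 0.

Definition cw_piece (e : vec2) (rho : R) : R -> vec2 :=
  fun t => rotate (- (t * rho)) e.

Definition coords_at (I : finType) (F : framing I) (x : pt3) (V : vec2)
    : vec2 :=
  coords (Xo F x) (Yo F x) V.

Definition segment_piece (I : finType) (F : framing I) (u : vec2) (P Q : pt3)
    : R -> vec2 :=
  fun t => coords_at F (xy P, zc P + t * (zc Q - zc P)) u.

Definition handle_piece (I : finType) (S : surgery I) (F : framing I)
    (x : crossing I) (w : vec2) : R -> vec2 :=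
  fun t =>
    let i := cr_comp x in
    let h := (- eps S + t * (z_top S i (cr_p x) + eps S), cr_p x, cr_q x) in
    coords (Xh F i h) (Yh F i h) w.

Fixpoint flow_pieces (I : finType) (S : surgery I) (F : framing I) (P : pt3)
    (u : vec2) (l : list (crossing I)) (ws : list vec2) (Q : pt3)
    : list (R -> vec2) :=
  match l, ws with
  | x :: l', w :: ws' =>
      segment_piece F u P (cr_in S x) :: handle_piece S F x w ::
      flow_pieces S F (cr_out S x)
        (push_top S (cr_comp x) (cr_p x) (cr_q x) w) l' ws' Q
  | _, _ => [segment_piece F u P Q]
  end.

Definition reverse_pieces (ps : list (R -> vec2)) : list (R -> vec2) :=
  rev (map (fun v t => v (1 - t)) ps).

(* ** Broken closed strings *)

(* One factor zeta * (a kappa); [st_path] is the lift of zeta to the parameter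
   line of the component [st_comp], and a = 1 iff [st_fwd]. *)
Record bstep (I : finType) := BStep {
  st_comp : I;
  st_path : R -> R;
  st_fwd : bool;
  st_chord : reeb_chord I
}.

Definition st_sign (I : finType) (s : bstep I) : R :=
  if st_fwd s then 1 else -1.

Definition st_from (I : finType) (s : bstep I) : I * R :=
  if st_fwd s then rc_start (st_chord s) else rc_end (st_chord s).

Definition st_to (I : finType) (s : bstep I) : I * R :=
  if st_fwd s then rc_end (st_chord s) else rc_start (st_chord s).

Definition is_bstep (I : finType) (S : surgery I) (s : bstep I) : Prop :=
  coef S (st_comp s) = 0%Z /\
  continuous_on (fun t => 0 <= t <= 1) (st_path s) /\
  is_reeb_chord S (st_chord s) /\
  same_pt (st_comp s, st_path s 1) (st_from s).

Fixpoint chained (I : finType) (P : I * R) (b : list (bstep I)) (Q : I * R)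
    : Prop :=
  match b with
  | [] => same_pt P Q
  | s :: b' => same_pt P (st_comp s, st_path s 0) /\ chained (st_to s) b' Q
  end.

Definition broken_closed_string (I : finType) (S : surgery I)
    (b : list (bstep I)) : Prop :=
  List.Forall (is_bstep S) b /\
  match b with
  | [] => False
  | s :: _ =>
      let P := (st_comp s, st_path s 0) in chained P b P
  end.

Definition legendrian_line (I : finType) (S : surgery I) (F : framing I)
    (P : I * R) : vec2 :=
  coords_at F (pos (gam S) P) (tangent (gam S) P).

Definition zeta_piece (I : finType) (S : surgery I) (F : framing I)
    (s : bstep I) : R -> vec2 :=
  fun t => legendrian_line S F (st_comp s, st_path s t).

(* The path of lines over one factor zeta * (a kappa). *)
Definition step_lines (I : finType) (S : surgery I) (F : framing I)
    (s : bstep I) (ps : list (R -> vec2)) : Prop :=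
  let k := st_chord s in
  let P := pos (gam S) (rc_start k) in
  let Q := pos (gam S) (rc_end k) in
  exists u ws v rho, flow_invariant S u (rc_cross k) ws v /\
    let flow := flow_pieces S F P u (rc_cross k) ws Q in
    if st_fwd s then
      u = tangent (gam S) (rc_start k) /\
      smallest_cw (coords_at F Q v) (legendrian_line S F (rc_end k)) rho /\
      ps = zeta_piece S F s :: flow ++ [cw_piece (coords_at F Q v) rho]
    else
      v = tangent (gam S) (rc_end k) /\
      smallest_cw (coords_at F P u) (legendrian_line S F (rc_start k)) rho /\
      ps = zeta_piece S F s :: reverse_pieces flow
             ++ [cw_piece (coords_at F P u) rho].

(* M is the Maslov index M_{X,Y}(b). *)
Definition maslov_index (I : finType) (S : surgery I) (F : framing I)
    (b : list (bstep I)) (M : Z) : Prop :=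
  exists pss, Forall2 (step_lines S F) b pss /\ has_degree (concat pss) M.

Definition Rsum (s : list R) : R := fold_right Rplus 0 s.

(* Main.v *)
(* In the outside coordinates the framing is standard along every segment of a
   chord: a third tube over the rectangle of r_j would have to cross both of its
   strands perpendicularly.  So the lines turn only along the zeta_k, in the
   handles and in the clockwise rotations.

   In a handle, the frame is known on the boundary only.  The vertical path can
   be pushed, away from the push-off, to the path along the bottom, up the side
   p = - c_i eps and back along the top.  Bottom and side contribute nothing; on
   the top, q + c_i f_eps(p) runs over the arc from the tip of r_a to the tail of
   r_b, so that a line of slope s in the handle turns by theta_{a,b} plus the
   change atan(s + c_i / eps) - atan s due to the shear.

   Since 1 / eps > 2, the slopes stay in the cone |s| < 1 around the tail
   direction (forwards; around the tip direction backwards).  Hence the tip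
   (tail) direction following the line advances by
   pi (rot_{a,b} + delta_{1,c}) in each handle, and the last clockwise rotation
   leaves - pi / 2 in total. *)

Require Import Defs.
From mathcomp Require Import ssreflect ssrbool eqtype fintype.
From Stdlib Require Import Reals ZArith List Lra Lia.
From Coquelicot Require Import Coquelicot.
(* Coquelicot's [pos] (on posreal) must not hide that of Defs. *)
Import Defs.
Import ListNotations.

Set Implicit Arguments.
Unset Strict Implicit.
Unset Printing Implicit Defensive.

Open Scope R_scope.

(** * Continuity *)

(** The bound [1 / eps > 2] comes from the length of the components: the parameter has period 1,
    while the linear model of a strand is injective in q within [eps0] of a chord endpoint, which
    forces [eps0 < 1 / 2]. Forwards, a slope in (-1, 1) shifted by c / eps thus has absolute value
    above 1 and the sign of c. Measured from the perpendicular line it becomes its negative inverse,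
    again in (-1, 1), and [atan (- / x)] differs from [atan x] by a quarter turn whose sign is
    decided by that of x. Combined with [theta = rot * PI + PI / 2] this leaves a half turn for c =
    1 and none for c = -1, which is the Kronecker delta.

    Angles of unoriented lines are defined modulo PI only, and the index is a relation that allows
    any choice of invariant vectors and lifts. Every statement about a piece is therefore about the
    increment of a lift, which does not depend on the lift. The homotopy in a handle is replaced by
    one continuous angle function on a square of parameters: its increment along one edge is read
    off from the other three. *)

Lemma cont_plus (U : UniformSpace) (f g : U -> R) (x : U) :
  continuous f x -> continuous g x -> continuous (fun y => f y + g y) x.
Proof. exact: (continuous_plus f g). Qed.

Lemma cont_mult (U : UniformSpace) (f g : U -> R) (x : U) :
  continuous f x -> continuous g x -> continuous (fun y => f y * g y) x.
Proof. exact: (continuous_mult f g). Qed.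

Lemma cont_opp (U : UniformSpace) (f : U -> R) (x : U) :
  continuous f x -> continuous (fun y => - f y) x.
Proof. exact: (continuous_opp f). Qed.

Lemma cont_minus (U : UniformSpace) (f g : U -> R) (x : U) :
  continuous f x -> continuous g x -> continuous (fun y => f y - g y) x.
Proof. exact: (continuous_minus f g). Qed.

Lemma cont_div (U : UniformSpace) (f g : U -> R) (x : U) :
  continuous f x -> continuous g x -> g x <> 0 ->
  continuous (fun y => f y / g y) x.
Proof.
move=> Hf Hg H0; apply: cont_mult => //.
apply: (continuous_comp g Rinv) => //; exact: continuous_Rinv.
Qed.

Lemma cont_atan (U : UniformSpace) (f : U -> R) (x : U) :
  continuous f x -> continuous (fun y => atan (f y)) x.
Proof.
move=> Hf; apply: (continuous_comp f atan) => //.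
apply: ex_derive_continuous; eexists; exact: is_derive_atan.
Qed.

Lemma cont_abs (U : UniformSpace) (f : U -> R) (x : U) :
  continuous f x -> continuous (fun y => Rabs (f y)) x.
Proof. by move=> Hf; apply: (continuous_comp f Rabs) => //; apply: continuous_Rabs. Qed.

Lemma cont_sqrt (U : UniformSpace) (f : U -> R) (x : U) :
  continuous f x -> continuous (fun y => sqrt (f y)) x.
Proof. by move=> Hf; apply: (continuous_comp f sqrt) => //; apply: continuous_sqrt. Qed.

Lemma cont_pair (U V W : UniformSpace) (f : U -> V) (g : U -> W) (x : U) :
  continuous f x -> continuous g x -> continuous (fun y => (f y, g y)) x.
Proof.
move=> Hf Hg; apply: (continuous_comp_2 f g (fun a b => (a, b))) => //.
apply: continuous_ext (continuous_id _); by case.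
Qed.

Lemma cont_fst (U V W : UniformSpace) (f : U -> V * W) (x : U) :
  continuous f x -> continuous (fun y => fst (f y)) x.
Proof. move=> Hf; apply: (continuous_comp f fst) => //; exact: continuous_fst. Qed.

Lemma cont_snd (U V W : UniformSpace) (f : U -> V * W) (x : U) :
  continuous f x -> continuous (fun y => snd (f y)) x.
Proof. move=> Hf; apply: (continuous_comp f snd) => //; exact: continuous_snd. Qed.

Lemma cont_id (U : UniformSpace) (x : U) : continuous (fun y : U => y) x.
Proof. exact: continuous_id. Qed.

Ltac cont := repeat match goal with
  | |- continuous (fun _ => ?c) _ => apply: continuous_const
  | |- continuous fst _ => apply: continuous_fst
  | |- continuous snd _ => apply: continuous_snd
  | |- continuous (fun y => y) _ => apply: cont_id
  | H : continuous ?f ?x |- continuous ?f ?x => exact: H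
  | H : forall x, continuous ?f x |- continuous ?f _ => apply: H
  | H : continuous ?f ?x |- continuous (fun y => ?f y) ?x => exact: H
  | H : forall x, continuous ?f x |- continuous (fun y => ?f y) _ => exact: H
  | |- continuous (fun y => _ + _) _ => apply: cont_plus
  | |- continuous (fun y => _ - _) _ => apply: cont_minus
  | |- continuous (fun y => _ * _) _ => apply: cont_mult
  | |- continuous (fun y => _ / _) _ => apply: cont_div
  | |- continuous (Rplus ?c) _ => apply: (@cont_plus _ (fun _ => c) (fun y => y))
  | |- continuous (Rminus ?c) _ => apply: (@cont_minus _ (fun _ => c) (fun y => y))
  | |- continuous (Rmult ?c) _ => apply: (@cont_mult _ (fun _ => c) (fun y => y))
  | |- continuous (fun y => - _) _ => apply: cont_opp
  | |- continuous (fun y => atan _) _ => apply: cont_atan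
  | |- continuous (fun y => sqrt _) _ => apply: cont_sqrt
  | |- continuous (fun y => Rabs _) _ => apply: cont_abs
  | |- continuous (fun y => (_, _)) _ => apply: cont_pair
  | |- continuous (fun y => fst _) _ => apply: cont_fst
  | |- continuous (fun y => snd _) _ => apply: cont_snd
  end.

Lemma continuous_on_of (T U : UniformSpace) (D : T -> Prop) (f : T -> U) :
  (forall x, D x -> continuous f x) -> continuous_on D f.
Proof.
move=> H x Dx; apply: filterlim_filter_le_1 (H x Dx).
exact: filter_le_within.
Qed.

Lemma continuous_on_comp (T U V : UniformSpace) (D : T -> Prop) (E : U -> Prop)
    (f : T -> U) (g : U -> V) :
  continuous_on D f -> (forall x, D x -> E (f x)) -> continuous_on E g ->
  continuous_on D (fun x => g (f x)).
Proof.
move=> Hf HE Hg x Dx P HP.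
have := Hf x Dx _ (Hg (f x) (HE x Dx) P HP).
rewrite /filtermap /within; apply: filter_imp => y H Dy; apply: H => //; exact: HE.
Qed.

Lemma continuous_of_on (T U V : UniformSpace) (E : U -> Prop)
    (f : T -> U) (g : U -> V) (x : T) :
  continuous_on E g -> (forall y, E (f y)) -> continuous f x ->
  continuous (fun x => g (f x)) x.
Proof.
move=> Hg HE Hf P HP.
have := Hf _ (Hg (f x) (HE x) P HP).
rewrite /filtermap /within; apply: filter_imp => y H; exact: H.
Qed.

(** Retraction onto [a, b]. Precomposing with it turns a function continuous relative to an interval
    or rectangle into one continuous everywhere, as the intermediate value theorem and uniform
    continuity require. *)
Definition clamp (a b x : R) : R := Rmax a (Rmin b x).

Lemma clamp_in (a b x : R) : a <= b -> a <= clamp a b x <= b.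
Proof.
move=> H; rewrite /clamp /Rmax /Rmin.
case: (Rle_dec b x) => ?; case: Rle_dec => ?; lra.
Qed.

Lemma clamp_id (a b x : R) : a <= x <= b -> clamp a b x = x.
Proof.
move=> H; rewrite /clamp /Rmax /Rmin.
case: (Rle_dec b x) => ?; case: Rle_dec => ?; lra.
Qed.

Lemma cont_clamp (a b x : R) : continuous (clamp a b) x.
Proof.
have E : forall y, ((a + (b + y - Rabs (b - y)) / 2)
  + Rabs (a - (b + y - Rabs (b - y)) / 2)) / 2 = clamp a b y.
  move=> y; rewrite /clamp /Rmax /Rmin.
  case: (Rle_dec b y) => ?; case: Rle_dec => ?; split_Rabs; lra.
apply: continuous_ext E _.
cont; move=> ?; lra.
Qed.

(** * Angles of lines *)

Definition dot (u v : vec2) : R := fst u * fst v + snd u * snd v.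

(** The factor [r] may have either sign: [a] is an angle of the unoriented line of [v], determined
    modulo PI. *)
Definition dir (v : vec2) (a : R) : Prop :=
  exists r, r <> 0 /\ v = (r * cos a, r * sin a).

Lemma cos2_sin2 (a : R) : cos a * cos a + sin a * sin a = 1.
Proof. by have := sin2_cos2 a; rewrite /Rsqr; lra. Qed.

Lemma dirP (v : vec2) (a : R) :
  dir v a <-> v <> (0, 0) /\ det v (cos a, sin a) = 0.
Proof.
have C := cos2_sin2 a; split.
- case=> r [r0 ->]; rewrite /det /=; split; last by ring.
  case=> H1 H2; apply: r0.
  have -> : r = (r * cos a) * cos a + (r * sin a) * sin a.
    by transitivity (r * (cos a * cos a + sin a * sin a)); [rewrite C|]; ring.
  by rewrite H1 H2; ring.
- case: v => v1 v2 []; rewrite /det /= => v0 D.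
  have E1 : v1 = (v1 * cos a + v2 * sin a) * cos a.
    have -> : (v1 * cos a + v2 * sin a) * cos a = v1 * (cos a * cos a + sin a * sin a)
       - (v1 * sin a - v2 * cos a) * sin a by ring.
    by rewrite C D; ring.
  have E2 : v2 = (v1 * cos a + v2 * sin a) * sin a.
    have -> : (v1 * cos a + v2 * sin a) * sin a = v2 * (cos a * cos a + sin a * sin a)
       + (v1 * sin a - v2 * cos a) * cos a by ring.
    by rewrite C D; ring.
  exists (v1 * cos a + v2 * sin a); split; last by rewrite -E1 -E2.
  move=> H; apply: v0; rewrite H in E1 E2.
  by rewrite E1 E2 !Rmult_0_l.
Qed.

Lemma cos_IZR_PI (k : Z) : cos (IZR k * PI) <> 0.
Proof.
have S : sin (IZR k * PI) = 0 by apply: sin_eq_0_1; exists k.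
have := cos2_sin2 (IZR k * PI); rewrite S => E H; rewrite H in E; lra.
Qed.

Lemma dir_shift (v : vec2) (a : R) (k : Z) : dir v a -> dir v (a + IZR k * PI).
Proof.
have S : sin (IZR k * PI) = 0 by apply: sin_eq_0_1; exists k.
have C0 := cos_IZR_PI (k := k).
move/dirP=> [v0 D]; apply/dirP; split=> //.
move: D; rewrite /det /= cos_plus sin_plus S => D.
have -> : fst v * (sin a * cos (IZR k * PI) + cos a * 0)
  - snd v * (cos a * cos (IZR k * PI) - sin a * 0)
  = cos (IZR k * PI) * (fst v * sin a - snd v * cos a) by ring.
rewrite D; ring.
Qed.

Lemma dir_unique (v : vec2) (a b : R) :
  dir v a -> dir v b -> exists k : Z, b = a + IZR k * PI.
Proof.
case=> r [r0 ->] /dirP [_]; rewrite /det /= => D.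
have S : sin (b - a) = 0.
  rewrite sin_minus; apply: (Rmult_eq_reg_l r) => //; lra.
have [k Hk] := sin_eq_0_0 _ S; exists k; lra.
Qed.

(** The quotient is the tangent of the angle from [u] to [v]; for lines, the branch of that angle in
    (- PI / 2, PI / 2) is as good as any other. *)
Lemma dir_add_atan (u v : vec2) (a : R) :
  dir u a -> dot u v <> 0 -> dir v (a + atan (det u v / dot u v)).
Proof.
case=> r [r0 ->]; case: v => v1 v2; rewrite /dot /det /= => H.
set T := _ / _; have C0 : cos (atan T) <> 0.
  by have := cos_atan T => ->; apply: Rgt_not_eq; apply: Rdiv_lt_0_compat;
    [lra|apply: sqrt_lt_R0; have := Rle_0_sqr T; lra].
have HS : sin (atan T) = T * cos (atan T).
  have := tan_atan T; rewrite /tan => E; rewrite -{2}E; field; exact: C0.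
apply/dirP; split.
  by case=> E1 E2; apply: H; rewrite E1 E2; ring.
rewrite /det /= cos_plus sin_plus HS.
have -> : v1 * (sin a * cos (atan T) + cos a * (T * cos (atan T)))
   - v2 * (cos a * cos (atan T) - sin a * (T * cos (atan T)))
   = cos (atan T) * ((v1 * sin a - v2 * cos a) + T * (v1 * cos a + v2 * sin a)).
  by ring.
have H' : v1 * cos a + v2 * sin a <> 0.
  move=> E; apply: H.
  transitivity (r * (v1 * cos a + v2 * sin a)); first by ring.
  by rewrite E; ring.
rewrite /T; field; exact: H.
Qed.

(* The clockwise quarter turn of [v] has angle [b - PI / 2]. *)
Lemma dir_sub_acot (v u : vec2) (b : R) :
  dir v b -> det v u <> 0 -> dir u (b - PI / 2 + atan (- dot v u / det v u)).
Proof.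
case=> r [r0 ->] H.
have D : dir (r * sin b, - (r * cos b)) (b - PI / 2).
  exists r; split=> //; rewrite cos_minus sin_minus cos_PI2 sin_PI2.
  by congr pair; ring.
have := dir_add_atan D (v := u); rewrite /dot /det /=.
move: H; rewrite /det /dot /= => H.
have -> : r * sin b * snd u - - (r * cos b) * fst u
  = r * cos b * fst u + r * sin b * snd u by ring.
have -> : r * sin b * fst u + - (r * cos b) * snd u
  = - (r * cos b * snd u - r * sin b * fst u) by ring.
move=> X; have {}X := X (Ropp_neq_0_compat _ H).
suff -> : - (r * cos b * fst u + r * sin b * snd u) /
   (r * cos b * snd u - r * sin b * fst u)
   = (r * cos b * fst u + r * sin b * snd u) /
   - (r * cos b * snd u - r * sin b * fst u) by [].
by field.
Qed.

Lemma dir_neq0 (v : vec2) (a : R) : dir v a -> v <> (0, 0).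
Proof. by case/dirP. Qed.

(** The difference of the two lifts is continuous with values in PI Z. If it changed, it would pass
    through a half-odd multiple of PI. *)
Lemma lift_unique (v : R -> vec2) (phi psi : R -> R) (a b : R) :
  a <= b -> continuous_on (fun t => a <= t <= b) phi ->
  continuous_on (fun t => a <= t <= b) psi ->
  (forall t, a <= t <= b -> dir (v t) (phi t)) ->
  (forall t, a <= t <= b -> dir (v t) (psi t)) ->
  phi b - phi a = psi b - psi a.
Proof.
move=> ab Cphi Cpsi Dphi Dpsi.
set d := fun t => phi (clamp a b t) - psi (clamp a b t).
have Cd : forall t, continuous d t.
  move=> t; apply: cont_minus;
    (apply: (continuous_of_on (E := fun t => a <= t <= b)) => //;
     [move=> y; exact: clamp_in | exact: cont_clamp]).
have Zd : forall t, exists k, d t = IZR k * PI.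
  move=> t; have H := clamp_in t ab.
  have [k Hk] := dir_unique (Dpsi _ H) (Dphi _ H).
  by exists k; rewrite /d Hk; ring.
have E : d a = d b.
  have P := PI_RGT_0.
  have [ka Ha] := Zd a; have [kb Hb] := Zd b.
  case: (Z.eq_dec ka kb) => [e|ne]; first by rewrite Ha Hb e.
  have : exists y k, y = IZR k * PI + PI / 2 /\
      Rmin (d a) (d b) <= y <= Rmax (d a) (d b).
    case: (Z.lt_total ka kb) => [l|[//|l]].
    - exists (IZR ka * PI + PI / 2), ka; split=> //.
      have : IZR ka + 1 <= IZR kb by rewrite -plus_IZR; apply: IZR_le; lia.
      rewrite Ha Hb => l'; rewrite /Rmin /Rmax; case: Rle_dec => ?; nra.
    - exists (IZR kb * PI + PI / 2), kb; split=> //.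
      have : IZR kb + 1 <= IZR ka by rewrite -plus_IZR; apply: IZR_le; lia.
      rewrite Ha Hb => l'; rewrite /Rmin /Rmax; case: Rle_dec => ?; nra.
  case=> y [k [Hy Hy']].
  have [x [_ Hx]] := IVT_gen_consistent d a b y Cd Hy'.
  have [m Hm] := Zd x.
  have : IZR m = IZR k + 1 / 2.
    apply: (Rmult_eq_reg_r PI); [lra|lra].
  move=> H; exfalso.
  have : IZR (2 * (m - k)) = IZR 1 by rewrite mult_IZR minus_IZR; lra.
  by move/eq_IZR; lia.
move: E; rewrite /d (clamp_id (x := a)) ?(clamp_id (x := b)); lra.
Qed.

(** * Angle functions of nonvanishing vector fields on a rectangle *)

Definition rect (a b c d : R) (w : R * R) : Prop :=
  a <= fst w <= b /\ c <= snd w <= d.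

(** Total turning along the chain [U 0 w], ..., [U n w], each turn taken in (- PI / 2, PI / 2); for
    continuous [U] it is continuous in [w] as long as consecutive dot products stay positive. *)
Fixpoint angle_sum (U : nat -> R * R -> vec2) (n : nat) (w : R * R) : R :=
  match n with
  | O => 0
  | S m => angle_sum U m w + atan (det (U m w) (U n w) / dot (U m w) (U n w))
  end.

(** For unit vectors the dot product is 1 - |u - v|^2 / 2, and here |u - v|^2 < 1 / 2. *)
Lemma dot_unit_close (u v : vec2) :
  dot u u = 1 -> dot v v = 1 -> Rabs (fst v - fst u) < / 2 ->
  Rabs (snd v - snd u) < / 2 -> 0 < dot u v.
Proof.
case: u => u1 u2; case: v => v1 v2; rewrite /dot /=.
move=> H1 H2 /Rabs_def2 [A B] /Rabs_def2 [C D].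
suff : (v1 - u1) * (v1 - u1) + (v2 - u2) * (v2 - u2) < 2 by nra.
nra.
Qed.

Lemma vec2_dir_ex (v : vec2) : v <> (0, 0) -> exists a, dir v a.
Proof.
case: v => v1 v2 v0.
case: (Req_dec v1 0) => H.
- have V2 : v2 <> 0 by move=> E; apply: v0; rewrite H E.
  exists (PI / 2); exists v2; split=> //; rewrite cos_PI2 sin_PI2 H.
  by congr pair; ring.
- exists (0 + atan (det (1, 0) (v1, v2) / dot (1, 0) (v1, v2))).
  apply: dir_add_atan; last by rewrite /dot /=; lra.
  by exists 1; split; [lra|rewrite cos_0 sin_0; congr pair; ring].
Qed.

(* Sum the small angles between consecutive values of [G] along the ray from
   the corner; by uniform continuity these are less than a right angle, so that
   they are given by [atan], continuously. *)
Lemma angle_lift2 (G : R * R -> vec2) (a b c d : R) :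
  a <= b -> c <= d -> continuous_on (rect a b c d) G ->
  (forall w, rect a b c d w -> G w <> (0, 0)) ->
  exists phi : R * R -> R, continuous_on (rect a b c d) phi /\
    forall w, rect a b c d w -> dir (G w) (phi w).
Proof.
move=> ab cd CG NG.
set h := fun w : R * R => (clamp a b (fst w), clamp c d (snd w)).
have hin : forall w, rect a b c d (h w) by move=> w; split; exact: clamp_in.
have hid : forall w, rect a b c d w -> h w = w.
  by case=> x y [/= H1 H2]; rewrite /h /= !clamp_id.
have Ch : forall w, continuous h w.
  move=> w; apply: cont_pair.
  - apply: (continuous_comp (fst : R * R -> R) (clamp a b)).
      by cont. by apply: cont_clamp.
  - apply: (continuous_comp (snd : R * R -> R) (clamp c d)).
      by cont. by apply: cont_clamp.
have CGh : forall w, continuous (fun w => G (h w)) w.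
  by move=> w; exact: (continuous_of_on CG hin (Ch w)).
(* Normalizing [G] makes a small increment bound the angle, whatever the size of [G]. *)
set nn := fun w => sqrt (dot (G (h w)) (G (h w))).
have dpos : forall w, 0 < dot (G (h w)) (G (h w)).
  move=> w; have := NG _ (hin w); case: (G (h w)) => x y; rewrite /dot /= => H.
  case: (Req_dec x 0) => [x0|x0]; last by nra.
  have y0 : y <> 0 by move=> y0; apply: H; rewrite x0 y0.
  by nra.
have npos : forall w, 0 < nn w by move=> w; exact: sqrt_lt_R0.
set U := fun w => (fst (G (h w)) / nn w, snd (G (h w)) / nn w).
have Cdot : forall w, continuous (fun w => dot (G (h w)) (G (h w))) w.
  by move=> w; rewrite /dot; cont; apply: CGh.
have CU : forall w, continuous U w.
  move=> w; have N := Rgt_not_eq _ _ (npos w).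
  by rewrite /U; cont; rewrite /nn; cont.
have UU : forall w, dot (U w) (U w) = 1.
  move=> w; have N := Rgt_not_eq _ _ (npos w).
  have E : nn w * nn w = dot (G (h w)) (G (h w)) by apply: sqrt_sqrt; have := dpos w; lra.
  rewrite {1}/dot /U /=.
  transitivity (dot (G (h w)) (G (h w)) / (nn w * nn w)).
    by rewrite /dot; field.
  by rewrite E; field; have := dpos w; lra.
have GU : forall w, G (h w) = (nn w * fst (U w), nn w * snd (U w)).
  move=> w; have N := Rgt_not_eq _ _ (npos w); rewrite /U /=.
  by case: (G (h w)) => x y /=; congr pair; field.
have CU2 (p : vec2 -> R) : (forall z, continuous p z) ->
    forall x y, continuity_2d_pt (fun x y => p (U (x, y))) x y.
  move=> Cp x y; apply/continuity_2d_pt_filterlim.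
  apply: (continuous_ext (fun w : R * R => p (U w))); first by case.
  exact: (continuous_comp U p).
have Cfst : forall z : vec2, continuous (fst : vec2 -> R) z by case=> x y; exact: continuous_fst.
have Csnd : forall z : vec2, continuous (snd : vec2 -> R) z by case=> x y; exact: continuous_snd.
have half : 0 < / 2 by lra.
have [d1 H1] := @uniform_continuity_2d (fun x y => fst (U (x, y))) a b c d
  (fun x y _ _ => CU2 fst Cfst x y) (mkposreal _ half).
have [d2 H2] := @uniform_continuity_2d (fun x y => snd (U (x, y))) a b c d
  (fun x y _ _ => CU2 snd Csnd x y) (mkposreal _ half).
have D1 := cond_pos d1; have D2 := cond_pos d2.
set del := Rmin d1 d2.
have Dpos : 0 < del by rewrite /del /Rmin; case: Rle_dec => ?; lra.
have Dle1 : del <= d1 by exact: Rmin_l.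
have Dle2 : del <= d2 by exact: Rmin_r.
(* One of [N] equal steps along the ray moves each coordinate by at most a side length over [N],
   hence by less than [del]. Taking [N] positive covers a rectangle reduced to a point. *)
have [N [N0 HN]] : exists N : nat, (0 < N)%nat /\ (b - a) + (d - c) < INR N * del.
  have [N HN] := nfloor_ex (((b - a) + (d - c)) / del)
    (Rdiv_le_0_compat ((b - a) + (d - c)) del ltac:(lra) Dpos).
  exists (S N); split; first lia.
  have [_ HN2] := HN; rewrite S_INR.
  have -> : (b - a) + (d - c) = ((b - a) + (d - c)) / del * del by field; lra.
  by apply: Rmult_lt_compat_r => //; lra.
have IN : 0 < INR N by apply: lt_0_INR.
set g := fun (k : nat) (w : R * R) =>
  (a + INR k / INR N * (fst (h w) - a), c + INR k / INR N * (snd (h w) - c)).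
have frac : forall k, (k <= N)%nat -> 0 <= INR k / INR N <= 1.
  move=> k kN; split; first by apply: Rdiv_le_0_compat => //; exact: pos_INR.
  apply/Rle_div_l => //; rewrite Rmult_1_l; exact: le_INR.
have gin : forall k w, (k <= N)%nat -> rect a b c d (g k w).
  move=> k w kN; have := frac _ kN; have [] := hin w.
  rewrite /rect /g /=; set x := fst _; set y := snd _; set t := _ / _; nra.
have step : forall k w, (S k <= N)%nat -> 0 < dot (U (g k w)) (U (g (S k) w)).
  move=> k w kN.
  have G1 := gin k w ltac:(lia); have G2 := gin (S k) w kN.
  have E : INR (S k) / INR N = INR k / INR N + / INR N by rewrite S_INR; field; lra.
  have I0 : 0 < / INR N by exact: Rinv_0_lt_compat.
  have I1 : / INR N * ((b - a) + (d - c)) < del.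
    apply: (Rmult_lt_reg_l (INR N)) => //; rewrite -Rmult_assoc Rinv_r; lra.
  have [[? ?] [? ?]] := hin w.
  have B1 : Rabs (fst (g (S k) w) - fst (g k w)) < del.
    have -> : fst (g (S k) w) - fst (g k w) = / INR N * (fst (h w) - a).
      by rewrite /g /fst E; ring.
    by rewrite Rabs_pos_eq; nra.
  have B2 : Rabs (snd (g (S k) w) - snd (g k w)) < del.
    have -> : snd (g (S k) w) - snd (g k w) = / INR N * (snd (h w) - c).
      by rewrite /g /snd E; ring.
    by rewrite Rabs_pos_eq; nra.
  apply: dot_unit_close => //.
  - rewrite (surjective_pairing (g (S k) w)) (surjective_pairing (g k w)).
    by case: G1 => ? ?; case: G2 => ? ?; apply: H1 => //; lra.
  - rewrite (surjective_pairing (g (S k) w)) (surjective_pairing (g k w)).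
    by case: G1 => ? ?; case: G2 => ? ?; apply: H2 => //; lra.
have [a0 Ha0] := vec2_dir_ex (NG (a, c) ltac:(by rewrite /rect /=; lra)).
set V := fun k w => U (g k w).
have Cg : forall k w, continuous (V k) w.
  move=> k w; apply: (continuous_comp (g k) U) => //.
  by rewrite /g; cont.
have CA : forall n, (n <= N)%nat -> forall w, continuous (angle_sum V n) w.
  elim=> [|n IH] nN w; first exact: continuous_const.
  have S0 := step n w nN.
  have C1 := Cg n w; have C2 := Cg (S n) w.
  apply: (cont_plus (f := angle_sum V n)); first by apply: IH; lia.
  by rewrite /det /dot; cont; apply: Rgt_not_eq.
have DU : forall n w, (n <= N)%nat -> dir (V n w) (a0 + angle_sum V n w).
  elim=> [|n IH] w nN.
  - rewrite /= Rplus_0_r.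
    have E : g 0%nat w = (a, c).
      by rewrite /g /=; congr pair; rewrite Rdiv_0_l; ring.
    rewrite /V E; case: Ha0 => r [r0 Hr]; exists (r / nn (a, c)).
    have Np := npos (a, c); split.
      by apply: Rmult_integral_contrapositive; split=> //; apply: Rinv_neq_0_compat; lra.
    have A : h (a, c) = (a, c) by apply: hid; rewrite /rect /=; lra.
    by rewrite /U A Hr /=; congr pair; field; lra.
  - have S0 := step n w nN.
    rewrite [angle_sum _ _ _]/= -Rplus_assoc; apply: dir_add_atan.
      by apply: IH; lia.
    exact: Rgt_not_eq.
exists (fun w => a0 + angle_sum V N w); split.
- apply: continuous_on_of => w _; apply: cont_plus; first by cont.
  exact: CA.
- move=> w Hw; have := DU N w ltac:(lia).
  have E : g N w = h w.
    rewrite /g; case: (h w) => x y /=; congr pair; field; lra.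
  have Np := npos w.
  rewrite /V E; case=> r [r0 Hr].
  have E2 : U (h w) = U w by rewrite /U /nn (hid (h w)).
  exists (nn w * r); split; first by apply: Rmult_integral_contrapositive; split=> //; lra.
  by rewrite -{1}(hid w Hw) GU -E2 Hr /=; congr pair; ring.
Qed.

(** * Lifts of concatenated paths of lines *)

Lemma lifts_single (v : R -> vec2) (phi : R -> R) (ps : list (R -> vec2)) (b : R) :
  continuous_on (fun t => 0 <= t <= 1) phi ->
  (forall t, 0 <= t <= 1 -> dir (v t) (phi t)) ->
  lifts ps (phi 1) b -> lifts (v :: ps) (phi 0) b.
Proof.
move=> Cp Dp H; apply: lifts_cons H => // t Ht.
by apply/dirP; exact: Dp.
Qed.

Lemma lifts_consE (v : R -> vec2) (ps : list (R -> vec2)) (a b : R) :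
  lifts (v :: ps) a b -> exists phi,
   continuous_on (fun t => 0 <= t <= 1) phi /\
   (forall t, 0 <= t <= 1 -> dir (v t) (phi t)) /\ phi 0 = a /\ lifts ps (phi 1) b.
Proof.
move=> H; inversion H as [|v' ps' phi b' Cp Dp L]; subst.
by exists phi; split=> //; split=> [t Ht|]; [apply/dirP; exact: Dp|].
Qed.

Lemma lifts_nilE (a b : R) : lifts [] a b -> a = b.
Proof. by move=> H; inversion H. Qed.

(** By uniqueness of lifts on each piece; hence a given list of pieces has at most one degree. *)
Lemma lifts_increment (ps : list (R -> vec2)) (a b a' b' : R) :
  lifts ps a b -> lifts ps a' b' -> b - a = b' - a'.
Proof.
elim: ps a a' => [|v ps IH] a a' H H'.
  by rewrite (lifts_nilE H) (lifts_nilE H'); ring.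
have [phi [Cp [Dp [E L]]]] := lifts_consE H.
have [psi [Cs [Ds [E' L']]]] := lifts_consE H'.
have := IH _ _ L L'; have := lift_unique Rle_0_1 Cp Cs Dp Ds; lra.
Qed.

Lemma lifts_app (ps qs : list (R -> vec2)) (a b c : R) :
  lifts ps a b -> lifts qs b c -> lifts (ps ++ qs) a c.
Proof.
elim: ps a => [|v ps IH] a H H' /=; first by rewrite (lifts_nilE H).
have [phi [Cp [Dp [<- L]]]] := lifts_consE H.
by apply: lifts_single => //; exact: IH.
Qed.

Lemma lifts_shift (ps : list (R -> vec2)) (a b : R) (k : Z) :
  lifts ps a b -> lifts ps (a + IZR k * PI) (b + IZR k * PI).
Proof.
elim: ps a => [|v ps IH] a H; first by rewrite (lifts_nilE H); exact: lifts_nil.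
have [phi [Cp [Dp [<- L]]]] := lifts_consE H.
apply: (lifts_single (phi := fun t => phi t + IZR k * PI)).
- apply: (continuous_on_comp (E := fun _ => True) (g := fun x => x + IZR k * PI) Cp) => //.
  by apply: continuous_on_of => x _; cont.
- by move=> t Ht; apply: dir_shift; exact: Dp.
- exact: IH.
Qed.

Lemma lifts_one (v : R -> vec2) (phi : R -> R) :
  continuous_on (fun t => 0 <= t <= 1) phi ->
  (forall t, 0 <= t <= 1 -> dir (v t) (phi t)) -> lifts [v] (phi 0) (phi 1).
Proof. by move=> Cp Dp; apply: lifts_single => //; exact: lifts_nil. Qed.

Lemma lifts_reverse (ps : list (R -> vec2)) (a b : R) :
  lifts ps a b -> lifts (reverse_pieces ps) b a.
Proof.
elim: ps a => [|v ps IH] a H; first by rewrite (lifts_nilE H); exact: lifts_nil.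
have [phi [Cp [Dp [<- L]]]] := lifts_consE H.
rewrite /reverse_pieces /=; apply: lifts_app (IH _ L) _.
pose psi t := phi (1 - t).
have E0 : phi 0 = psi 1 by rewrite /psi; f_equal; lra.
have E1 : phi 1 = psi 0 by rewrite /psi; f_equal; lra.
rewrite E0 E1; apply: lifts_one.
- apply: continuous_on_comp Cp; last by move=> t; lra.
  by apply: continuous_on_of => w _; cont.
- by move=> t Ht; apply: Dp; lra.
Qed.

#[local] Arguments tangent : simpl never.

(** * Strands near the chord endpoints *)

Lemma locally_of_Rabs (x e : R) (P : R -> Prop) :
  0 < e -> (forall y, Rabs (y - x) < e -> P y) -> locally x P.
Proof. by move=> e0 H; exists (mkposreal e e0) => y Hy; apply: H. Qed.

Lemma Derive_affine_loc (f : R -> R) (x e a b : R) :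
  0 < e -> (forall y, Rabs (y - x) < e -> f y = a + b * y) -> Derive f x = b.
Proof.
move=> e0 H; apply: is_derive_unique.
apply: (is_derive_ext_loc (fun y => a + b * y)).
  by apply: locally_of_Rabs e0 _ => y Hy; rewrite H.
by auto_derive=> //; ring.
Qed.

Lemma smooth1_ex_derive (g : R -> R) (x : R) : smooth1 g -> ex_derive g x.
Proof. by move=> H; exact: (H 1%nat x). Qed.

Lemma smooth1_Derive (g : R -> R) : smooth1 g -> smooth1 (Derive g).
Proof.
move=> H n x; case: n => [|n] //=.
have := H (S (S n)) x; rewrite /=; apply: ex_derive_ext => t.
by elim: n t => [|n IH] t //=; apply: Derive_ext.
Qed.

Lemma smooth1_cont (g : R -> R) (x : R) : smooth1 g -> continuous g x.
Proof. by move=> H; apply: ex_derive_continuous; exact: smooth1_ex_derive. Qed.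

(** Good position gives the strand through an auxiliary parameter of unspecified regularity. The sum
    x + y is free of it, so its derivative vanishes, and unit speed fixes the size. The sign of [s],
    the orientation of the strand, stays open. *)
Lemma tip_tangent (I : finType) (S : surgery I) (r : chord I) :
  surgery_setup S -> is_chord (gam S) r ->
  exists s, s * s = 1 / 2 /\ tangent (gam S) (tip r) = (s, - s).
Proof.
move=> HS Hr; have L := ss_link HS; have C := ss_chords HS.
have [eta [e0 H]] := cc_good_position C Hr.
have [sx [sy _]] := ll_smooth L (fst (tip r)).
have U := ll_unit_speed L (fst (tip r)) (snd (tip r)).
have Z : Derive (fun s => xc (gam S (fst (tip r)) s)) (snd (tip r))
     + Derive (fun s => yc (gam S (fst (tip r)) s)) (snd (tip r)) = 0.
  rewrite -Derive_plus; try exact: smooth1_ex_derive.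
  apply: (Derive_affine_loc (a := xc (pos (gam S) (tip r)) + yc (pos (gam S) (tip r))) e0).
  move=> y Hy; have [[s Hs] _] := H _ Hy; move: Hs.
  have -> : snd (tip r) + (y - snd (tip r)) = y by ring.
  by rewrite /xy /xc /yc => ->; rewrite /=; ring.
rewrite /tangent; exists (Derive (fun s => xc (gam S (fst (tip r)) s)) (snd (tip r))).
have E : Derive (fun s => yc (gam S (fst (tip r)) s)) (snd (tip r))
   = - Derive (fun s => xc (gam S (fst (tip r)) s)) (snd (tip r)) by lra.
by move: U; rewrite E => U; split=> //; lra.
Qed.

Lemma tail_tangent (I : finType) (S : surgery I) (r : chord I) :
  surgery_setup S -> is_chord (gam S) r ->
  exists s, s * s = 1 / 2 /\ tangent (gam S) (tail r) = (s, s).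
Proof.
move=> HS Hr; have L := ss_link HS; have C := ss_chords HS.
have [eta [e0 H]] := cc_good_position C Hr.
have [sx [sy _]] := ll_smooth L (fst (tail r)).
have U := ll_unit_speed L (fst (tail r)) (snd (tail r)).
have Z : Derive (fun s => xc (gam S (fst (tail r)) s)) (snd (tail r))
     - Derive (fun s => yc (gam S (fst (tail r)) s)) (snd (tail r)) = 0.
  rewrite -Derive_minus; try exact: smooth1_ex_derive.
  apply: (Derive_affine_loc (a := xc (pos (gam S) (tip r)) - yc (pos (gam S) (tip r))) e0).
  move=> y Hy; have [_ [s Hs]] := H _ Hy; move: Hs.
  have -> : snd (tail r) + (y - snd (tail r)) = y by ring.
  by rewrite /xy /xc /yc => ->; rewrite /=; ring.
rewrite /tangent; exists (Derive (fun s => xc (gam S (fst (tail r)) s)) (snd (tail r))).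
have E : Derive (fun s => yc (gam S (fst (tail r)) s)) (snd (tail r))
   = Derive (fun s => xc (gam S (fst (tail r)) s)) (snd (tail r)) by lra.
by move: U; rewrite E => U; split=> //; lra.
Qed.

Definition chord_end (I : finType) (S : surgery I) (e : I * R) : Prop :=
  exists r, is_chord (gam S) r /\ (e = tail r \/ e = tip r).

Lemma chord_end_tail (I : finType) (S : surgery I) (r : chord I) :
  is_chord (gam S) r -> chord_end S (tail r).
Proof. by exists r; split=> //; left. Qed.

Lemma chord_end_tip (I : finType) (S : surgery I) (r : chord I) :
  is_chord (gam S) r -> chord_end S (tip r).
Proof. by exists r; split=> //; right. Qed.

Lemma chord_end_unit (I : finType) (S : surgery I) (e : I * R) :
  surgery_setup S -> dot (tangent (gam S) e) (tangent (gam S) e) = 1.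
Proof.
move=> HS; have := ll_unit_speed (ss_link HS) (fst e) (snd e).
by rewrite /dot /tangent /=; lra.
Qed.

Lemma period_IZR (T : Type) (g : R -> T) (k : Z) :
  (forall q, g (q + 1) = g q) -> forall q, g (q + IZR k) = g q.
Proof.
move=> H; have N : forall (n : nat) q, g (q + INR n) = g q.
  elim=> [|n IH] q; first by rewrite /= Rplus_0_r.
  by rewrite S_INR -Rplus_assoc H.
move=> q; case: (Z_le_dec 0 k) => kk.
- by rewrite -(Z2Nat.id k) // -INR_IZR_INZ.
- rewrite -(N (Z.to_nat (- k)) (q + IZR k)).
  by rewrite INR_IZR_INZ Z2Nat.id; [rewrite opp_IZR; f_equal; ring | lia].
Qed.

Lemma proj_period (I : finType) (S : surgery I) (i : I) (p q : R) (k : Z) :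
  surgery_setup S -> proj S i p (q + IZR k) = proj S i p q.
Proof.
move=> HS; rewrite /proj; congr xy.
by apply: (period_IZR (g := Phi S i 0 p)) => x; exact: tb_period (ss_tubes HS) _ _ _ _.
Qed.

Lemma xy_Phi (I : finType) (S : surgery I) (i : I) (z p q : R) :
  surgery_setup S -> Rabs z <= eps0 S -> Rabs p <= eps0 S ->
  xy (Phi S i z p q) = proj S i p q.
Proof. by move=> HS Hz Hp; rewrite (tb_translation (ss_tubes HS)). Qed.

Lemma proj_linear (I : finType) (S : surgery I) (e : I * R) (k : Z) (p q : R) :
  surgery_setup S -> chord_end S e ->
  Rabs p <= eps0 S -> Rabs (q - snd e - IZR k) <= eps0 S ->
  let v := tangent (gam S) e in
  proj S (fst e) p q =
      (xc (pos (gam S) e) + (q - snd e - IZR k) * fst v + p * snd v,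
       yc (pos (gam S) e) + (q - snd e - IZR k) * snd v - p * fst v).
Proof.
move=> HS [r [Hr He]] Hp Hq /=.
rewrite -(proj_period _ _ _ (- k) HS) (tb_linear (ss_tubes HS) Hr He) //.
- by rewrite opp_IZR /=; congr pair; ring.
- by rewrite opp_IZR; have -> : q + - IZR k - snd e = q - snd e - IZR k by ring.
Qed.

Lemma near_mono (I : finType) (a b : R) (P Q : I * R) :
  a <= b -> near a P Q -> near b P Q.
Proof. by move=> ab [E [k H]]; split=> //; exists k; lra. Qed.

(** A displacement in p alone reveals the tangent at the chord endpoint, whichever integer shift
    realizes [near]. *)
Lemma proj_transverse (I : finType) (S : surgery I) (e P : I * R) (p : R) :
  surgery_setup S -> chord_end S e -> near (eps0 S) e P -> Rabs p <= eps0 S ->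
  let v := tangent (gam S) e in
  proj S (fst P) p (snd P) =
    (fst (proj S (fst P) 0 (snd P)) + p * snd v,
     snd (proj S (fst P) 0 (snd P)) - p * fst v).
Proof.
move=> HS He [E [k Hk]] Hp v; have e0 := tb_eps0 (ss_tubes HS).
have A0 : Rabs 0 <= eps0 S by rewrite Rabs_R0; lra.
have := proj_linear HS He Hp Hk; have := proj_linear HS He A0 Hk.
by rewrite E /v => -> ->; congr pair; rewrite /fst /snd; ring.
Qed.

(** Compare the displacements to p = [eps0] computed from the two endpoints. *)
Lemma near_same_direction (I : finType) (S : surgery I) (e e' P : I * R) :
  surgery_setup S -> chord_end S e -> chord_end S e' ->
  near (eps0 S) e P -> near (eps0 S) e' P ->
  tangent (gam S) e = tangent (gam S) e'.
Proof.
move=> HS He He' N N'; have e0 := tb_eps0 (ss_tubes HS).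
have A1 : Rabs (eps0 S) <= eps0 S by rewrite Rabs_pos_eq; lra.
have := proj_transverse HS He N A1; rewrite (proj_transverse HS He' N' A1).
case: (tangent _ e) => v1 v2; case: (tangent _ e') => w1 w2 /=.
case=> H1 H2; congr pair; apply: (Rmult_eq_reg_l (eps0 S)); lra.
Qed.

(** Otherwise the strand would have both diagonal directions at once. This excludes third tubes over
    a rectangle and separates the two ends of an arc from a tip to a tail. *)
Lemma tip_tail_exclusive (I : finType) (S : surgery I) (r r' : chord I) (P : I * R) :
  surgery_setup S -> is_chord (gam S) r -> is_chord (gam S) r' ->
  near (eps0 S) (tip r) P -> near (eps0 S) (tail r') P -> False.
Proof.
move=> HS Hr Hr' N N'.
have := near_same_direction HS (chord_end_tip Hr) (chord_end_tail Hr') N N'.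
have [s [Hs ->]] := tip_tangent HS Hr; have [t [Ht ->]] := tail_tangent HS Hr'.
case=> E1 E2; nra.
Qed.

(** Otherwise the parameters at distance 1 / 2 on either side of the endpoint would both obey the
    linear formula, which separates them, although they differ by a full period. *)
Lemma eps0_lt_half (I : finType) (S : surgery I) (e : I * R) :
  surgery_setup S -> chord_end S e -> eps0 S < 1 / 2.
Proof.
move=> HS He; have e0 := tb_eps0 (ss_tubes HS).
case: (Rlt_le_dec (eps0 S) (1 / 2)) => // H; exfalso.
have A0 : Rabs 0 <= eps0 S by rewrite Rabs_R0; lra.
have A1 : Rabs (snd e - 1 / 2 - snd e - IZR 0) <= eps0 S.
  by rewrite Rabs_left; lra.
have A2 : Rabs (snd e - 1 / 2 + IZR 1 - snd e - IZR 0) <= eps0 S.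
  by rewrite Rabs_pos_eq; lra.
have := proj_linear HS He A0 A2; rewrite proj_period // (proj_linear HS He A0 A1).
have := chord_end_unit e HS; case: (tangent _ e) => v1 v2; rewrite /dot /= => U.
case=> H1 H2; have V1 : v1 = 0 by lra.
have V2 : v2 = 0 by lra.
by rewrite V1 V2 in U; lra.
Qed.

(** Over a rectangle the differential is a rotation: d_q goes to the unit tangent and d_p to its
    clockwise quarter turn. *)
Lemma dproj_near (I : finType) (S : surgery I) (e : I * R) (i : I) (p q : R) (w : vec2) :
  surgery_setup S -> chord_end S e -> near (eps S) e (i, q) -> Rabs p <= eps S ->
  let v := tangent (gam S) e in
  dproj S i p q w = (fst w * snd v + snd w * fst v, - (fst w * fst v) + snd w * snd v).
Proof.
move=> HS He [E [k Hk]] Hp v; have [? ?] := ss_eps HS.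
change (fst e = i) in E; subst i; change (Rabs (q - snd e - IZR k) <= eps S) in Hk.
(* The slack between [eps] and [eps0] makes the linear formula hold on a whole neighborhood, even at
   distance exactly [eps]. *)
have d0 : 0 < eps0 S - eps S by lra.
rewrite /dproj.
have T := @proj_linear _ S e k _ _ HS He.
have Kp : forall y, Rabs (y - p) < eps0 S - eps S -> Rabs y <= eps0 S.
  move=> y; split_Rabs; lra.
have Kq : forall y, Rabs (y - q) < eps0 S - eps S -> Rabs (y - snd e - IZR k) <= eps0 S.
  move=> y; split_Rabs; lra.
have Hk' : Rabs (q - snd e - IZR k) <= eps0 S by lra.
have Hp' : Rabs p <= eps0 S by lra.
rewrite {}/v; move: T; case: (tangent _ e) => v1 v2 T.
change (forall r r0 : R, Rabs r <= eps0 S -> Rabs (r0 - snd e - IZR k) <= eps0 S ->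
  proj S (fst e) r r0 = (xc (pos (gam S) e) + (r0 - snd e - IZR k) * v1 + r * v2,
     yc (pos (gam S) e) + (r0 - snd e - IZR k) * v2 - r * v1)) in T.
rewrite (Derive_affine_loc (f := fun s => fst (proj S (fst e) s q)) d0
  (a := xc (pos (gam S) e) + (q - snd e - IZR k) * v1) (b := v2)); last first.
  by move=> y Hy; rewrite T /=; [ring|exact: Kp|].
rewrite (Derive_affine_loc (f := fun s => snd (proj S (fst e) s q)) d0
  (a := yc (pos (gam S) e) + (q - snd e - IZR k) * v2) (b := - v1)); last first.
  by move=> y Hy; rewrite T /=; [ring|exact: Kp|].
rewrite (Derive_affine_loc (f := fun s => fst (proj S (fst e) p s)) d0
  (a := xc (pos (gam S) e) + (- snd e - IZR k) * v1 + p * v2) (b := v1)); last first.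
  by move=> y Hy; rewrite T /=; [ring| |exact: Kq].
rewrite (Derive_affine_loc (f := fun s => snd (proj S (fst e) p s)) d0
  (a := yc (pos (gam S) e) + (- snd e - IZR k) * v2 - p * v1) (b := v2)); last first.
  by move=> y Hy; rewrite T /=; [ring| |exact: Kq].
by rewrite /=; congr pair; ring.
Qed.

Lemma tangent_dproj (I : finType) (S : surgery I) (P : I * R) :
  surgery_setup S -> tangent (gam S) P = dproj S (fst P) 0 (snd P) (0, 1).
Proof.
move=> HS; have E : forall s, xy (gam S (fst P) s) = proj S (fst P) 0 s.
  by move=> s; rewrite /proj (tb_core (ss_tubes HS)).
rewrite /tangent /dproj /=; congr pair; rewrite !Rmult_0_l Rplus_0_l Rmult_1_l;
  apply: Derive_ext => s; by rewrite -E.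
Qed.

Lemma tangent_near (I : finType) (S : surgery I) (e P : I * R) :
  surgery_setup S -> chord_end S e -> near (eps S) e P ->
  tangent (gam S) P = tangent (gam S) e.
Proof.
move=> HS He HN; have [? ?] := ss_eps HS; rewrite tangent_dproj //.
rewrite (dproj_near (e := e)) //.
- by case: (tangent _ e) => v1 v2 /=; congr pair; ring.
- by rewrite Rabs_R0; lra.
Qed.

(** * The projected tubes are local diffeomorphisms *)

Lemma smooth3_cont23 (g : R -> R -> R -> R) (w : R * R) :
  smooth3 g -> continuous (fun w : R * R => g 0 (fst w) (snd w)) w.
Proof.
move=> H; have C := @s3_cont _ H (0, fst w, snd w).
apply: (continuous_comp (fun w : R * R => ((0, fst w), snd w))
   (fun w : R * R * R => g (fst (fst w)) (snd (fst w)) (snd w))) => //.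
by cont.
Qed.

Lemma smooth3_2d (g : R -> R -> R -> R) (x y : R) :
  smooth3 g -> continuity_2d_pt (fun p q => g 0 p q) x y.
Proof.
move=> H; apply/(continuity_2d_pt_filterlim (fun p q => g 0 p q)).
exact (@smooth3_cont23 g (x, y) H).
Qed.

Lemma locally_2d_all (P : R -> R -> Prop) (x y : R) :
  (forall u v, P u v) -> locally_2d P x y.
Proof. by move=> H; exists (mkposreal 1 Rlt_0_1) => u v _ _. Qed.

Lemma smooth3_Schwarz (g : R -> R -> R -> R) (x y : R) : smooth3 g ->
  Derive (fun z => Derive (fun t => g 0 z t) y) x
   = Derive (fun z => Derive (fun t => g 0 t z) x) y.
Proof.
move=> H; have H2 := s3_2 H; have H3 := s3_3 H.
apply: (Schwarz (fun p q => g 0 p q)).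
- apply: locally_2d_all => u v; split; first exact: (s3_ex2 H).
  split; first exact: (s3_ex3 H).
  by split; [exact: (s3_ex2 H3) | exact: (s3_ex3 H2)].
- exact (@smooth3_2d _ x y (s3_2 H3)).
- exact (@smooth3_2d _ x y (s3_3 H2)).
Qed.

(* Comparing the mixed derivatives of the two contact equations for [Phi] gives
   [d alpha] in both charts. *)
Lemma dproj_det (I : finType) (S : surgery I) (i : I) (p q : R) (v w : vec2) :
  surgery_setup S -> Rabs p <= eps S ->
  det (dproj S i p q v) (dproj S i p q w) = det v w.
Proof.
move=> HS Hp; have [? ?] := ss_eps HS; have T := ss_tubes HS.
have e0 := tb_eps0 T.
have [sx [sy sz]] := tb_smooth T i.
rewrite /dproj /proj /xy.
change (fun s => fst (fst (Phi S i 0 s q))) with (fun s => xc (Phi S i 0 s q)).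
change (fun s => fst (fst (Phi S i 0 p s))) with (fun s => xc (Phi S i 0 p s)).
change (fun s => snd (fst (Phi S i 0 s q))) with (fun s => yc (Phi S i 0 s q)).
change (fun s => snd (fst (Phi S i 0 p s))) with (fun s => yc (Phi S i 0 p s)).
have A0 : Rabs 0 <= eps0 S by rewrite Rabs_R0; lra.
have d0 : 0 < eps0 S - eps S by lra.
have Kp : forall y, Rabs (y - p) < eps0 S - eps S -> Rabs y <= eps0 S.
  by move=> y; split_Rabs; lra.
have E1 : Derive (fun s => Derive (fun t => zc (Phi S i 0 t s)) p) q
   = Derive (fun s => yc (Phi S i 0 p s) * Derive (fun t => xc (Phi S i 0 t s)) p) q.
  apply: Derive_ext => s; have [_ [H2 _]] := tb_contact T i s A0 (p := p) ltac:(lra).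
  lra.
have E2 : Derive (fun s => Derive (fun t => zc (Phi S i 0 s t)) q) p
   = Derive (fun s => s + yc (Phi S i 0 s q) * Derive (fun t => xc (Phi S i 0 s t)) q) p.
  apply: Derive_ext_loc; apply: locally_of_Rabs d0 _ => s Hs.
  have [_ [_ H3]] := tb_contact T i q A0 (p := s) (Kp _ Hs).
  lra.
have Z := smooth3_Schwarz p q sz; rewrite E1 E2 in Z.
have X := smooth3_Schwarz p q sx.
have ex1 : ex_derive (fun s => yc (Phi S i 0 p s)) q by exact: (s3_ex3 sy).
have ex2 : ex_derive (fun s => Derive (fun t => xc (Phi S i 0 t s)) p) q
  by exact: (s3_ex3 (s3_2 sx)).
have ex3 : ex_derive (fun s => yc (Phi S i 0 s q)) p by exact: (s3_ex2 sy).
have ex4 : ex_derive (fun s => Derive (fun t => xc (Phi S i 0 s t)) q) p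
  by exact: (s3_ex2 (s3_3 sx)).
have ex5 : ex_derive (fun s : R => s) p by exact: ex_derive_id.
have ex6 : ex_derive (fun s => yc (Phi S i 0 s q) * Derive (fun t => xc (Phi S i 0 s t)) q) p.
  exact: ex_derive_mult.
rewrite Derive_mult // Derive_plus // Derive_mult // Derive_id -X in Z.
set xp := Derive (fun s => xc (Phi S i 0 s q)) p in Z *.
set xq := Derive (fun s => xc (Phi S i 0 p s)) q in Z *.
set yp := Derive (fun s => yc (Phi S i 0 s q)) p in Z *.
set yq := Derive (fun s => yc (Phi S i 0 p s)) q in Z *.
have D : xp * yq - yp * xq = 1 by lra.
rewrite /det /=.
transitivity ((fst v * snd w - snd v * fst w) * (xp * yq - yp * xq)); first by ring.
by rewrite D; ring.
Qed.

Lemma dproj_cont (I : finType) (S : surgery I) (i : I) (v : vec2) (w : R * R) :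
  surgery_setup S -> continuous (fun w : R * R => dproj S i (fst w) (snd w) v) w.
Proof.
move=> HS; have [sx [sy sz]] := tb_smooth (ss_tubes HS) i.
have X2 := @smooth3_cont23 _ w (s3_2 sx); have X3 := @smooth3_cont23 _ w (s3_3 sx).
have Y2 := @smooth3_cont23 _ w (s3_2 sy); have Y3 := @smooth3_cont23 _ w (s3_3 sy).
by rewrite /dproj; cont.
Qed.

Lemma Derive_period (g : R -> R) (q : R) :
  (forall x, g (x + 1) = g x) -> Derive g (q + 1) = Derive g q.
Proof.
move=> H; rewrite /Derive; congr real; apply: Lim_ext => h.
by have -> : q + 1 + h = q + h + 1 by [ring]; rewrite !H.
Qed.

Lemma dproj_period (I : finType) (S : surgery I) (i : I) (p q : R) (k : Z) (v : vec2) :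
  surgery_setup S -> dproj S i p (q + IZR k) v = dproj S i p q v.
Proof.
move=> HS; apply: (period_IZR (g := fun q => dproj S i p q v)) => {}q.
have P : forall p q, proj S i p (q + 1) = proj S i p q.
  by move=> p' q'; exact: (proj_period i p' q' 1 HS).
rewrite /dproj.
rewrite (Derive_period (g := fun s => fst (proj S i p s))); last by move=> x; rewrite P.
rewrite (Derive_period (g := fun s => snd (proj S i p s))); last by move=> x; rewrite P.
by rewrite (Derive_ext _ _ p (fun s => f_equal fst (P s q)))
  (Derive_ext _ _ p (fun s => f_equal snd (P s q))).
Qed.

(** * The profile function *)

Lemma f_eps_deriv (I : finType) (S : surgery I) (p : R) :
  surgery_setup S -> is_derive (f_eps S) p (Derive (prof S) (p / eps S) / eps S).
Proof.
move=> HS; have [? ?] := ss_eps HS; have Sm := pf_smooth (ss_profile HS).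
have D : is_derive (prof S) (p / eps S) (Derive (prof S) (p / eps S)).
  by apply: Derive_correct; exact: smooth1_ex_derive.
have D2 : is_derive (fun p => p / eps S) p (1 / eps S).
  by auto_derive=> //; field; lra.
have := @is_derive_comp _ _ (prof S) (fun p => p / eps S) p _ _ D D2; rewrite /scal /= /mult /=.
by have -> : 1 / eps S * Derive (prof S) (p / eps S) = Derive (prof S) (p / eps S) / eps S
  by field; lra.
Qed.

Lemma f_eps_Derive (I : finType) (S : surgery I) (p : R) :
  surgery_setup S -> Derive (f_eps S) p = Derive (prof S) (p / eps S) / eps S.
Proof. by move=> HS; apply: is_derive_unique; exact: f_eps_deriv. Qed.

Lemma f_eps_cont (I : finType) (S : surgery I) (p : R) :
  surgery_setup S -> continuous (f_eps S) p.
Proof. by move=> HS; apply: ex_derive_continuous; eexists; exact: f_eps_deriv. Qed.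

Lemma f_eps_Derive_cont (I : finType) (S : surgery I) (p : R) :
  surgery_setup S -> continuous (Derive (f_eps S)) p.
Proof.
move=> HS; have [? ?] := ss_eps HS; have Sm := pf_smooth (ss_profile HS).
apply: (continuous_ext (fun p => Derive (prof S) (p / eps S) / eps S)).
  by move=> x; rewrite f_eps_Derive.
cont; last by move=> ?; lra.
apply: (continuous_comp (fun y => y / eps S) (Derive (prof S))).
- by cont; move=> ?; lra.
- by apply: smooth1_cont; exact: smooth1_Derive.
Qed.

(** The support condition speaks of |p| > 1 only; continuity of the derivative carries the zero to
    the endpoint. *)
Lemma prof_Derive_m1 (I : finType) (S : surgery I) :
  surgery_setup S -> Derive (prof S) (-1) = 0.
Proof.
move=> HS; have P := ss_profile HS.
have C : continuous (Derive (prof S)) (-1).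
  by apply: smooth1_cont; apply: smooth1_Derive; exact: pf_smooth.
case: (Req_dec (Derive (prof S) (-1)) 0) => // H.
have R := pf_range P (-1).
have e0 : 0 < Derive (prof S) (-1) / 2 by lra.
have [d Hd] := proj1 (filterlim_locally _ _) C (mkposreal _ e0).
have d0 := cond_pos d.
have /Hd : ball (-1) d (-1 - d / 2).
  rewrite /ball /= /AbsRing_ball /= /abs /= /minus /plus /opp /=.
  by have -> : -1 - d / 2 + - (-1) = - (d / 2) by [ring]; rewrite Rabs_Ropp Rabs_pos_eq; lra.
rewrite (pf_support P (p := -1 - d / 2)); last by rewrite Rabs_left; lra.
rewrite /ball /= /AbsRing_ball /= /abs /= /minus /plus /opp /= Rplus_0_l Rabs_Ropp.
rewrite Rabs_pos_eq; lra.
Qed.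

Lemma f_eps_m (I : finType) (S : surgery I) : surgery_setup S -> f_eps S (- eps S) = 0.
Proof.
move=> HS; have [? ?] := ss_eps HS; rewrite /f_eps (pf_zero (ss_profile HS)) //.
by have -> : - eps S / eps S = -1 by [field; lra]; lra.
Qed.

Lemma f_eps_p (I : finType) (S : surgery I) : surgery_setup S -> f_eps S (eps S) = 1.
Proof.
move=> HS; have [? ?] := ss_eps HS; have P := ss_profile HS; rewrite /f_eps.
have -> : eps S / eps S = 1 by field; lra.
have := pf_integral P; rewrite RInt_Derive.
- by rewrite (pf_zero P (p := -1)); lra.
- by move=> x _; apply: smooth1_ex_derive; exact: pf_smooth.
- by move=> x _; apply: smooth1_cont; apply: smooth1_Derive; exact: pf_smooth.
Qed.

Lemma f_eps_mono (I : finType) (S : surgery I) (x y : R) :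
  surgery_setup S -> x <= y -> f_eps S x <= f_eps S y.
Proof.
move=> HS xy; have [? ?] := ss_eps HS.
have [|t _|c [_ E]] := @MVT_gen (f_eps S) x y (Derive (f_eps S)).
- by move=> t _; rewrite f_eps_Derive //; exact: f_eps_deriv.
- by apply/continuity_pt_filterlim; exact: f_eps_cont.
have D0 : 0 <= Derive (f_eps S) c.
  rewrite f_eps_Derive //; have := pf_range (ss_profile HS) (c / eps S) => R.
  by apply: Rdiv_le_0_compat; lra.
have : 0 <= Derive (f_eps S) c * (y - x) by apply: Rmult_le_pos; lra.
lra.
Qed.

Lemma f_eps_01 (I : finType) (S : surgery I) (p : R) :
  surgery_setup S -> Rabs p <= eps S -> 0 <= f_eps S p <= 1.
Proof.
move=> HS /Rabs_le_between Hp.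
rewrite -{1}(f_eps_m HS) -(f_eps_p HS); split; apply: f_eps_mono => //; lra.
Qed.

Lemma f_eps_Derive_side (I : finType) (S : surgery I) (p : R) :
  surgery_setup S -> Rabs p = eps S -> Derive (f_eps S) p = 0.
Proof.
move=> HS Hp; have [? ?] := ss_eps HS; rewrite f_eps_Derive //.
have Z := prof_Derive_m1 HS.
have : p = eps S \/ p = - eps S by move: Hp; split_Rabs; lra.
case=> ->.
- have -> : eps S / eps S = - -1 by field; lra.
  by rewrite (pf_even (ss_profile HS)) Z Rdiv_0_l.
- have -> : - eps S / eps S = -1 by field; lra.
  by rewrite Z Rdiv_0_l.
Qed.

Lemma f_eps_Derive_affine (I : finType) (S : surgery I) (p : R) :
  surgery_setup S -> Rabs p <= eps S * ((1 - delta S) / 2) ->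
  Derive (f_eps S) p = 1 / eps S.
Proof.
move=> HS Hp; have [? ?] := ss_eps HS; rewrite f_eps_Derive //.
rewrite (pf_affine (ss_profile HS)) //.
rewrite Rabs_div; last by lra.
rewrite (Rabs_pos_eq (eps S)); last by lra.
by apply/Rle_div_l; lra.
Qed.

Lemma f_eps_Derive_out (I : finType) (S : surgery I) (p : R) :
  surgery_setup S -> p <= - eps S -> Derive (f_eps S) p = 0.
Proof.
move=> HS Hp; have [? ?] := ss_eps HS.
case: (Req_dec p (- eps S)) => [->|H].
  by apply: f_eps_Derive_side => //; rewrite Rabs_Ropp Rabs_pos_eq; lra.
rewrite f_eps_Derive // (pf_support (ss_profile HS)); first by rewrite Rdiv_0_l.
rewrite Rabs_div; last by lra.
rewrite (Rabs_pos_eq (eps S)); last by lra.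
by apply/Rlt_div_r; [lra|split_Rabs; lra].
Qed.

(** * The integral [H_eps] and the top of the handle *)

Lemma H_integrand_cont (I : finType) (S : surgery I) (p : R) :
  surgery_setup S -> continuous (fun P => P * Derive (f_eps S) P) p.
Proof. by move=> HS; have C := @f_eps_Derive_cont _ S p HS; cont. Qed.

Lemma H_integrand_ex (I : finType) (S : surgery I) (a b : R) :
  surgery_setup S -> ex_RInt (fun P => P * Derive (f_eps S) P) a b.
Proof. by move=> HS; apply: ex_RInt_continuous => z _; exact: H_integrand_cont. Qed.

(** The integrand vanishes below [- eps S], so the improper part contributes 0. *)
Lemma H_eps_RInt (I : finType) (S : surgery I) (p : R) :
  surgery_setup S ->
  H_eps S p = RInt (fun P => P * Derive (f_eps S) P) (- eps S) p.
Proof.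
move=> HS; have [? ?] := ss_eps HS.
set g := fun P => P * Derive (f_eps S) P.
refine (@is_RInt_gen_unique R_CompleteNormedModule (Rbar_locally m_infty) (at_point p) _ _ g _ _).
have -> : RInt g (- eps S) p = plus 0 (RInt g (- eps S) p) by rewrite /plus /= Rplus_0_l.
refine (@is_RInt_gen_Chasles _ _ _ _ _ g (- eps S) 0 _ _ _).
- move=> Q HQ.
  apply: (Filter_prod _ _ _ (fun a => a < - eps S) (fun b => b = - eps S)).
  + by exists (- eps S).
  + by [].
  move=> a b Ha -> /=; exists 0; split; last exact: locally_singleton HQ.
  apply: (is_RInt_ext (fun _ => 0)).
    move=> x; rewrite Rmin_left ?Rmax_right; try lra.
    by move=> Hx; rewrite /g f_eps_Derive_out ?Rmult_0_r //; lra.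
  have := @is_RInt_const R_CompleteNormedModule a (- eps S) 0.
  by rewrite /scal /= /mult /= Rmult_0_r.
- apply/is_RInt_gen_at_point; apply: RInt_correct; exact: H_integrand_ex.
Qed.

Lemma H_eps_cont (I : finType) (S : surgery I) (p : R) :
  surgery_setup S -> continuous (H_eps S) p.
Proof.
move=> HS; set g := fun P => P * Derive (f_eps S) P.
apply: (continuous_ext (fun p => RInt g (- eps S) p)).
  by move=> x; rewrite H_eps_RInt.
apply: ex_derive_continuous; exists (g p).
apply: is_derive_RInt.
- apply: filter_forall => x; apply: RInt_correct; exact: H_integrand_ex.
- exact: H_integrand_cont.
Qed.

Lemma H_eps_m (I : finType) (S : surgery I) : surgery_setup S -> H_eps S (- eps S) = 0.
Proof. by move=> HS; rewrite H_eps_RInt // RInt_point. Qed.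

Lemma f_eps_Derive_even (I : finType) (S : surgery I) (p : R) :
  surgery_setup S -> Derive (f_eps S) (- p) = Derive (f_eps S) p.
Proof.
move=> HS; have [? ?] := ss_eps HS; rewrite !f_eps_Derive //.
have -> : - p / eps S = - (p / eps S) by field; lra.
by rewrite (pf_even (ss_profile HS)).
Qed.

(** The integrand is odd, because the derivative of [f_eps] is even. *)
Lemma H_eps_p (I : finType) (S : surgery I) : surgery_setup S -> H_eps S (eps S) = 0.
Proof.
move=> HS; rewrite H_eps_RInt //; set g := fun P => P * Derive (f_eps S) P.
have E : RInt g (eps S) (- eps S) = RInt g (- eps S) (eps S).
  symmetry; apply: is_RInt_unique.
  apply: (is_RInt_ext (fun y => opp (g (- y)))).
    by move=> x _; rewrite /opp /= /g f_eps_Derive_even // Ropp_mult_distr_l Ropp_involutive.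
  apply: is_RInt_comp_opp; rewrite Ropp_involutive.
  apply: RInt_correct; exact: H_integrand_ex.
have := opp_RInt_swap g (- eps S) (eps S) (H_integrand_ex _ _ HS).
rewrite E /opp /=; lra.
Qed.

(** The integrand is at most eps * (1 / eps) = 1 on an interval of length at most 2 eps. This is
    exactly what keeps the top of the handle from lying below its bottom. *)
Lemma H_eps_bound (I : finType) (S : surgery I) (p : R) :
  surgery_setup S -> Rabs p <= eps S -> Rabs (H_eps S p) <= 2 * eps S.
Proof.
move=> HS /Rabs_le_between Hp; have [? ?] := ss_eps HS; rewrite H_eps_RInt //.
have : Rabs (RInt (fun P => P * Derive (f_eps S) P) (- eps S) p) <= (p - - eps S) * 1.
  apply: abs_RInt_le_const; [lra|exact: H_integrand_ex|].
  move=> t Ht; rewrite f_eps_Derive // Rabs_mult.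
  have R := pf_range (ss_profile HS) (t / eps S).
  rewrite Rabs_div; last by lra.
  rewrite (Rabs_pos_eq (eps S)); last by lra.
  rewrite (Rabs_pos_eq (Derive _ _)); last by lra.
  set D := Derive _ _ in R *.
  have T : Rabs t <= eps S by split_Rabs; lra.
  have T0 := Rabs_pos t.
  have -> : Rabs t * (D / eps S) = (Rabs t * D) / eps S by field; lra.
  apply/Rle_div_l; [lra|nra].
lra.
Qed.

Lemma coef_cases (I : finType) (S : surgery I) (i : I) :
  surgery_setup S -> coef S i <> 0%Z -> IZR (coef S i) = 1 \/ IZR (coef S i) = -1.
Proof.
by move=> HS; case: (ss_coef HS i) => [->|[->|->]] // _; [left|right].
Qed.

Lemma z_top_cont (I : finType) (S : surgery I) (i : I) (p : R) :
  surgery_setup S -> continuous (z_top S i) p.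
Proof. by move=> HS; have C := @H_eps_cont _ S p HS; rewrite /z_top; cont. Qed.

Lemma z_top_ge (I : finType) (S : surgery I) (i : I) (p : R) :
  surgery_setup S -> coef S i <> 0%Z -> Rabs p <= eps S -> - eps S <= z_top S i p.
Proof.
move=> HS Hc Hp; have := H_eps_bound HS Hp; rewrite /z_top.
by case: (coef_cases HS Hc) => ->; split_Rabs; lra.
Qed.

Lemma z_top_side (I : finType) (S : surgery I) (i : I) :
  surgery_setup S -> coef S i <> 0%Z -> z_top S i (- IZR (coef S i) * eps S) = eps S.
Proof.
move=> HS Hc; rewrite /z_top; case: (coef_cases HS Hc) => ->.
- by have -> : - (1) * eps S = - eps S by [ring]; rewrite H_eps_m //; ring.
- by have -> : - -1 * eps S = eps S by [ring]; rewrite H_eps_p //; ring.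
Qed.

(** * The angle of the tangent *)

Lemma tangent_shift (I : finType) (S : surgery I) (i : I) (q : R) (k : Z) :
  surgery_setup S -> tangent (gam S) (i, q + IZR k) = tangent (gam S) (i, q).
Proof. by move=> HS; rewrite !tangent_dproj //= dproj_period. Qed.

Lemma tau_dir (I : finType) (S : surgery I) (tau : I -> R -> R) (P : I * R) :
  tangent_angle (gam S) tau -> dir (tangent (gam S) P) (tau (fst P) (snd P)).
Proof.
case: P => i q H; have [_ E] := H i q; exists 1; split; first by lra.
by rewrite E /= !Rmult_1_l.
Qed.

Lemma tau_cont (I : finType) (S : surgery I) (tau : I -> R -> R) (i : I) (q : R) :
  tangent_angle (gam S) tau -> continuous (tau i) q.
Proof. by move=> H; have [] := H i q. Qed.

(** [tau] need not be periodic, but the tangent is, so both sides are increments of lifts of the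
    same path of lines. *)
Lemma tau_shift (I : finType) (S : surgery I) (tau : I -> R -> R) (i : I)
    (x y : R) (k : Z) :
  surgery_setup S -> tangent_angle (gam S) tau ->
  tau i (y + IZR k) - tau i (x + IZR k) = tau i y - tau i x.
Proof.
move=> HS Ht.
wlog xy : x y / x <= y.
  move=> H; case: (Rle_lt_dec x y) => xy; first exact: H.
  by have := H y x ltac:(lra); lra.
apply: (lift_unique (v := fun s => tangent (gam S) (i, s))
  (phi := fun s => tau i (s + IZR k)) xy).
- apply: continuous_on_of => s _.
  apply: (continuous_comp (fun s => s + IZR k) (tau i)); first by cont.
  exact: tau_cont.
- by apply: continuous_on_of => s _; exact: tau_cont.
- move=> s _; rewrite -(tangent_shift _ _ k HS); exact: (tau_dir (i, s + IZR k) Ht).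
- by move=> s _; exact: (tau_dir (i, s) Ht).
Qed.

Lemma tau_const (I : finType) (S : surgery I) (tau : I -> R -> R) (i : I)
    (v : vec2) (x y : R) :
  surgery_setup S -> tangent_angle (gam S) tau ->
  (forall t, 0 <= t <= 1 -> tangent (gam S) (i, x + t * (y - x)) = v) ->
  tau i y = tau i x.
Proof.
move=> HS Ht Hv.
have := @lift_unique (fun t => tangent (gam S) (i, x + t * (y - x)))
  (fun t => tau i (x + t * (y - x))) (fun _ => tau i x) 0 1 Rle_0_1.
have -> : x + 1 * (y - x) = y by ring.
have -> : x + 0 * (y - x) = x by ring.
move=> H; have : tau i y - tau i x = tau i x - tau i x; last by lra.
apply: H.
- apply: continuous_on_of => s _.
  apply: (continuous_comp (fun t => x + t * (y - x)) (tau i)); first by cont.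
  exact: tau_cont.
- by apply: continuous_on_of => s _; cont.
- by move=> t _; exact: (tau_dir (i, x + t * (y - x)) Ht).
- move=> t Ht1; rewrite (Hv t Ht1) -(Hv 0 ltac:(lra)).
  have -> : x + 0 * (y - x) = x by ring.
  exact: (tau_dir (i, x) Ht).
Qed.

Lemma tau_near (I : finType) (S : surgery I) (tau : I -> R -> R) (e : I * R) (q : R)
    (k : Z) :
  surgery_setup S -> tangent_angle (gam S) tau -> chord_end S e ->
  Rabs (q - snd e - IZR k) <= eps S ->
  tau (fst e) q = tau (fst e) (snd e + IZR k).
Proof.
move=> HS Ht He Hq; apply: (@tau_const _ S tau (fst e) (tangent (gam S) e) _ _ HS Ht) => t Ht1.
apply: (@tangent_near _ S e) => //; split=> //=; exists k.
have -> : snd e + IZR k + t * (q - (snd e + IZR k)) - snd e - IZR k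
  = t * (q - snd e - IZR k) by ring.
rewrite Rabs_mult Rabs_pos_eq; last by lra.
have := Rabs_pos (q - snd e - IZR k); nra.
Qed.

(** The midpoint of [A] and [B] would be within [eps0] of both a tip and a tail. *)
Lemma near_gap (I : finType) (S : surgery I) (a b : chord I) (A B : R) (ka kb : Z) :
  surgery_setup S -> is_chord (gam S) a -> is_chord (gam S) b ->
  fst (tip a) = fst (tail b) ->
  A = snd (tip a) + IZR ka -> B = snd (tail b) + IZR kb ->
  Rabs (B - A) <= 2 * eps0 S -> False.
Proof.
move=> HS Ha Hb E EA EB H.
apply: (@tip_tail_exclusive _ S a b (fst (tip a), (A + B) / 2)) => //.
- split=> //=; exists ka.
  have -> : (A + B) / 2 - snd (tip a) - IZR ka = (B - A) / 2 by rewrite EA; field.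
  by rewrite Rabs_div; [rewrite (Rabs_pos_eq 2); lra|lra].
- split=> //=; exists kb.
  have -> : (A + B) / 2 - snd (tail b) - IZR kb = - ((B - A) / 2) by rewrite EB; field.
  by rewrite Rabs_Ropp Rabs_div; [rewrite (Rabs_pos_eq 2); lra|lra].
Qed.

(* An oriented arc of length at most 1 from near the tip of [a] to near the tail
   of [b] is, up to its ends where the tangent is constant, the embedded arc:
   the rectangles being disjoint, the parameter difference stays in [0, 1). *)
Lemma theta_arc (I : finType) (S : surgery I) (tau : I -> R -> R) (a b : chord I)
    (i : I) (q0 q1 : R) :
  surgery_setup S -> tangent_angle (gam S) tau ->
  is_chord (gam S) a -> is_chord (gam S) b ->
  near (eps S) (tip a) (i, q0) -> near (eps S) (tail b) (i, q1) ->
  0 <= q1 - q0 <= 1 -> tau i q1 - tau i q0 = theta tau a b.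
Proof.
move=> HS Ht Ha Hb [Ea [ka Hka]] [Eb [kb Hkb]] Hq.
change (fst (tip a) = i) in Ea; change (fst (tail b) = i) in Eb.
change (Rabs (q0 - snd (tip a) - IZR ka) <= eps S) in Hka.
change (Rabs (q1 - snd (tail b) - IZR kb) <= eps S) in Hkb.
have [? ?] := ss_eps HS.
have Eab : fst (tip a) = fst (tail b) by rewrite Ea Eb.
have := tau_near HS Ht (chord_end_tip Ha) Hka.
have := tau_near HS Ht (chord_end_tail Hb) Hkb.
rewrite /theta Ea Eb => -> ->.
set A := snd (tip a) + IZR ka; set B := snd (tail b) + IZR kb.
have HA : Rabs (q0 - A) <= eps S.
  by have -> : q0 - A = q0 - snd (tip a) - IZR ka by rewrite /A; ring.
have HB : Rabs (q1 - B) <= eps S.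
  by have -> : q1 - B = q1 - snd (tail b) - IZR kb by rewrite /B; ring.
have G := @near_gap _ S a b _ _ ka kb HS Ha Hb Eab Logic.eq_refl.
have L : 0 <= B - A.
  case: (Rle_lt_dec 0 (B - A)) => // N; exfalso; apply: (G _ Logic.eq_refl).
  rewrite -/A -/B; move: HA HB N; split_Rabs; lra.
have U : B - A < 1.
  case: (Rlt_le_dec (B - A) 1) => // N; exfalso.
  (* Past a full turn, the copy [B - 1] of the tail parameter would come within 2 eps of [A]. *)
  apply: (@near_gap _ S a b A (B - 1) ka (kb - 1) HS Ha Hb Eab Logic.eq_refl).
    by rewrite minus_IZR /B; ring.
  by move: HA HB N; split_Rabs; lra.
have F : B - A = frac_part (snd (tail b) - snd (tip a)).
  have [_ ] := @Int_part_frac_part_spec (snd (tail b) - snd (tip a)) (ka - kb) (B - A)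
    (conj L U) ltac:(rewrite minus_IZR /A /B; ring).
  by [].
rewrite -F -(tau_shift i (snd (tip a)) (snd (tip a) + (B - A)) ka HS Ht).
by congr (tau i _ - tau i _); rewrite /A; ring.
Qed.

(** * The framing *)

Definition standard_at (I : finType) (F : framing I) (x : pt3) : Prop :=
  Xo F x = (1, 0) /\ Yo F x = (0, 1).

Lemma coords_std (V : vec2) : coords (1, 0) (0, 1) V = V.
Proof. by case: V => a b; rewrite /coords /det /=; congr pair; field. Qed.

Lemma coords_at_std (I : finType) (F : framing I) (x : pt3) (V : vec2) :
  standard_at F x -> coords_at F x V = V.
Proof. by move=> [E1 E2]; rewrite /coords_at E1 E2 coords_std. Qed.

(** Coordinates are quotients of determinants, which [L] preserves. With [L] the differential of an
    attaching map, the unknown frame on the boundary of a handle is read off from the standard one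
    outside. *)
Lemma coords_transport (L : vec2 -> vec2) (X Y w : vec2) :
  (forall u v, det (L u) (L v) = det u v) ->
  L X = (1, 0) -> L Y = (0, 1) -> coords X Y w = L w.
Proof.
move=> HL HX HY; rewrite /coords -(HL w Y) -(HL X w) -(HL X Y) HX HY.
by case: (L w) => a b; rewrite /det /=; congr pair; field.
Qed.

Lemma coords_neq0 (X Y w : vec2) :
  det X Y <> 0 -> w <> (0, 0) -> coords X Y w <> (0, 0).
Proof.
case: X => x1 x2; case: Y => y1 y2; case: w => w1 w2.
rewrite /coords /det /= => D W [E1 E2]; apply: W.
set d := x1 * y2 - x2 * y1 in D E1 E2.
have F1 : w1 * y2 - w2 * y1 = 0.
  by have -> : w1 * y2 - w2 * y1 = (w1 * y2 - w2 * y1) / d * d by [field]; rewrite E1; ring.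
have F2 : x1 * w2 - x2 * w1 = 0.
  by have -> : x1 * w2 - x2 * w1 = (x1 * w2 - x2 * w1) / d * d by [field]; rewrite E2; ring.
have G1 : w1 * d = 0.
  have -> : w1 * d = (w1 * y2 - w2 * y1) * x1 + (x1 * w2 - x2 * w1) * y1 by rewrite /d; ring.
  by rewrite F1 F2; ring.
have G2 : w2 * d = 0.
  have -> : w2 * d = (w1 * y2 - w2 * y1) * x2 + (x1 * w2 - x2 * w1) * y2 by rewrite /d; ring.
  by rewrite F1 F2; ring.
by case: (Rmult_integral _ _ G1) => // ->; case: (Rmult_integral _ _ G2) => // ->.
Qed.

Lemma push_top_det (I : finType) (S : surgery I) (i : I) (p q : R) (v w : vec2) :
  surgery_setup S -> Rabs p <= eps S ->
  det (push_top S i p q v) (push_top S i p q w) = det v w.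
Proof. by move=> HS Hp; rewrite /push_top dproj_det // /det /=; ring. Qed.

(** Injectivity of the tube coordinates leaves no other way for the point to lie in a surgered tube
    or near a push-off, and [rho <= eps S / 2] keeps the push-off away from the top, the bottom and
    the opposite side. *)
Lemma standard_Phi (I : finType) (S : surgery I) (tau : I -> R -> R) (F : framing I)
    (i : I) (z p q : R) :
  surgery_setup S -> is_framing S tau F -> Rabs z <= eps S -> Rabs p <= eps S ->
  coef S i = 0%Z \/ Rabs z = eps S \/ p = - IZR (coef S i) * eps S ->
  standard_at F (Phi S i z p q).
Proof.
move=> HS [_ [_ [rho [r0 [r1 [r2 [St _]]]]]]] Hz Hp H; have [e0 e1] := ss_eps HS.
have Inj := tb_injective (ss_tubes HS).
have Hz' : Rabs z <= eps0 S by lra.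
have Hp' : Rabs p <= eps0 S by lra.
apply: St.
- move=> i' Hi' [z' [p' [q' [Hz1 [Hp1 E]]]]].
  have [ii [zz [pp _]]] := Inj i z p q i' z' p' q' Hz' Hp' ltac:(lra) ltac:(lra) E.
  subst i' z' p'; case: H => [//|[H|H]]; first by lra.
  move: Hp1; rewrite H; case: (coef_cases HS Hi') => ->; split_Rabs; lra.
- move=> [i' [z' [p' [q' [Hi' [[Hz1 Hp1] E]]]]]].
  (* The bound [rho <= eps0 S - eps S] keeps the neighborhood of the push-off inside the range of
     injectivity. *)
  have Hp2 : Rabs p' <= eps0 S.
    by move: Hp1; case: (coef_cases HS Hi') => ->; split_Rabs; lra.
  have [ii [zz [pp _]]] := Inj i z p q i' z' p' q' Hz' Hp' ltac:(lra) Hp2 E.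
  subst i' z' p'; case: H => [//|[H|H]]; first by lra.
  move: Hp1; rewrite H; case: (coef_cases HS Hi') => ->; split_Rabs; lra.
Qed.

Lemma standard_link (I : finType) (S : surgery I) (tau : I -> R -> R) (F : framing I)
    (P : I * R) :
  surgery_setup S -> is_framing S tau F -> coef S (fst P) = 0%Z ->
  standard_at F (pos (gam S) P).
Proof.
move=> HS HF H; rewrite /pos -(tb_core (ss_tubes HS)); have [? ?] := ss_eps HS.
by apply: (standard_Phi _ HS HF); [rewrite Rabs_R0; lra| rewrite Rabs_R0; lra|left].
Qed.

Lemma legendrian_line_tangent (I : finType) (S : surgery I) (tau : I -> R -> R)
    (F : framing I) (P : I * R) :
  surgery_setup S -> is_framing S tau F -> coef S (fst P) = 0%Z ->
  legendrian_line S F P = tangent (gam S) P.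
Proof.
by move=> HS HF H; rewrite /legendrian_line coords_at_std //; exact: (standard_link HS HF).
Qed.

(* Ends of outside segments that can occur along a chord of Lambda^0. *)
Definition segment_end (I : finType) (S : surgery I) (i : I) (z p : R) : Prop :=
  Rabs z <= eps S /\ Rabs p <= eps S /\
  (coef S i = 0%Z \/ (Rabs z = eps S /\ Rabs p < eps S / 2)).

(* A third tube over a point of the rectangle of [r] would cross both strands of
   [r] perpendicularly. *)
Lemma standard_segment (I : finType) (S : surgery I) (tau : I -> R -> R)
    (F : framing I) (r : chord I) (i1 i2 : I) (z1 p1 q1 z2 p2 q2 t : R) :
  surgery_setup S -> is_framing S tau F -> is_chord (gam S) r ->
  near (eps S) (tail r) (i1, q1) -> near (eps S) (tip r) (i2, q2) ->
  segment_end S i1 z1 p1 -> segment_end S i2 z2 p2 ->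
  let P := Phi S i1 z1 p1 q1 in
  let Q := Phi S i2 z2 p2 q2 in
  outer_segment S P Q -> 0 <= t <= 1 ->
  standard_at F (xy P, zc P + t * (zc Q - zc P)).
Proof.
move=> HS HF Hr N1 N2 [Hz1 [Hp1 G1]] [Hz2 [Hp2 G2]] P Q [EPQ [LPQ Out]] Ht.
have [e0 e1] := ss_eps HS; have T := ss_tubes HS.
have ee : eps S <= eps0 S by lra.
(* Tubes are excluded strictly between the ends only, so the two ends are treated apart. *)
case: (Req_dec t 0) => [->|t0].
  have -> : (xy P, zc P + 0 * (zc Q - zc P)) = P.
    by rewrite Rmult_0_l Rplus_0_r; case: (P).
  by apply: (standard_Phi _ HS HF) => //; tauto.
case: (Req_dec t 1) => [->|t1].
  have -> : (xy P, zc P + 1 * (zc Q - zc P)) = Q.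
    rewrite EPQ; have -> : zc P + 1 * (zc Q - zc P) = zc Q by ring.
    by case: (Q).
  by apply: (standard_Phi _ HS HF) => //; tauto.
have Hx : zc P < zc P + t * (zc Q - zc P) < zc Q by nra.
have {}Out := Out _ Hx.
case: (HF) => _ [_ [rho [r0 [r1 [r2 [St _]]]]]].
apply: St.
- move=> i Hi [z [p [q [Hz [Hp E]]]]]; apply: (Out i Hi).
  by exists z, p, q; split; [lra|split; [lra|]].
move=> [i [z [p [q [Hi [[Hz Hp] E]]]]]].
have Hp' : Rabs p <= eps0 S.
  by move: Hp; case: (coef_cases HS Hi) => ->; split_Rabs; lra.
have EP : proj S i p q = proj S i1 p1 q1.
  rewrite -(@xy_Phi _ S i z p q) //; last by lra.
  by rewrite -(@xy_Phi _ S i1 z1 p1 q1) //; [rewrite -E|lra|lra].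
have EQ : proj S i p q = proj S i2 p2 q2.
  rewrite -(@xy_Phi _ S i z p q) //; last by lra.
  by rewrite -(@xy_Phi _ S i2 z2 p2 q2) //; [rewrite -E /= EPQ|lra|lra].
(* Near a push-off |p| exceeds eps - rho, hence eps / 2, whereas an end of the segment in a surgered
   tube has |p| < eps / 2. *)
have far : forall i' z' p', segment_end S i' z' p' -> i = i' -> p = p' -> False.
  move=> i' z' p' [_ [_ G]] ii pp; subst i' p'; case: G => [//|[_ G]].
  by move: Hp; case: (coef_cases HS Hi) => ->; split_Rabs; lra.
have M1 := near_mono ee N1; have M2 := near_mono ee N2.
have [[ii [pp _]]|[r' [Hr' D1]]] := tb_overlap T Hp' (ltac:(lra) : Rabs p1 <= eps0 S) EP.
  by apply: (far i1 z1 p1).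
have [[ii [pp _]]|[r'' [Hr'' D2]]] := tb_overlap T Hp' (ltac:(lra) : Rabs p2 <= eps0 S) EQ.
  by apply: (far i2 z2 p2).
(* Overlapping the lower strand of [r] makes the third strand a tip strand; overlapping the upper
   one makes it a tail strand. *)
case: D1 => [[A B]|[A B]]; first exact: (tip_tail_exclusive HS Hr' Hr B M1).
case: D2 => [[A' B']|[A' B']]; last exact: (tip_tail_exclusive HS Hr Hr'' M2 B').
exact: (tip_tail_exclusive HS Hr' Hr'' A A').
Qed.

(** * Crossing a handle *)

Lemma continuous_on_plus (T : UniformSpace) (D : T -> Prop) (f g : T -> R) :
  continuous_on D f -> continuous_on D g -> continuous_on D (fun x => f x + g x).
Proof.
move=> Hf Hg x Dx.
exact (filterlim_comp_2 f g Rplus (Hf x Dx) (Hg x Dx)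
  (@filterlim_plus R_AbsRing R_NormedModule (f x) (g x))).
Qed.

Lemma lift_const (v : R -> vec2) (phi : R -> R) (u : vec2) :
  continuous_on (fun t => 0 <= t <= 1) phi ->
  (forall t, 0 <= t <= 1 -> dir (v t) (phi t)) ->
  (forall t, 0 <= t <= 1 -> v t = u) -> phi 1 = phi 0.
Proof.
move=> C D E.
have H : phi 1 - phi 0 = phi 0 - phi 0; last by lra.
apply: (@lift_unique v phi (fun _ => phi 0) 0 1 Rle_0_1) => //.
- by apply: continuous_on_of => t _; cont.
- by move=> t Ht; rewrite (E t Ht) -(E 0 ltac:(lra)); apply: D; lra.
Qed.

(* The direction of [d_q] in the tube of [Lambda_i], along a path whose [p]
   varies as well, turns as much as the tangent of the core. *)
Lemma dproj_q_lift (I : finType) (S : surgery I) (tau : I -> R -> R) (a b : chord I)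
    (i : I) (p0 q0 p1 q1 A B : R) :
  surgery_setup S -> tangent_angle (gam S) tau ->
  is_chord (gam S) a -> is_chord (gam S) b ->
  near (eps S) (tip a) (i, q0) -> near (eps S) (tail b) (i, q1) ->
  Rabs p0 <= eps S -> Rabs p1 <= eps S ->
  A <= q0 <= B -> A <= q1 <= B -> 0 <= q1 - q0 <= 1 ->
  exists phi, continuous_on (rect (- eps S) (eps S) A B) phi /\
    (forall w, rect (- eps S) (eps S) A B w ->
       dir (dproj S i (fst w) (snd w) (0, 1)) (phi w)) /\
    phi (p1, q1) - phi (p0, q0) = theta tau a b.
Proof.
move=> HS Ht Ha Hb N0 N1 Hp0 Hp1 Hq0 Hq1 H01; have [e0 e1] := ss_eps HS.
have R0 := Hp0; have R1 := Hp1.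
move/Rabs_le_between: R0 => R0; move/Rabs_le_between: R1 => R1.
have [||||phi [Cp Dp]] := @angle_lift2 (fun w => dproj S i (fst w) (snd w) (0, 1))
    (- eps S) (eps S) A B; [lra|lra| | |].
- by apply: continuous_on_of => w _; exact: dproj_cont.
- move=> [p q'] [/= /Rabs_le_between Hp _] E.
  have := dproj_det i q' (1, 0) (0, 1) HS Hp.
  by rewrite E /det /=; lra.
exists phi; split=> //; split=> //.
have sub : forall g : R -> R * R, (forall t, continuous g t) ->
    (forall t, 0 <= t <= 1 -> rect (- eps S) (eps S) A B (g t)) ->
    continuous_on (fun t => 0 <= t <= 1) (fun t => phi (g t)).
  move=> g Cg Hg; apply: continuous_on_comp Cp => //.
  by apply: continuous_on_of => t _.
(* Over the rectangles at both ends the image of d_q does not depend on p, so both ends can be moved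
   to the core p = 0. *)
have E0 : phi (p0, q0) = phi (0, q0).
  have X := @lift_const (fun t => dproj S i (t * p0) q0 (0, 1)) (fun t => phi (t * p0, q0))
    (dproj S i 0 q0 (0, 1)).
  rewrite Rmult_0_l Rmult_1_l in X; apply: X.
  + apply: (sub (fun t => (t * p0, q0))); first by move=> t; cont.
    by move=> t Ht1; split=> //=; nra.
  + by move=> t Ht1; apply: (Dp (t * p0, q0)); split=> //=; nra.
  + move=> t Ht1; rewrite !(dproj_near (e := tip a)) //; try exact: chord_end_tip;
      apply/Rabs_le_between; nra.
have E1 : phi (p1, q1) = phi (0, q1).
  have X := @lift_const (fun t => dproj S i (t * p1) q1 (0, 1)) (fun t => phi (t * p1, q1))
    (dproj S i 0 q1 (0, 1)).
  rewrite Rmult_0_l Rmult_1_l in X; apply: X.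
  + apply: (sub (fun t => (t * p1, q1))); first by move=> t; cont.
    by move=> t Ht1; split=> //=; nra.
  + by move=> t Ht1; apply: (Dp (t * p1, q1)); split=> //=; nra.
  + move=> t Ht1; rewrite !(dproj_near (e := tail b)) //; try exact: chord_end_tail;
      apply/Rabs_le_between; nra.
rewrite E0 E1 -(theta_arc HS Ht Ha Hb N0 N1 H01).
apply: (@lift_unique (fun s => tangent (gam S) (i, s)) (fun s => phi (0, s)) (tau i) q0 q1);
  first by lra.
- apply: (continuous_on_comp (f := fun s => (0, s)) (E := rect (- eps S) (eps S) A B)) => //.
    by apply: continuous_on_of => t _; cont.
  by move=> s Hs; split=> /=; lra.
- by apply: continuous_on_of => s _; exact: tau_cont.
- move=> s Hs; rewrite tangent_dproj //; apply: (Dp (0, s)); split=> /=; lra.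
- by move=> s _; exact: (tau_dir (i, s) Ht).
Qed.

(** A rotation preserves [dot] and [det], so the quotient can be computed in handle coordinates,
    with (0, 1) and [w]. *)
Lemma dproj_near_ratio (I : finType) (S : surgery I) (e : I * R) (i : I) (p q : R)
    (w : vec2) :
  surgery_setup S -> chord_end S e -> near (eps S) e (i, q) -> Rabs p <= eps S ->
  fst w <> 0 ->
  let v := dproj S i p q (0, 1) in
  let u := dproj S i p q w in
  - dot v u / det v u = snd w / fst w.
Proof.
move=> HS He N Hp Hw v u.
have U := chord_end_unit e HS.
rewrite /u /v !(dproj_near (e := e)) //.
move: U; case: (tangent _ e) => v1 v2; case: w Hw {u} => w1 w2 /= Hw.
rewrite /dot /det /= => U.
have -> : (0 * v2 + 1 * v1) * (- (w1 * v1) + w2 * v2) - (- (0 * v1) + 1 * v2) * (w1 * v2 + w2 * v1)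
  = - w1 * (v1 * v1 + v2 * v2) by ring.
have -> : (0 * v2 + 1 * v1) * (w1 * v2 + w2 * v1) + (- (0 * v1) + 1 * v2) * (- (w1 * v1) + w2 * v2)
  = w2 * (v1 * v1 + v2 * v2) by ring.
by rewrite U; field.
Qed.

(** Starting from the side opposite to the push-off makes the arc on top run along the orientation
    for both signs of c. The start is [q] for c = 1 and [q - 1] for c = -1. *)
Lemma q_top_side (I : finType) (S : surgery I) (i : I) (p q : R) :
  surgery_setup S -> coef S i <> 0%Z -> Rabs p <= eps S ->
  let q0 := q_top S i (- IZR (coef S i) * eps S) q in
  (exists k, q0 = q + IZR k) /\ 0 <= q_top S i p q - q0 <= 1 /\
  q - 1 <= q0 <= q + 1 /\ q - 1 <= q_top S i p q <= q + 1.
Proof.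
move=> HS Hc Hp; have := f_eps_01 HS Hp; rewrite /q_top.
case: (coef_cases HS Hc) => -> Hf.
- have -> : - (1) * eps S = - eps S by ring.
  rewrite f_eps_m //; split; [by exists 0%Z; ring|lra].
- have -> : - -1 * eps S = eps S by ring.
  rewrite f_eps_p //; split; [by exists (-1)%Z; ring|lra].
Qed.

Lemma near_shift (I : finType) (e : R) (P : I * R) (i : I) (q : R) (k : Z) :
  near e P (i, q) -> near e P (i, q + IZR k).
Proof.
move=> [E [m Hm]]; split=> //; exists (m + k)%Z; rewrite plus_IZR.
by move: Hm => /=; have -> : q + IZR k - snd P - (IZR m + IZR k) = q - snd P - IZR m by ring.
Qed.

(* The lines over the vertical path through the handle are homotopic, in the
   complement of the push-off, to those over the path that runs along the
   bottom to the side opposite to the push-off, up this side, and back along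
   the top.  On the boundary the frame is known. *)
Lemma handle_lift (I : finType) (S : surgery I) (tau : I -> R -> R) (F : framing I)
    (x : crossing I) (a b : chord I) (w : vec2) (alpha : R) :
  surgery_setup S -> tangent_angle (gam S) tau -> is_framing S tau F ->
  is_chord (gam S) a -> is_chord (gam S) b ->
  coef S (cr_comp x) <> 0%Z -> Rabs (cr_p x) <= eps S ->
  near (eps S) (tip a) (cr_comp x, cr_q x) ->
  near (eps S) (tail b) (cr_comp x, q_top S (cr_comp x) (cr_p x) (cr_q x)) ->
  fst w <> 0 ->
  dir (push_id S (cr_comp x) (cr_p x) (cr_q x) w) alpha ->
  lifts [handle_piece S F x w] alpha
    (alpha + theta tau a b
       + (atan (snd w / fst w + IZR (coef S (cr_comp x)) / eps S)
          - atan (snd w / fst w))).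
Proof.
case: x => i p q /=; set c := IZR (coef S i).
move=> HS Ht HF Ha Hb Hc Hp Na Nb Hw Halpha.
have [e0 e1] := ss_eps HS; have Pr := ss_profile HS; have dl := pf_delta Pr.
have Hpa := pf_flow Pr Ha Hb Hc Hp Na Nb.
have Hp2 : Rabs p < eps S / 2 by nra.
have Cc : c = 1 \/ c = -1 by exact: coef_cases.
set p1 := - c * eps S.
have Hp1 : Rabs p1 = eps S by rewrite /p1; case: Cc => ->; split_Rabs; lra.
have [[k0 Hk0] [Hq01 [Hq0 Hq1]]] := q_top_side q HS Hc Hp.
rewrite -/c -/p1 in Hk0 Hq01 Hq0.
have N0 : near (eps S) (tip a) (i, q_top S i p1 q) by rewrite Hk0; exact: near_shift.
have Hp1' : Rabs p1 <= eps S by lra.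
have [phi2 [Cphi2 [Dphi2 Ephi2]]] :=
  dproj_q_lift HS Ht Ha Hb N0 Nb Hp1' Hp Hq0 Hq1 Hq01.
have [SX [SY [rho [r0 [r1 [r2 [_ [Det _]]]]]]]] := HF.
(* Coordinates of the square: [s] moves p from the actual path ([s = 0]) to the side opposite to the
   push-off ([s = 1]), and [t] runs from the bottom to the top. *)
pose ps s := p + s * (p1 - p).
have Hps : forall s, 0 <= s <= 1 -> Rabs (ps s) <= eps S.
  move=> s Hs; rewrite /ps; apply/Rabs_le_between.
  by move/Rabs_le_between: Hp => ?; move/Rabs_le_between: Hp1' => ?; nra.
(* Since |p| < eps / 2, every [ps s] is at distance at least eps / 2 from c eps. *)
have Far : forall z s, 0 <= s <= 1 -> ~ near_pushoff S rho i z (ps s).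
  move=> z s Hs [_]; rewrite -/c /ps /p1.
  case: Cc => ->; move: Hp2; split_Rabs; nra.
pose zs s t := - eps S + t * (z_top S i (ps s) + eps S).
have Hin : forall s t, 0 <= s <= 1 -> 0 <= t <= 1 -> in_handle S i (zs s t, ps s, q).
  move=> s t Hs Ht1; split; first exact: Hps.
  have := z_top_ge HS Hc (Hps s Hs); rewrite /zs => ?; nra.
pose cl := clamp 0 1.
have Hcl : forall s, 0 <= cl s <= 1 by move=> s; apply: clamp_in; lra.
pose h (m : R * R) := (zs (cl (fst m)) (cl (snd m)), ps (cl (fst m)), q).
have Ccl : forall (f : R * R -> R) m, continuous f m -> continuous (fun m => cl (f m)) m.
  by move=> f m Cf; apply: (continuous_comp f cl) => //; exact: cont_clamp.
have Ch : forall m, continuous h m.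
  move=> m.
  have C1 : continuous (fun m : R * R => cl (fst m)) m by apply: Ccl; cont.
  have C2 : continuous (fun m : R * R => cl (snd m)) m by apply: Ccl; cont.
  have C3 : continuous (fun m : R * R => ps (cl (fst m))) m by rewrite /ps; cont.
  have C4 : continuous (fun m : R * R => z_top S i (ps (cl (fst m)))) m.
    apply: (continuous_comp (fun m : R * R => ps (cl (fst m))) (z_top S i)) => //.
    exact: z_top_cont.
  by rewrite /h /zs; cont.
have hin : forall m, in_handle S i (h m) by move=> m; exact: Hin.
pose G (m : R * R) := coords (Xh F i (h m)) (Yh F i (h m)) w.
have DetG : forall m, det (Xh F i (h m)) (Yh F i (h m)) = 1.
  move=> m; apply: (Det i _ (ps (cl (fst m))) q Hc (hin m)); exact: Far.
have CG : forall m, continuous G m.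
  move=> m.
  have C1 := continuous_of_on (sec_cont_handle SX Hc) hin (Ch m).
  have C2 := continuous_of_on (sec_cont_handle SY Hc) hin (Ch m).
  have D : det (Xh F i (h m)) (Yh F i (h m)) <> 0 by rewrite DetG; lra.
  by rewrite /G /coords; rewrite /det in D *; cont.
have NG : forall m, G m <> (0, 0).
  move=> m; apply: coords_neq0; first by rewrite DetG; lra.
  by move=> E; apply: Hw; rewrite E.
have [|Phi0 [CP DP]] := @angle_lift2 G 0 1 0 1 Rle_0_1 Rle_0_1
  (continuous_on_of (fun m _ => CG m)); first by move=> m _; exact: NG.
have hE : forall s t, 0 <= s <= 1 -> 0 <= t <= 1 -> h (s, t) = (zs s t, ps s, q).
  by move=> s t Hs Ht1; rewrite /h /= /cl !clamp_id.
have edge : forall g : R -> R * R, (forall t, continuous g t) ->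
    (forall t, 0 <= t <= 1 -> rect 0 1 0 1 (g t)) ->
    continuous_on (fun t => 0 <= t <= 1) (fun t => Phi0 (g t)).
  move=> g Cg Hg; apply: continuous_on_comp CP => //.
  by apply: continuous_on_of => t _.
have He0 : Rabs (- eps S) <= eps S by rewrite Rabs_Ropp Rabs_pos_eq; lra.
have He1 : Rabs (eps S) <= eps S by rewrite Rabs_pos_eq; lra.
have St0 : forall p', Rabs p' <= eps S -> standard_at F (Phi S i (- eps S) p' q).
  move=> p' Hp'; apply: (standard_Phi _ HS HF) => //.
  by right; left; rewrite Rabs_Ropp Rabs_pos_eq; lra.
have Bottom : forall s, 0 <= s <= 1 -> G (s, 0) = dproj S i (ps s) q w.
  move=> s Hs; rewrite /G hE //; last by lra.
  have -> : zs s 0 = - eps S by rewrite /zs; ring.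
  have [EX EY] := St0 (ps s) (Hps s Hs).
  rewrite -/(push_id S i (ps s) q w); apply: coords_transport.
  - by move=> u v; rewrite /push_id dproj_det //; exact: Hps.
  - by rewrite -(sec_bottom SX q Hc (Hps s Hs)).
  - by rewrite -(sec_bottom SY q Hc (Hps s Hs)).
have Ps1 : ps 1 = p1 by rewrite /ps; ring.
have Ps0 : ps 0 = p by rewrite /ps; ring.
have Side : forall t, 0 <= t <= 1 -> G (1, t) = dproj S i p1 q w.
  move=> t Ht1; rewrite /G hE //; last by lra.
  have Z : Rabs (zs 1 t) <= eps S.
    rewrite /zs Ps1 /p1 z_top_side //; apply/Rabs_le_between; nra.
  rewrite Ps1; have [EX EY] : standard_at F (Phi S i (zs 1 t) p1 q).
    by apply: (standard_Phi _ HS HF) => //; right; right.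
  rewrite -/(push_id S i p1 q w); apply: coords_transport.
  - by move=> u v; rewrite /push_id dproj_det.
  - by rewrite -(sec_sides SX q Hc Hp1 Z).
  - by rewrite -(sec_sides SY q Hc Hp1 Z).
have Top : forall s, 0 <= s <= 1 -> G (s, 1) = push_top S i (ps s) q w.
  move=> s Hs; rewrite /G hE //; last by lra.
  have -> : zs s 1 = z_top S i (ps s) by rewrite /zs; ring.
  have [EX EY] : standard_at F (Phi S i (eps S) (ps s) (q_top S i (ps s) q)).
    apply: (standard_Phi _ HS HF) => //; first exact: Hps.
    by right; left; rewrite Rabs_pos_eq; lra.
  apply: coords_transport.
  - by move=> u v; rewrite push_top_det //; exact: Hps.
  - by rewrite -(sec_top SX q Hc (Hps s Hs)).
  - by rewrite -(sec_top SY q Hc (Hps s Hs)).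
(* The bottom edge keeps [q] over the rectangle of [a], where the differential does not depend on
   p. *)
have E1 : Phi0 (1, 0) = Phi0 (0, 0).
  apply: (@lift_const (fun s => G (s, 0)) (fun s => Phi0 (s, 0)) (dproj S i p q w)).
  - apply: (edge (fun s => (s, 0))); first by move=> t; cont.
    by move=> t Ht1; split=> /=; lra.
  - by move=> t Ht1; apply: DP; split=> /=; lra.
  - move=> t Ht1; rewrite Bottom // !(dproj_near (e := tip a)) //.
      exact: chord_end_tip.
      exact: chord_end_tip.
      exact: Hps.
have E2 : Phi0 (1, 1) = Phi0 (1, 0).
  apply: (@lift_const (fun t => G (1, t)) (fun t => Phi0 (1, t)) (dproj S i p1 q w)) => //.
  - apply: (edge (fun t => (1, t))); first by move=> t; cont.
    by move=> t Ht1; split=> /=; lra.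
  - by move=> t Ht1; apply: DP; split=> /=; lra.
(* On the top edge the line is followed relative to [vq], the image of d_q. Their determinant is the
   nonzero constant [- fst w], so the relative angle stays on one branch and [lam] is continuous. *)
pose wt s := (fst w, snd w + c * Derive (f_eps S) (ps s) * fst w).
pose vq s := dproj S i (ps s) (q_top S i (ps s) q) (0, 1).
pose uq s := dproj S i (ps s) (q_top S i (ps s) q) (wt s).
pose lam s := phi2 (ps s, q_top S i (ps s) q) - PI / 2
  + atan (- dot (vq s) (uq s) / det (vq s) (uq s)).
have Dq : forall s, 0 <= s <= 1 -> det (vq s) (uq s) = - fst w.
  by move=> s Hs; rewrite /vq /uq dproj_det ?/det /=; [ring|exact: HS|exact: Hps].
have Rq : forall s, 0 <= s <= 1 ->
    rect (- eps S) (eps S) (q - 1) (q + 1) (ps s, q_top S i (ps s) q).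
  move=> s Hs; have [_ [_ [_ B]]] := q_top_side q HS Hc (Hps s Hs).
  by split=> //=; apply/Rabs_le_between; exact: Hps.
have Cps : forall s, continuous ps s by move=> s; rewrite /ps; cont.
have Cqt : forall s, continuous (fun s => q_top S i (ps s) q) s.
  move=> s; rewrite /q_top; cont.
  by apply: (continuous_comp ps (f_eps S)) => //; exact: f_eps_cont.
have Cd : forall u : R -> vec2, (forall s, continuous u s) ->
    forall s, continuous (fun s => dproj S i (ps s) (q_top S i (ps s) q) (u s)) s.
  move=> u Cu s.
  have L : forall y, dproj S i (ps y) (q_top S i (ps y) q) (u y) =
      (fst (u y) * fst (dproj S i (ps y) (q_top S i (ps y) q) (1, 0))
         + snd (u y) * fst (dproj S i (ps y) (q_top S i (ps y) q) (0, 1)),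
       fst (u y) * snd (dproj S i (ps y) (q_top S i (ps y) q) (1, 0))
         + snd (u y) * snd (dproj S i (ps y) (q_top S i (ps y) q) (0, 1))).
    by move=> y; rewrite /dproj /=; congr pair; ring.
  apply: (continuous_ext _ _ _ (fun y => Logic.eq_sym (L y))).
  have C1 : forall v, continuous (fun y => dproj S i (ps y) (q_top S i (ps y) q) v) s.
    move=> v; apply: (continuous_comp (fun y => (ps y, q_top S i (ps y) q))
       (fun m : R * R => dproj S i (fst m) (snd m) v)); last exact: dproj_cont.
    by apply: cont_pair.
  have C10 := C1 (1, 0); have C01 := C1 (0, 1); have Cus := Cu s.
  by cont.
have Cwt : forall s, continuous wt s.
  move=> s; rewrite /wt; cont.
  by apply: (continuous_comp ps (Derive (f_eps S))) => //; exact: f_eps_Derive_cont.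
have Clam : continuous_on (fun s => 0 <= s <= 1) lam.
  apply: continuous_on_plus.
  - apply: (continuous_on_comp (f := fun s => phi2 (ps s, q_top S i (ps s) q))
      (g := fun y => y - PI / 2) (E := fun _ => True)) => //.
    + apply: (continuous_on_comp (f := fun s => (ps s, q_top S i (ps s) q))
        (E := rect (- eps S) (eps S) (q - 1) (q + 1))) => //.
      by apply: continuous_on_of => s _; apply: cont_pair.
    + by apply: continuous_on_of => y _; cont.
  - apply: continuous_on_of => s Hs.
    have C1 : continuous vq s by apply: Cd => y; cont.
    have C2 : continuous uq s by apply: Cd.
    have D := Dq s Hs.
    by rewrite /dot /det in D *; cont; rewrite D; move: Hw; lra.
have E3 : Phi0 (1, 1) - Phi0 (0, 1) = lam 1 - lam 0.
  apply: (@lift_unique (fun s => G (s, 1)) (fun s => Phi0 (s, 1)) lam 0 1 Rle_0_1) => //.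
  - apply: (edge (fun s => (s, 1))); first by move=> t; cont.
    by move=> t Ht1; split=> /=; lra.
  - by move=> t Ht1; apply: DP; split=> /=; lra.
  - move=> s Hs; rewrite Top //; apply: dir_sub_acot; first exact: (Dphi2 _ (Rq s Hs)).
    by have := Dq s Hs; rewrite /uq /wt => ->; move: Hw; lra.
(* The shear adds c / eps here, where [f_eps] is affine, and nothing at the other end of the edge,
   where its derivative vanishes. *)
have L0 : lam 0 = phi2 (p, q_top S i p q) - PI / 2 + atan (snd w / fst w + c / eps S).
  rewrite /lam /vq /uq Ps0 (dproj_near_ratio (e := tail b)) //; last exact: chord_end_tail.
  rewrite /wt Ps0 /= f_eps_Derive_affine //.
  by congr (_ + atan _); field; split=> //; lra.
have L1 : lam 1 = phi2 (p1, q_top S i p1 q) - PI / 2 + atan (snd w / fst w).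
  rewrite /lam /vq /uq Ps1 (dproj_near_ratio (e := tip a)) //; last exact: chord_end_tip.
  rewrite /wt Ps1 /= f_eps_Derive_side //.
  by congr (_ + atan _); field.
have Inc : Phi0 (0, 1) = Phi0 (0, 0) + theta tau a b
    + (atan (snd w / fst w + c / eps S) - atan (snd w / fst w)) by lra.
have D00 : dir (push_id S i p q w) (Phi0 (0, 0)).
  by rewrite /push_id -{1}Ps0 -Bottom; [apply: DP; split=> /=; lra|lra].
(* The angle function on the square is normalized arbitrarily; a multiple of PI moves its start to
   [alpha]. *)
have [k Hk] := dir_unique D00 Halpha.
have L : lifts [handle_piece S F {| cr_comp := i; cr_p := p; cr_q := q |} w]
   (Phi0 (0, 0)) (Phi0 (0, 1)).
  apply: (lifts_one (phi := fun t => Phi0 (0, t))).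
  - apply: (edge (fun t => (0, t))); first by move=> t; cont.
    by move=> t Ht1; split=> /=; lra.
  - move=> t Ht1; have := DP (0, t) ltac:(split=> /=; lra).
    by rewrite /G hE //; [rewrite /zs Ps0 | lra].
have := lifts_shift k L; rewrite -Hk Inc.
have -> // : Phi0 (0, 0) + theta tau a b + (atan (snd w / fst w + c / eps S) - atan (snd w / fst w))
   + IZR k * PI = alpha + theta tau a b + (atan (snd w / fst w + c / eps S) - atan (snd w / fst w)).
by rewrite Hk; ring.
Qed.

(** * Lines along a chord of Lambda^0 *)

Lemma atan_neg_inv_pos (x : R) : 0 < x -> atan (- / x) = atan x - PI / 2.
Proof. by move=> H; rewrite atan_opp atan_inv //; ring. Qed.

Lemma atan_neg_inv_neg (x : R) : x < 0 -> atan (- / x) = atan x + PI / 2.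
Proof.
move=> H; have -> : - / x = / - x by field; lra.
by rewrite atan_inv; [rewrite atan_opp; ring|lra].
Qed.

Lemma neg_inv_small (x : R) : 1 < Rabs x -> Rabs (- / x) < 1.
Proof.
move=> H; rewrite Rabs_Ropp Rabs_inv -Rinv_1.
by apply: Rinv_lt_contravar; lra.
Qed.

(* [slope n u = s] means that the line of [u] is at angle [- PI / 2 + atan s]
   from that of [n]. *)
Definition slope (n u : vec2) : R := - dot n u / det n u.

(** A quarter turn of the reference line exchanges [dot] and [det] up to sign. This passes between
    the tip and the tail as reference direction. *)
Lemma slope_rotate (t n u : vec2) (k : R) :
  k <> 0 -> n = (- k * snd t, k * fst t) -> det t u <> 0 -> slope t u <> 0 ->
  det n u <> 0 /\ slope n u = - / slope t u.
Proof.
case: t => t1 t2; case: u => u1 u2 k0 ->; rewrite /slope /dot /det /= => D T.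
have T0 : t1 * u1 + t2 * u2 <> 0.
  by move=> E; apply: T; rewrite E; field.
have E : - k * t2 * u2 - k * t1 * u1 = - k * (t1 * u1 + t2 * u2) by ring.
have D' : - k * t2 * u2 - k * t1 * u1 <> 0.
  by rewrite E; apply: Rmult_integral_contrapositive; split=> //; lra.
split=> //; rewrite E; field; do! split=> //; lra.
Qed.

Lemma tip_tail_rotate (I : finType) (S : surgery I) (r r' : chord I) :
  surgery_setup S -> is_chord (gam S) r -> is_chord (gam S) r' ->
  let n := tangent (gam S) (tip r) in
  let t := tangent (gam S) (tail r') in
  (exists k, k <> 0 /\ n = (- k * snd t, k * fst t)) /\
  (exists k, k <> 0 /\ t = (- k * snd n, k * fst n)).
Proof.
move=> HS Hr Hr' n t; rewrite /n /t.
have [b [Hb ->]] := tip_tangent HS Hr; have [a [Ha ->]] := tail_tangent HS Hr'.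
have a0 : a <> 0 by nra.
have b0 : b <> 0 by nra.
split=> /=.
- exists (- (b / a)); split; last by congr pair; field.
  apply: Ropp_neq_0_compat; apply: Rmult_integral_contrapositive; split=> //.
  exact: Rinv_neq_0_compat.
- exists (a / b); split; last by congr pair; field.
  apply: Rmult_integral_contrapositive; split=> //; exact: Rinv_neq_0_compat.
Qed.

(** Good position puts all tips on one unoriented line, so the same angle serves along a whole
    word. *)
Lemma dir_tip (I : finType) (S : surgery I) (r r' : chord I) (a : R) :
  surgery_setup S -> is_chord (gam S) r -> is_chord (gam S) r' ->
  dir (tangent (gam S) (tip r)) a -> dir (tangent (gam S) (tip r')) a.
Proof.
move=> HS Hr Hr'; have [b [Hb ->]] := tip_tangent HS Hr.
have [c [Hc ->]] := tip_tangent HS Hr'; move/dirP => [_ D]; apply/dirP; split.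
  by case=> E; rewrite E in Hc; lra.
move: D; rewrite /det /= => D; apply: (Rmult_eq_reg_l b); last by nra.
transitivity (c * (b * sin a - - b * cos a)); first by ring.
by rewrite D; ring.
Qed.

Lemma dir_tail (I : finType) (S : surgery I) (r r' : chord I) (a : R) :
  surgery_setup S -> is_chord (gam S) r -> is_chord (gam S) r' ->
  dir (tangent (gam S) (tail r)) a -> dir (tangent (gam S) (tail r')) a.
Proof.
move=> HS Hr Hr'; have [b [Hb ->]] := tail_tangent HS Hr.
have [c [Hc ->]] := tail_tangent HS Hr'; move/dirP => [_ D]; apply/dirP; split.
  by case=> E; rewrite E in Hc; lra.
move: D; rewrite /det /= => D; apply: (Rmult_eq_reg_l b); last by nra.
transitivity (c * (b * sin a - b * cos a)); first by ring.
by rewrite D; ring.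
Qed.

Lemma dir_rotate (v : vec2) (k a : R) :
  k <> 0 -> dir v a -> dir (- k * snd v, k * fst v) (a + PI / 2).
Proof.
move=> k0 [r [r0 ->]]; exists (k * r); split.
  by apply: Rmult_integral_contrapositive.
by rewrite cos_plus sin_plus cos_PI2 sin_PI2 /=; congr pair; ring.
Qed.

(** Tip and tail lines are perpendicular, so [theta] is an odd multiple of PI / 2 and the floor in
    [rot] drops exactly 1 / 2. *)
Lemma theta_rot (I : finType) (S : surgery I) (tau : I -> R -> R) (a b : chord I) :
  surgery_setup S -> tangent_angle (gam S) tau ->
  is_chord (gam S) a -> is_chord (gam S) b -> fst (tip a) = fst (tail b) ->
  theta tau a b = IZR (rot tau a b) * PI + PI / 2.
Proof.
move=> HS Ht Ha Hb E; have P := PI_RGT_0.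
have T1 := tau_dir (tip a) Ht.
have T2 : dir (tangent (gam S) (tail b))
    (tau (fst (tip a)) (snd (tip a) + frac_part (snd (tail b) - snd (tip a)))).
  rewrite /frac_part.
  have -> : snd (tip a) + (snd (tail b) - snd (tip a) - IZR (Int_part (snd (tail b) - snd (tip a))))
    = snd (tail b) + IZR (- Int_part (snd (tail b) - snd (tip a))) by rewrite opp_IZR; ring.
  set k := (- _)%Z; have := tau_dir (fst (tip a), snd (tail b) + IZR k) Ht.
  by rewrite tangent_shift // E -surjective_pairing.
have [_ [k [k0 Hk]]] := tip_tail_rotate HS Ha Hb.
have := dir_rotate k0 T1; rewrite -Hk => T3.
have [m Hm] := dir_unique T3 T2.
have Th : theta tau a b = IZR m * PI + PI / 2 by rewrite /theta Hm; ring.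
rewrite Th; suff -> : rot tau a b = m by [].
rewrite /rot Th; symmetry; apply: Int_part_spec.
have -> : (IZR m * PI + PI / 2) / PI = IZR m + 1 / 2 by field; lra.
lra.
Qed.

Lemma segment_lift (I : finType) (S : surgery I) (tau : I -> R -> R)
    (F : framing I) (r : chord I) (i1 i2 : I) (z1 p1 q1 z2 p2 q2 : R) (u : vec2) (a : R) :
  surgery_setup S -> is_framing S tau F -> is_chord (gam S) r ->
  near (eps S) (tail r) (i1, q1) -> near (eps S) (tip r) (i2, q2) ->
  segment_end S i1 z1 p1 -> segment_end S i2 z2 p2 ->
  outer_segment S (Phi S i1 z1 p1 q1) (Phi S i2 z2 p2 q2) -> dir u a ->
  lifts [segment_piece F u (Phi S i1 z1 p1 q1) (Phi S i2 z2 p2 q2)] a a.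
Proof.
move=> HS HF Hr N1 N2 G1 G2 O D.
apply: (lifts_one (phi := fun _ => a)); first by apply: continuous_on_of => t _; cont.
move=> t Ht; rewrite /segment_piece coords_at_std //.
exact: (standard_segment HS HF Hr N1 N2 G1 G2 O Ht).
Qed.

Lemma crossing_small (I : finType) (S : surgery I) (a b : chord I) (i : I) (p q : R) :
  surgery_setup S -> is_chord (gam S) a -> is_chord (gam S) b -> coef S i <> 0%Z ->
  Rabs p <= eps S -> near (eps S) (tip a) (i, q) ->
  near (eps S) (tail b) (i, q_top S i p q) -> Rabs p < eps S / 2.
Proof.
move=> HS Ha Hb Hc Hp Na Nb; have [e0 e1] := ss_eps HS.
have dl := pf_delta (ss_profile HS).
have := pf_flow (ss_profile HS) Ha Hb Hc Hp Na Nb; nra.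
Qed.

Lemma segment_end_handle (I : finType) (S : surgery I) (i : I) (z p : R) :
  Rabs z = eps S -> Rabs p < eps S / 2 -> segment_end S i z p.
Proof.
move=> Hz Hp; have := Rabs_pos p => P; split; first by lra.
by split; [lra|right].
Qed.

Lemma segment_end_link (I : finType) (S : surgery I) (i : I) :
  surgery_setup S -> coef S i = 0%Z -> segment_end S i 0 0.
Proof.
by move=> HS H; have [? ?] := ss_eps HS; rewrite /segment_end Rabs_R0;
  split; [lra|split; [lra|left]].
Qed.

Lemma pos_Phi (I : finType) (S : surgery I) (P : I * R) :
  surgery_setup S -> pos (gam S) P = Phi S (fst P) 0 0 (snd P).
Proof. by move=> HS; rewrite (tb_core (ss_tubes HS)). Qed.

Lemma dproj_q_near (I : finType) (S : surgery I) (e : I * R) (i : I) (p q : R) :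
  surgery_setup S -> chord_end S e -> near (eps S) e (i, q) -> Rabs p <= eps S ->
  dproj S i p q (0, 1) = tangent (gam S) e.
Proof.
move=> HS He N Hp; rewrite (dproj_near (e := e)) // (surjective_pairing (tangent _ e)).
by congr pair; rewrite /=; ring.
Qed.

Lemma slope_bottom (I : finType) (S : surgery I) (a : chord I) (i : I) (p q : R) (w : vec2) :
  surgery_setup S -> is_chord (gam S) a -> Rabs p <= eps S ->
  near (eps S) (tip a) (i, q) ->
  let n := tangent (gam S) (tip a) in
  det n (push_id S i p q w) = - fst w /\
  (fst w <> 0 -> slope n (push_id S i p q w) = snd w / fst w).
Proof.
move=> HS Ha Hp N n; have Ea := chord_end_tip Ha; rewrite /n /push_id; split.
- by rewrite -(dproj_q_near HS Ea N Hp) dproj_det // /det /=; ring.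
- by move=> Hw; rewrite -(dproj_near_ratio HS Ea N Hp Hw) (dproj_q_near HS Ea N Hp).
Qed.

Lemma slope_top (I : finType) (S : surgery I) (a b : chord I) (i : I) (p q : R) (w : vec2) :
  surgery_setup S -> is_chord (gam S) a -> is_chord (gam S) b -> coef S i <> 0%Z ->
  Rabs p <= eps S -> near (eps S) (tip a) (i, q) ->
  near (eps S) (tail b) (i, q_top S i p q) ->
  let t := tangent (gam S) (tail b) in
  det t (push_top S i p q w) = - fst w /\
  (fst w <> 0 ->
   slope t (push_top S i p q w) = snd w / fst w + IZR (coef S i) / eps S).
Proof.
move=> HS Ha Hb Hc Hp Na Nb t; have Eb := chord_end_tail Hb; have [e0 e1] := ss_eps HS.
rewrite /t /push_top; split.
- by rewrite -(dproj_q_near HS Eb Nb Hp) dproj_det // /det /=; ring.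
- move=> Hw.
  have Hpa := pf_flow (ss_profile HS) Ha Hb Hc Hp Na Nb.
  rewrite /slope -(dproj_q_near HS Eb Nb Hp) (dproj_near_ratio HS Eb Nb Hp) //=.
  by rewrite f_eps_Derive_affine //; field; split=> //; lra.
Qed.

(** With 2 as bound, a slope in (-1, 1) shifted by c / eps leaves [-1, 1]. *)
Lemma inv_eps_gt2 (I : finType) (S : surgery I) (a : chord I) :
  surgery_setup S -> is_chord (gam S) a -> 2 < 1 / eps S.
Proof.
move=> HS Ha; have := eps0_lt_half HS (chord_end_tip Ha); have [? ?] := ss_eps HS => H.
by apply/Rlt_div_r; lra.
Qed.

Lemma spells_head (I : finType) (S : surgery I) (P Q : I * R) (l : list (crossing I))
    (w : list (chord I)) :
  spells S P l Q w ->
  exists r w', w = r :: w' /\ is_chord (gam S) r /\ near (eps S) (tail r) P.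
Proof.
case: l => [|x l]; case: w => [|r [|r' w]] //=.
- by move=> [? [? ?]]; exists r, [].
- by move=> [? [? [? H]]]; case: l H.
- by move=> [? [? [? H]]]; exists r, (r' :: w).
Qed.

(** The Kronecker delta in [m_index]. *)
Definition flip (I : finType) (S : surgery I) (a : chord I) : Z :=
  if Z.eqb 1 (coef S (fst (tip a))) then 1%Z else 0%Z.

Lemma flip_cases (I : finType) (S : surgery I) (a : chord I) :
  surgery_setup S -> coef S (fst (tip a)) <> 0%Z ->
  (IZR (coef S (fst (tip a))) = 1 /\ IZR (flip S a) = 1) \/
  (IZR (coef S (fst (tip a))) = -1 /\ IZR (flip S a) = 0).
Proof.
by move=> HS; rewrite /flip; case: (ss_coef HS (fst (tip a))) => [->|[->|->]] // _;
  [left|right].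
Qed.

(* Forward, the line over the segment along [r] stays within PI / 4 of the tail
   direction of [r], which is [- PI / 2] from the tip direction, of angle
   [beta]. *)
Lemma forward_lift (I : finType) (S : surgery I) (tau : I -> R -> R) (F : framing I)
    (Q : I * R) (l : list (crossing I)) :
  surgery_setup S -> tangent_angle (gam S) tau -> is_framing S tau F ->
  coef S (fst Q) = 0%Z ->
  forall (i : I) (z p q : R) (r : chord I) (w : list (chord I)) (u v : vec2)
    (ws : list vec2) (beta : R),
  spells S (i, q) l Q (r :: w) -> segment_end S i z p ->
  trajectory S (Phi S i z p q) l (pos (gam S) Q) -> flow_invariant S u l ws v ->
  dir (tangent (gam S) (tip r)) beta ->
  det (tangent (gam S) (tip r)) u <> 0 ->
  Rabs (slope (tangent (gam S) (tip r)) u) < 1 ->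
  let beta' := beta + IZR (m_index S tau (r :: w)) * PI in
  dir (tangent (gam S) Q) beta' /\
  exists s, dir v (beta' - PI / 2 + atan s) /\
    lifts (flow_pieces S F (Phi S i z p q) u l ws (pos (gam S) Q))
      (beta - PI / 2 + atan (slope (tangent (gam S) (tip r)) u))
      (beta' - PI / 2 + atan s).
Proof.
move=> HS Ht HF HQ; have [e0 e1] := ss_eps HS.
elim: l => [|[j pj qj] l IH] i z p q r w u v ws beta Sp Se Tr Fl Db Du Su.
- case: w Sp => [|? ?] // [Hr [Nr Nq]].
  case: ws Fl => [|? ?] //= uv; subst v.
  rewrite Rmult_0_l Rplus_0_r; split.
    by rewrite (tangent_near HS (chord_end_tip Hr)).
  exists (slope (tangent (gam S) (tip r)) u); split; first exact: dir_sub_acot.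
  rewrite /= in Tr; rewrite pos_Phi // in Tr *.
  apply: (segment_lift HS HF Hr Nr _ Se (segment_end_link HS HQ) Tr (dir_sub_acot Db Du)).
  by case: (Q) Nq.
- case: ws Fl => [|w1 ws] //= [Eu Fl].
  case: Sp => [Hr [Nr [Nt Sp]]]; case: Tr => [Hc [Hp [Os Tr]]].
  rewrite /= in Nt Sp Hc Hp Os Tr Eu Fl.
  have [r' [w' [Ew [Hr' Nr']]]] := spells_head Sp; subst w.
  have Sm := crossing_small HS Hr Hr' Hc Hp Nt Nr'.
  have Seb : segment_end S j (- eps S) pj.
    by apply: segment_end_handle => //; rewrite Rabs_Ropp Rabs_pos_eq; lra.
  have Set' : segment_end S j (eps S) pj.
    by apply: segment_end_handle => //; rewrite Rabs_pos_eq; lra.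
  have [Db1 Sb1] := slope_bottom w1 HS Hr Hp Nt.
  have [Dt1 St1] := slope_top w1 HS Hr Hr' Hc Hp Nt Nr'.
  have Hw : fst w1 <> 0 by rewrite Eu Db1 in Du; move: Du; lra.
  have {}Sb1 := Sb1 Hw; have {}St1 := St1 Hw; rewrite -Eu in Sb1.
  set u' := push_top S j pj qj w1 in Dt1 St1 Fl *.
  have Ej : fst (tip r) = j by case: Nt.
  have Ej' : fst (tail r') = j by case: Nr'.
  have G2 := inv_eps_gt2 HS Hr.
  set s := slope _ u in Su Sb1 *.
  set sg := slope _ u' in St1.
  have Th := theta_rot HS Ht Hr Hr' ltac:(by rewrite Ej).
  have Hc' : coef S (fst (tip r)) <> 0%Z by rewrite Ej.
  have Fc := flip_cases HS Hc'; rewrite Ej in Fc.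
  have Esg : sg = s + IZR (coef S j) * (1 / eps S).
    by rewrite St1 Sb1; field; split=> //; lra.
  have Hs : -1 < s < 1 by apply/Rabs_lt_between.
  have Big : 1 < Rabs sg.
    by rewrite Esg; case: Fc => [[-> _]|[-> _]]; split_Rabs; lra.
  have sg0 : sg <> 0 by move=> E; move: Big; rewrite E Rabs_R0; lra.
  have [[k [k0 Hk]] _] := tip_tail_rotate HS Hr' Hr'.
  have Dt0 : det (tangent (gam S) (tail r')) u' <> 0 by rewrite Dt1; move: Hw; lra.
  have [Dn Sn] := slope_rotate k0 Hk Dt0 sg0.
  have Sn1 : Rabs (slope (tangent (gam S) (tip r')) u') < 1.
    by rewrite Sn; exact: neg_inv_small.
  (* The tip lines of [r] and [r'] coincide; this choice of angle modulo PI is the one for which the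
     lifts fit together at the top of the handle. *)
  have Db' : dir (tangent (gam S) (tip r')) (beta + IZR (rot tau r r' + flip S r) * PI).
    by apply: dir_shift; exact: (dir_tip HS Hr Hr' Db).
  have [DQ [s' [Dv L]]] := IH j (eps S) pj _ r' w' u' v ws _ Sp Set' Tr Fl Db' Dn Sn1.
  have Em : beta + IZR (m_index S tau (r :: r' :: w')) * PI
     = beta + IZR (rot tau r r' + flip S r) * PI + IZR (m_index S tau (r' :: w')) * PI.
    have -> : m_index S tau (r :: r' :: w')
      = (rot tau r r' + flip S r + m_index S tau (r' :: w'))%Z by [].
    by rewrite [in LHS]plus_IZR; ring.
  split; first by move: DQ; rewrite -Em.
  exists s'; split; first by move: Dv; rewrite -Em.
  have Du0 : dir u (beta - PI / 2 + atan s) by exact: dir_sub_acot.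
  have L1 : lifts [segment_piece F u (Phi S i z p q) (Phi S j (- eps S) pj qj)]
     (beta - PI / 2 + atan s) (beta - PI / 2 + atan s).
    exact: (segment_lift HS HF Hr Nr Nt Se Seb Os Du0).
  have L2 := @handle_lift _ S tau F {| cr_comp := j; cr_p := pj; cr_q := qj |} r r' w1
     (beta - PI / 2 + atan s) HS Ht HF Hr Hr' Hc Hp Nt Nr' Hw.
  rewrite /= -Eu in L2; have {}L2 := L2 Du0.
  apply: (lifts_app (ps := [_])) L1 _; apply: (lifts_app (ps := [_])) L2 _.
  move: L; rewrite -Em.
  (* The shifted slope [sg] has the sign of c. The quarter turn in [theta] and the one from
     [atan (- / sg)] thus add up to a half turn for c = 1 and cancel for c = -1. *)
  suff -> : beta + IZR (rot tau r r' + flip S r) * PI - PI / 2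
      + atan (slope (tangent (gam S) (tip r')) u')
    = beta - PI / 2 + atan s + theta tau r r'
      + (atan (snd w1 / fst w1 + IZR (coef S j) / eps S) - atan (snd w1 / fst w1)) by [].
  rewrite -St1 -Sb1 Sn -/sg Th plus_IZR.
  case: Fc => [[Ec ->]|[Ec ->]]; rewrite Ec in Esg.
  + by rewrite atan_neg_inv_pos; [field|lra].
  + by rewrite atan_neg_inv_neg; [field|lra].
Qed.

(* Backward, the line over the segment along [r] stays within PI / 4 of the tip
   direction of [r], which is [- PI / 2] from the tail direction, of angle
   [beta]. *)
Lemma backward_lift (I : finType) (S : surgery I) (tau : I -> R -> R) (F : framing I)
    (Q : I * R) (l : list (crossing I)) :
  surgery_setup S -> tangent_angle (gam S) tau -> is_framing S tau F ->
  coef S (fst Q) = 0%Z ->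
  forall (i : I) (z p q : R) (r : chord I) (w : list (chord I)) (u : vec2)
    (ws : list vec2) (beta : R),
  spells S (i, q) l Q (r :: w) -> segment_end S i z p ->
  trajectory S (Phi S i z p q) l (pos (gam S) Q) ->
  flow_invariant S u l ws (tangent (gam S) Q) ->
  dir (tangent (gam S) (tail r)) beta ->
  let t := tangent (gam S) (tail r) in
  det t u <> 0 /\ Rabs (slope t u) < 1 /\
  lifts (flow_pieces S F (Phi S i z p q) u l ws (pos (gam S) Q))
    (beta - PI / 2 + atan (slope t u))
    (beta + IZR (m_index S tau (r :: w)) * PI - PI / 2).
Proof.
move=> HS Ht HF HQ; have [e0 e1] := ss_eps HS.
elim: l => [|[j pj qj] l IH] i z p q r w u ws beta Sp Se Tr Fl Db t.
- case: w Sp => [|? ?] // [Hr [Nr Nq]].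
  case: ws Fl => [|? ?] //= Eu.
  rewrite Rmult_0_l Rplus_0_r.
  have Nu : u = tangent (gam S) (tip r).
    by rewrite Eu (tangent_near HS (chord_end_tip Hr)).
  have [Du Z] : det t u <> 0 /\ slope t u = 0.
    rewrite /slope /t Nu.
    have [b [Hb ->]] := tip_tangent HS Hr; have [a [Ha ->]] := tail_tangent HS Hr.
    have ab : a * - b - a * b <> 0.
      have -> : a * - b - a * b = -2 * (a * b) by ring.
      have a0 : a <> 0 by nra.
      have b0 : b <> 0 by nra.
      by do! (apply: Rmult_integral_contrapositive; split=> //); lra.
    by rewrite /det /dot /=; split=> //; field.
  have Dir : dir u (beta - PI / 2 + atan (slope t u)) by exact: dir_sub_acot.
  rewrite Z atan_0 Rplus_0_r in Dir *; split=> //; split; first by rewrite Rabs_R0; lra.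
  rewrite /= in Tr; rewrite pos_Phi // in Tr *.
  apply: (segment_lift HS HF Hr Nr _ Se (segment_end_link HS HQ) Tr Dir).
  by case: (Q) Nq.
- case: ws Fl => [|w1 ws] //= [Eu Fl].
  case: Sp => [Hr [Nr [Nt Sp]]]; case: Tr => [Hc [Hp [Os Tr]]].
  rewrite /= in Nt Sp Hc Hp Os Tr Eu Fl.
  have [r' [w' [Ew [Hr' Nr']]]] := spells_head Sp; subst w.
  have Sm := crossing_small HS Hr Hr' Hc Hp Nt Nr'.
  have Seb : segment_end S j (- eps S) pj.
    by apply: segment_end_handle => //; rewrite Rabs_Ropp Rabs_pos_eq; lra.
  have Set' : segment_end S j (eps S) pj.
    by apply: segment_end_handle => //; rewrite Rabs_pos_eq; lra.
  have [Db1 Sb1] := slope_bottom w1 HS Hr Hp Nt.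
  have [Dt1 St1] := slope_top w1 HS Hr Hr' Hc Hp Nt Nr'.
  set u' := push_top S j pj qj w1 in Dt1 St1 Fl *.
  have Ej : fst (tip r) = j by case: Nt.
  have Ej' : fst (tail r') = j by case: Nr'.
  have G2 := inv_eps_gt2 HS Hr.
  have Th := theta_rot HS Ht Hr Hr' ltac:(by rewrite Ej).
  have Hc' : coef S (fst (tip r)) <> 0%Z by rewrite Ej.
  have Fc := flip_cases HS Hc'; rewrite Ej in Fc.
  have Db' : dir (tangent (gam S) (tail r')) (beta + IZR (rot tau r r' + flip S r) * PI).
    by apply: dir_shift; exact: (dir_tail HS Hr Hr' Db).
  have [Du' [Su' L]] := IH j (eps S) pj _ r' w' u' ws _ Sp Set' Tr Fl Db'.
  (* The invariant vector is prescribed at the end of the chord, so transversality is inherited from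
     the rest of the word instead of being assumed at its start. *)
  have Hw : fst w1 <> 0 by move=> E; apply: Du'; rewrite Dt1 E; ring.
  have {}Sb1 := Sb1 Hw; have {}St1 := St1 Hw; rewrite -Eu in Sb1 Db1.
  set n := tangent (gam S) (tip r) in Sb1 Db1.
  set s := slope n u in Sb1.
  set sg := slope _ u' in Su' St1 L.
  have Esg : s = sg - IZR (coef S j) * (1 / eps S).
    by rewrite St1 Sb1; field; split=> //; lra.
  have Hs : -1 < sg < 1 by apply/Rabs_lt_between.
  have Big : 1 < Rabs s.
    by rewrite Esg; case: Fc => [[-> _]|[-> _]]; split_Rabs; lra.
  have s0 : s <> 0 by move=> E; move: Big; rewrite E Rabs_R0; lra.
  have [_ [k [k0 Hk]]] := tip_tail_rotate HS Hr Hr.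
  have Dn0 : det n u <> 0 by rewrite Db1; move: Hw; lra.
  have [Dt St] := slope_rotate k0 Hk Dn0 s0.
  rewrite -/t -/s in Dt St.
  split=> //; split; first by rewrite St; exact: neg_inv_small.
  have Du0 : dir u (beta - PI / 2 + atan (slope t u)) by exact: dir_sub_acot.
  have L1 := segment_lift HS HF Hr Nr Nt Se Seb Os Du0.
  have L2 := @handle_lift _ S tau F {| cr_comp := j; cr_p := pj; cr_q := qj |} r r' w1
     (beta - PI / 2 + atan (slope t u)) HS Ht HF Hr Hr' Hc Hp Nt Nr' Hw.
  rewrite /= -Eu in L2; have {}L2 := L2 Du0.
  apply: (lifts_app (ps := [_])) L1 _; apply: (lifts_app (ps := [_])) L2 _.
  have Em : beta + IZR (rot tau r r' + flip S r + m_index S tau (r' :: w')) * PI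
     = beta + IZR (rot tau r r' + flip S r) * PI + IZR (m_index S tau (r' :: w')) * PI.
    by rewrite [in LHS]plus_IZR; ring.
  move: L; rewrite -Em.
  (* Backwards the shift is subtracted, so [s] has the sign of - c, and the two cases of
     [atan (- / s)] are exchanged. *)
  suff -> : beta + IZR (rot tau r r' + flip S r) * PI - PI / 2 + atan sg
    = beta - PI / 2 + atan (slope t u) + theta tau r r'
      + (atan (snd w1 / fst w1 + IZR (coef S j) / eps S) - atan (snd w1 / fst w1)) by [].
  rewrite -St1 -Sb1 St Th plus_IZR.
  case: Fc => [[Ec ->]|[Ec ->]]; rewrite Ec in Esg.
  + by rewrite atan_neg_inv_neg; [field|lra].
  + by rewrite atan_neg_inv_pos; [field|lra].
Qed.

(** * Existence of vector fields invariant under the linearized flow *)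

Lemma dproj_surj (I : finType) (S : surgery I) (i : I) (p q : R) (u : vec2) :
  surgery_setup S -> Rabs p <= eps S -> exists w, dproj S i p q w = u.
Proof.
move=> HS Hp; have D := dproj_det i q (1, 0) (0, 1) HS Hp.
have L : forall a b, dproj S i p q (a, b) =
   (a * fst (dproj S i p q (1, 0)) + b * fst (dproj S i p q (0, 1)),
    a * snd (dproj S i p q (1, 0)) + b * snd (dproj S i p q (0, 1))).
  by move=> a b; rewrite /dproj /=; congr pair; ring.
move: D L; case: (dproj S i p q (1, 0)) => a1 a2; case: (dproj S i p q (0, 1)) => b1 b2.
rewrite /det /= => D L; have D1 : a1 * b2 - a2 * b1 = 1 by lra.
case: u => u1 u2; exists (u1 * b2 - u2 * b1, a1 * u2 - a2 * u1); rewrite L; congr pair.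
- by transitivity (u1 * (a1 * b2 - a2 * b1)); [ring|rewrite D1; ring].
- by transitivity (u2 * (a1 * b2 - a2 * b1)); [ring|rewrite D1; ring].
Qed.

Lemma push_top_surj (I : finType) (S : surgery I) (i : I) (p q : R) (u : vec2) :
  surgery_setup S -> Rabs p <= eps S -> exists w, push_top S i p q w = u.
Proof.
move=> HS Hp; have [[a b] <-] := dproj_surj i (q_top S i p q) u HS Hp.
exists (a, b - IZR (coef S i) * Derive (f_eps S) p * a).
by rewrite /push_top /=; congr (dproj _ _ _ _ _); congr pair; ring.
Qed.

Lemma flow_invariant_forward (I : finType) (S : surgery I) (l : list (crossing I))
    (P Q : pt3) (u : vec2) :
  surgery_setup S -> trajectory S P l Q -> exists ws v, flow_invariant S u l ws v.
Proof.
move=> HS; elim: l P u => [|x l IH] P u /=; first by exists [], u.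
move=> [Hc [Hp [_ Tr]]].
have [w Hw] := dproj_surj (cr_comp x) (cr_q x) u HS Hp.
have [ws [v Fl]] := IH _ (push_top S (cr_comp x) (cr_p x) (cr_q x) w) Tr.
by exists (w :: ws), v.
Qed.

Lemma flow_invariant_backward (I : finType) (S : surgery I) (l : list (crossing I))
    (P Q : pt3) (v : vec2) :
  surgery_setup S -> trajectory S P l Q -> exists u ws, flow_invariant S u l ws v.
Proof.
move=> HS; elim: l P => [|x l IH] P /=; first by exists v, [].
move=> [Hc [Hp [_ Tr]]]; have [u' [ws Fl]] := IH _ Tr.
have [w Hw] := push_top_surj (cr_comp x) (cr_q x) u' HS Hp.
by exists (push_id S (cr_comp x) (cr_p x) (cr_q x) w), (w :: ws); rewrite /= Hw.
Qed.

(** * Broken closed strings *)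

Lemma dir_rotate_angle (v : vec2) (a x : R) : dir v a -> dir (rotate x v) (a + x).
Proof.
case=> r [r0 ->]; exists r; split=> //.
by rewrite /rotate cos_plus sin_plus /=; congr pair; ring.
Qed.

Lemma dir_det (u v : vec2) (a : R) : dir u a -> dir v a -> det u v = 0.
Proof. by case=> r [_ ->] [r' [_ ->]]; rewrite /det /=; ring. Qed.

Lemma dir_det0 (u v : vec2) (a : R) : dir u a -> v <> (0, 0) -> det u v = 0 -> dir v a.
Proof.
case=> r [r0 ->]; case: v => v1 v2 v0; rewrite /det /= => D; apply/dirP; split=> //.
by rewrite /det /=; apply: (Rmult_eq_reg_l r) => //; lra.
Qed.

(** From [e] the line of [v] is at an angle strictly between - PI and 0. Turning clockwise it
    therefore first meets the line of [e] at the angle [beta - PI]. *)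
Lemma smallest_cwP (v e : vec2) (beta s rho : R) :
  dir v (beta - PI / 2 + atan s) -> dir e beta ->
  smallest_cw v e rho <-> rho = PI / 2 + atan s.
Proof.
move=> Dv De; have [B1 B2] := atan_bound s; have P := PI_RGT_0; split.
- move=> [Hr D].
  have D' := dir_det0 (dir_rotate_angle (- rho) Dv) (dir_neq0 De) D.
  have [k Hk] := dir_unique D' De.
  have E : rho + PI / 2 - atan s = IZR k * PI by lra.
  have k0 : (0 < k)%Z by apply: lt_IZR; nra.
  have k2 : (k < 2)%Z by apply: lt_IZR; nra.
  have k1 : k = 1%Z by lia.
  by rewrite k1 in E; lra.
- move=> ->; split; first by lra.
  have D' := dir_rotate_angle (- (PI / 2 + atan s)) Dv.
  have E : beta - PI / 2 + atan s + - (PI / 2 + atan s) = beta + IZR (- 1) * PI by field.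
  rewrite E in D'; exact: (dir_det D' (dir_shift (-1) De)).
Qed.

Lemma cw_lift (e : vec2) (rho a : R) :
  dir e a -> lifts [cw_piece e rho] a (a - rho).
Proof.
move=> D.
have := @lifts_one (cw_piece e rho) (fun t => a + - (t * rho)).
have -> : a + - (0 * rho) = a by ring.
have -> : a + - (1 * rho) = a - rho by ring.
apply.
- by apply: continuous_on_of => t _; cont.
- by move=> t _; exact: dir_rotate_angle.
Qed.

Lemma spells_last (I : finType) (S : surgery I) (P Q : I * R) (l : list (crossing I))
    (w : list (chord I)) :
  spells S P l Q w -> exists r, is_chord (gam S) r /\ near (eps S) (tip r) Q.
Proof.
elim: l P w => [|x l IH] P [|r w] //=.
- by case: w => // [[Hr [_ N]]]; exists r.
- by move=> [_ [_ [_ Sp]]]; exact: IH Sp.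
Qed.

Lemma same_pt_tangent (I : finType) (S : surgery I) (P Q : I * R) :
  surgery_setup S -> same_pt P Q -> tangent (gam S) P = tangent (gam S) Q.
Proof.
move=> HS; case: P => i x; case: Q => j y [/= <- [k ->]].
by rewrite tangent_shift.
Qed.

(** The line starts on the tail direction, with slope 0 from the tip direction of angle
    [a + PI / 2]. The latter advances by m half turns, and the clockwise rotation ends a half turn
    below it: the total is m PI + PI / 2 - PI. *)
Lemma reeb_chord_forward (I : finType) (S : surgery I) (tau : I -> R -> R)
    (F : framing I) (k : reeb_chord I) (w : list (chord I)) (v : vec2) (ws : list vec2)
    (a rho : R) :
  surgery_setup S -> tangent_angle (gam S) tau -> is_framing S tau F ->
  is_reeb_chord S k -> has_word S k w ->
  flow_invariant S (tangent (gam S) (rc_start k)) (rc_cross k) ws v ->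
  dir (tangent (gam S) (rc_start k)) a ->
  let P := pos (gam S) (rc_start k) in
  let Q := pos (gam S) (rc_end k) in
  let a' := a - PI / 2 + IZR (m_index S tau w) * PI in
  dir (tangent (gam S) (rc_end k)) a' /\
  (exists rho, smallest_cw v (tangent (gam S) (rc_end k)) rho) /\
  (smallest_cw v (tangent (gam S) (rc_end k)) rho ->
   lifts (flow_pieces S F P (tangent (gam S) (rc_start k)) (rc_cross k) ws Q
      ++ [cw_piece v rho]) a a').
Proof.
case: k => [[i q] l Q] HS Ht HF [/= Hi [HQ Tr]] Sp Fl Da.
rewrite /has_word /= in Sp.
have [r [w' [Ew [Hr Nr]]]] := spells_head Sp; subst w.
have Et := tangent_near HS (chord_end_tail Hr) Nr.
have [_ [k [k0 Hk]]] := tip_tail_rotate HS Hr Hr.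
have [[k' [k'0 Hk']] _] := tip_tail_rotate HS Hr Hr.
rewrite (pos_Phi (i, q)) // in Tr *.
have Da1 : dir (tangent (gam S) (tip r)) (a + PI / 2).
  by rewrite Hk'; apply: dir_rotate => //; rewrite -Et.
rewrite Et in Fl Da *.
have [Du Z] : det (tangent (gam S) (tip r)) (tangent (gam S) (tail r)) <> 0 /\
    slope (tangent (gam S) (tip r)) (tangent (gam S) (tail r)) = 0.
  have := chord_end_unit (tail r) HS; rewrite /slope Hk' /dot /det.
  case: (tangent _ (tail r)) => v1 v2 /= U.
  have E : - k' * v2 * v2 - k' * v1 * v1 = - k' by rewrite -[RHS]Rmult_1_r -U; ring.
  by rewrite E; split; [lra|field].
have Su : Rabs (slope (tangent (gam S) (tip r)) (tangent (gam S) (tail r))) < 1.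
  by rewrite Z Rabs_R0; lra.
have [DQ [s [Dv L]]] := forward_lift HS Ht HF HQ Sp (segment_end_link HS Hi) Tr Fl Da1 Du Su.
rewrite Z atan_0 in L.
have X := smallest_cwP _ Dv DQ.
split; first by have := dir_shift (-1) DQ; congr (dir _ _); field.
split; first by exists (PI / 2 + atan s); apply/X.
move/X => ->.
have E : a + PI / 2 - PI / 2 + 0 = a by ring.
rewrite E in L; apply: lifts_app L _.
have := cw_lift (PI / 2 + atan s) Dv; congr (lifts _ _ _); field.
Qed.

(** The lift from start to end is traversed in reverse. The tail angle a + PI / 2 - m PI is chosen
    so that this lift ends at [a]; the clockwise rotation then finishes PI below that tail angle. *)
Lemma reeb_chord_backward (I : finType) (S : surgery I) (tau : I -> R -> R)
    (F : framing I) (k : reeb_chord I) (w : list (chord I)) (u : vec2) (ws : list vec2)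
    (a rho : R) :
  surgery_setup S -> tangent_angle (gam S) tau -> is_framing S tau F ->
  is_reeb_chord S k -> has_word S k w ->
  flow_invariant S u (rc_cross k) ws (tangent (gam S) (rc_end k)) ->
  dir (tangent (gam S) (rc_end k)) a ->
  let P := pos (gam S) (rc_start k) in
  let Q := pos (gam S) (rc_end k) in
  let a' := a - PI / 2 - IZR (m_index S tau w) * PI in
  dir (tangent (gam S) (rc_start k)) a' /\
  (exists rho, smallest_cw u (tangent (gam S) (rc_start k)) rho) /\
  (smallest_cw u (tangent (gam S) (rc_start k)) rho ->
   lifts (reverse_pieces (flow_pieces S F P u (rc_cross k) ws Q)
      ++ [cw_piece u rho]) a a').
Proof.
case: k => [[i q] l Q] HS Ht HF [/= Hi [HQ Tr]] Sp Fl Da.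
rewrite /has_word /= in Sp.
have [r [w' [Ew [Hr Nr]]]] := spells_head Sp; subst w.
have [rn [Hrn Nrn]] := spells_last Sp.
have Et := tangent_near HS (chord_end_tail Hr) Nr.
have [_ [k [k0 Hk]]] := tip_tail_rotate HS Hrn Hr.
rewrite (pos_Phi (i, q)) // in Tr *.
set m := m_index S tau (r :: w').
have Db : dir (tangent (gam S) (tail r)) (a + PI / 2 + IZR (- m) * PI).
  apply: dir_shift; rewrite Hk; apply: dir_rotate => //.
  by rewrite -(tangent_near HS (chord_end_tip Hrn) Nrn).
have [Du [Su L]] := backward_lift HS Ht HF HQ Sp (segment_end_link HS Hi) Tr Fl Db.
rewrite Et; have Duu := dir_sub_acot Db Du.
have X := smallest_cwP _ Duu Db.
split; first by have := dir_shift (-1) Db; congr (dir _ _); rewrite opp_IZR; field.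
split; first by eexists; apply/X.
move/X => ->.
have {}L := lifts_reverse L.
have E : a + PI / 2 + IZR (- m) * PI + IZR (m_index S tau (r :: w')) * PI - PI / 2 = a.
  by rewrite opp_IZR -/m; ring.
rewrite E in L; apply: lifts_app L _.
have := cw_lift (PI / 2 + atan (slope (tangent (gam S) (tail r)) u)) Duu.
congr (lifts _ _ _); rewrite opp_IZR /slope; field.
Qed.

Lemma zeta_lift (I : finType) (S : surgery I) (tau : I -> R -> R) (F : framing I)
    (s : bstep I) (a : R) :
  surgery_setup S -> tangent_angle (gam S) tau -> is_framing S tau F ->
  is_bstep S s -> dir (tangent (gam S) (st_comp s, st_path s 0)) a ->
  let a' := a + theta_path tau (st_comp s) (st_path s) in
  dir (tangent (gam S) (st_from s)) a' /\ lifts [zeta_piece S F s] a a'.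
Proof.
move=> HS Ht HF [Hc [Cp [_ Sp]]] Da.
have D : forall t, dir (tangent (gam S) (st_comp s, st_path s t)) (tau (st_comp s) (st_path s t)).
  by move=> t; exact: (tau_dir (_, _) Ht).
have [k Hk] := dir_unique (D 0) Da.
have E : a + theta_path tau (st_comp s) (st_path s)
   = tau (st_comp s) (st_path s 1) + IZR k * PI by rewrite /theta_path Hk; ring.
split; first by rewrite E -(same_pt_tangent HS Sp); apply: dir_shift.
rewrite E {1}Hk; apply: lifts_shift.
apply: (lifts_one (phi := fun t => tau (st_comp s) (st_path s t))).
- apply: (continuous_on_comp (E := fun _ => True) (g := tau (st_comp s)) Cp) => //.
  by apply: continuous_on_of => x _; exact: tau_cont.
- by move=> t _; rewrite /zeta_piece (legendrian_line_tangent HS HF).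
Qed.

Definition step_index (I : finType) (S : surgery I) (tau : I -> R -> R)
    (word : reeb_chord I -> list (chord I)) (s : bstep I) : R :=
  theta_path tau (st_comp s) (st_path s) / PI - 1 / 2
    + st_sign s * IZR (m_index S tau (word (st_chord s))).

Lemma step_lines_ex (I : finType) (S : surgery I) (tau : I -> R -> R) (F : framing I)
    (word : reeb_chord I -> list (chord I)) (s : bstep I) :
  surgery_setup S -> tangent_angle (gam S) tau -> is_framing S tau F ->
  is_bstep S s -> has_word S (st_chord s) (word (st_chord s)) ->
  exists ps, step_lines S F s ps.
Proof.
move=> HS Ht HF [_ [_ [Hk _]]] Hw; rewrite /step_lines.
have [H0 [H1 Tr]] := Hk.
rewrite !(legendrian_line_tangent HS HF) //.
case: (st_fwd s).
- have [ws [v Fl]] := flow_invariant_forward (tangent (gam S) (rc_start (st_chord s))) HS Tr.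
  have [_ [[rho Hr] _]] :=
    reeb_chord_forward 0 HS Ht HF Hk Hw Fl (tau_dir _ Ht).
  eexists; exists (tangent (gam S) (rc_start (st_chord s))), ws, v, rho; split=> //.
  split=> //; split; last by [].
  by rewrite coords_at_std //; exact: (standard_link HS HF).
- have [u [ws Fl]] := flow_invariant_backward (tangent (gam S) (rc_end (st_chord s))) HS Tr.
  have [_ [[rho Hr] _]] :=
    reeb_chord_backward 0 HS Ht HF Hk Hw Fl (tau_dir _ Ht).
  eexists; exists u, ws, (tangent (gam S) (rc_end (st_chord s))), rho; split=> //.
  split=> //; split; last by [].
  by rewrite coords_at_std //; exact: (standard_link HS HF).
Qed.

Lemma step_lines_lift (I : finType) (S : surgery I) (tau : I -> R -> R) (F : framing I)
    (word : reeb_chord I -> list (chord I)) (s : bstep I) (ps : list (R -> vec2)) (a : R) :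
  surgery_setup S -> tangent_angle (gam S) tau -> is_framing S tau F ->
  is_bstep S s -> has_word S (st_chord s) (word (st_chord s)) ->
  step_lines S F s ps -> dir (tangent (gam S) (st_comp s, st_path s 0)) a ->
  let a' := a + step_index S tau word s * PI in
  dir (tangent (gam S) (st_to s)) a' /\ lifts ps a a'.
Proof.
move=> HS Ht HF Hs Hw Hps Da; have P := PI_RGT_0.
have [Dz Lz] := zeta_lift HS Ht HF Hs Da.
have [_ [_ [Hk _]]] := Hs; have [H0 [H1 Tr]] := Hk.
move: Hps Dz; rewrite /step_lines /step_index /st_from /st_to /st_sign.
rewrite !(legendrian_line_tangent HS HF) //.
case: (st_fwd s) => [[u [ws [v [rho [Fl [Eu [Hr ->]]]]]]]|[u [ws [v [rho [Fl [Ev [Hr ->]]]]]]]] Dz.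
- rewrite coords_at_std in Hr *; last exact: (standard_link HS HF).
  subst u.
  have [D [_ L]] := reeb_chord_forward rho HS Ht HF Hk Hw Fl Dz.
  have E : a + (theta_path tau (st_comp s) (st_path s) / PI - 1 / 2 +
      1 * IZR (m_index S tau (word (st_chord s)))) * PI
    = a + theta_path tau (st_comp s) (st_path s) - PI / 2
      + IZR (m_index S tau (word (st_chord s))) * PI by field; lra.
  rewrite E; split=> //; apply: (lifts_app (ps := [_])) Lz _; exact: L.
- rewrite coords_at_std in Hr *; last exact: (standard_link HS HF).
  subst v.
  have [D [_ L]] := reeb_chord_backward rho HS Ht HF Hk Hw Fl Dz.
  have E : a + (theta_path tau (st_comp s) (st_path s) / PI - 1 / 2 +
      -1 * IZR (m_index S tau (word (st_chord s)))) * PI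
    = a + theta_path tau (st_comp s) (st_path s) - PI / 2
      - IZR (m_index S tau (word (st_chord s))) * PI by field; lra.
  rewrite E; split=> //; apply: (lifts_app (ps := [_])) Lz _; exact: L.
Qed.

Lemma chained_lift (I : finType) (S : surgery I) (tau : I -> R -> R) (F : framing I)
    (word : reeb_chord I -> list (chord I)) (b : list (bstep I)) (P Q : I * R)
    (pss : list (list (R -> vec2))) (a : R) :
  surgery_setup S -> tangent_angle (gam S) tau -> is_framing S tau F ->
  List.Forall (is_bstep S) b ->
  (forall s, In s b -> has_word S (st_chord s) (word (st_chord s))) ->
  chained P b Q -> Forall2 (step_lines S F) b pss -> dir (tangent (gam S) P) a ->
  let a' := a + Rsum (map (step_index S tau word) b) * PI in
  dir (tangent (gam S) Q) a' /\ lifts (concat pss) a a'.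
Proof.
move=> HS Ht HF Hb Hw Ch Hpss.
elim: Hpss P a Hb Hw Ch => [|s ps b' pss' Hs _ IH] P a Hb Hw /= Ch Da.
- rewrite Rmult_0_l Rplus_0_r -(same_pt_tangent HS Ch); split=> //; exact: lifts_nil.
- have [PS Ch'] := Ch; rewrite (same_pt_tangent HS PS) in Da.
  have Hb1 : is_bstep S s by exact: List.Forall_inv Hb.
  have Hb2 := List.Forall_inv_tail Hb.
  have [D L] := step_lines_lift HS Ht HF Hb1 (Hw s (or_introl Logic.eq_refl)) Hs Da.
  have [D' L'] := IH _ _ Hb2 (fun s' H => Hw s' (or_intror H)) Ch' D.
  have E : a + (step_index S tau word s + Rsum (map (step_index S tau word) b')) * PI
    = a + step_index S tau word s * PI + Rsum (map (step_index S tau word) b') * PI by ring.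
  rewrite E; split=> //; exact: lifts_app L L'.
Qed.

Lemma step_lines_list_ex (I : finType) (S : surgery I) (tau : I -> R -> R) (F : framing I)
    (word : reeb_chord I -> list (chord I)) (b : list (bstep I)) :
  surgery_setup S -> tangent_angle (gam S) tau -> is_framing S tau F ->
  List.Forall (is_bstep S) b ->
  (forall s, In s b -> has_word S (st_chord s) (word (st_chord s))) ->
  exists pss, Forall2 (step_lines S F) b pss.
Proof.
move=> HS Ht HF; elim=> [|s b' Hs _ IH] Hw; first by exists [].
have [ps Hps] := step_lines_ex HS Ht HF Hs (Hw s (or_introl Logic.eq_refl)).
have [pss Hpss] := IH (fun s' H => Hw s' (or_intror H)).
by exists (ps :: pss); constructor.
Qed.

Theorem theorem7p2 (I : finType) (S : surgery I) (tau : I -> R -> R)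
    (F : framing I) (b : list (bstep I))
    (word : reeb_chord I -> list (chord I))
    (HS : surgery_setup S)
    (Htau : tangent_angle (gam S) tau)
    (HF : is_framing S tau F)
    (Hb : broken_closed_string S b)
    (Hword : forall s, In s b -> has_word S (st_chord s) (word (st_chord s))) :
  exists M : Z, unique (maslov_index S F b) M /\
    IZR M = Rsum (map (fun s =>
      theta_path tau (st_comp s) (st_path s) / PI - 1 / 2
        + st_sign s * IZR (m_index S tau (word (st_chord s)))) b).
Proof.
have P := PI_RGT_0.
rewrite -/(step_index S tau word).
have [Hs Hch] := Hb.
have [pss Hpss] := step_lines_list_ex HS Htau HF Hs Hword.
have [P0 Ch] : exists P0, chained P0 b P0.
  by move: Hch; case: (b) => // s b' Ch; eexists; exact: Ch.
have D0 := tau_dir P0 Htau.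
have Lift := fun qss H => chained_lift (pss := qss) HS Htau HF Hs Hword Ch H D0.
have [D1 L1] := Lift pss Hpss.
(* The string closes up, so both angles belong to the same line; this makes the sum an integer. *)
have [M HM] := dir_unique D0 D1.
have EM : IZR M = Rsum (map (step_index S tau word) b).
  by apply: (Rmult_eq_reg_r PI); lra.
exists M; split=> //; split.
- by exists pss; split=> //; exists (tau (fst P0) (snd P0)); rewrite EM.
(* The increment was computed for every admissible list of pieces, so another choice of invariant
   vectors or lifts yields the same degree. *)
- move=> M' [pss' [Hpss' [a' L']]].
  have [_ L2] := Lift pss' Hpss'.
  have E := lifts_increment L2 L'; apply: eq_IZR.
  by rewrite EM; apply: (Rmult_eq_reg_r PI); lra.
Qed.
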